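(* Consider the catenoids $\{\mathcal{C}_a,\ a>0\}$ in the Heisenberg group $\mathrm{Nil}(3)$ with the left-invariant metric $\hat g$. (i) For all $a>0$, the catenoid $\mathcal{C}_a$ has finite Morse index, at least equal to $3$ and at most equal to $1+2[\sqrt{a^2+2}]$, where $[x]$ is the integer part of $x$. In particular, the index of $\mathcal{C}_a$ is equal to $3$ for $a$ close to zero. (ii) When $a$ tends to infinity, the index of $\mathcal{C}_a$ grows at least like $\sqrt3\,a$, i.e. $\liminf_{a\to\infty}\mathrm{Ind}(\mathcal{C}_a)/a\ge\sqrt3$. In particular, the index tends to infinity when $a$ tends to infinity.
   Context: $\mathrm{Nil}(3)$ is $\mathbb{R}^3$ with the group law $(x,y,z)\star(x',y',z')=(x+x',y+y',z+z'+\frac12(xy'-x'y))$, equipped with the left-invariant Riemannian metric $\hat g=dx^2+dy^2+\big(dz+\frac12(y\,dx-x\,dy)\big)^2$. For $a>0$, $f(a,\cdot):\mathbb{R}\to[a,\infty)$ denotes the unique global solution of the Cauchy problem $f(f^2+4)f_{tt}=4(1+f_t^2)$, $f(0)=a$, $f_t(0)=0$ (subscript $t$ denotes derivative in $t$). The catenoid $\mathcal{C}_a$ is the complete minimal surface given by the map $\mathcal{F}(a,t,\theta)=(f(a,t)\cos\theta,f(a,t)\sin\theta,t)$, $t\in\mathbb{R}$, $\theta\in[0,2\pi]$. For an orientable minimal surface $M$ immersed in an oriented Riemannian $3$-manifold, with unit normal $N_M$ and second fundamental form $A_M$, the Jacobi operator is $J_M=-\Delta_M-(|A_M|^2+\widehat{\mathrm{Ric}}(N_M))$,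 where $\Delta_M$ is the non-positive Laplacian of the induced metric and $\widehat{\mathrm{Ric}}(N_M)$ is the ambient Ricci curvature in the direction $N_M$. For a relatively compact regular domain $\Omega\subset M$, $\mathrm{Ind}(\Omega)$ is the number of negative eigenvalues (counted with multiplicity) of $J_M$ for the Dirichlet problem in $\Omega$, and the Morse index of $M$ is $\mathrm{Ind}(M)=\sup\{\mathrm{Ind}(\Omega):\Omega\Subset M\}\le\infty$, the supremum being over all relatively compact regular domains. *)

(* Defs.v *)
From HB Require Import structures.
From mathcomp Require Import all_boot all_order all_algebra.
From mathcomp Require Import all_classical all_reals all_analysis.

Set Implicit Arguments.
Unset Strict Implicit.
Unset Printing Implicit Defensive.

Import Order.TTheory GRing.Theory Num.Theory.
Import numFieldNormedType.Exports.

Local Open Scope classical_set_scope.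
Local Open Scope ring_scope.

Section Calculus.
Context {R : realType} {n : nat}.
Implicit Types (x : 'rV[R]_n.+1) (D : set 'rV[R]_n.+1).

Definition evec (i : 'I_n.+1) : 'rV[R]_n.+1 := delta_mx 0 i.

Definition partial {V : normedModType R} (i : 'I_n.+1) (h : 'rV[R]_n.+1 -> V)
  : 'rV[R]_n.+1 -> V := 'D_(evec i) h.

(* [Ck k D h]: h is of class C^k at every point of D; meaningful for D open. *)
Fixpoint Ck (k : nat) D (h : 'rV[R]_n.+1 -> R) : Prop :=
  (forall x, D x -> {for x, continuous h}) /\
  if k is k'.+1 then
    forall i, (forall x, D x -> derivable h x (evec i)) /\ Ck k' D (partial i h)
  else True.

End Calculus.

Section AmbientCurvature.
Context {R : realType} {n : nat}.
Variable g : 'rV[R]_n.+1 -> 'M[R]_n.+1.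
Implicit Types (x v w : 'rV[R]_n.+1).

Definition inner x v w : R := (v *m g x *m w^T) 0 0.

Definition christoffel (k i j : 'I_n.+1) x : R :=
  2^-1 * \sum_(l < n.+1) invmx (g x) k l *
    (partial i (fun y => g y j l) x + partial j (fun y => g y i l) x
     - partial l (fun y => g y i j) x).

(* Sign convention: the round sphere has positive Ricci curvature. *)
Definition ricci_tensor x : 'M[R]_n.+1 := \matrix_(j, k)
  (\sum_(i < n.+1) (partial i (christoffel i j k) x
                    - partial j (christoffel i k i) x)
   + \sum_(i < n.+1) \sum_(p < n.+1)
       (christoffel i i p x * christoffel p j k x
        - christoffel i j p x * christoffel p i k x)).

Definition ricci x v : R := (v *m ricci_tensor x *m v^T) 0 0.

End AmbientCurvature.

Section ImmersedSurface.
Context {R : realType}.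
Variables (g : 'rV[R]_3 -> 'M[R]_3) (F : 'rV[R]_2 -> 'rV[R]_3).
Implicit Types (q : 'rV[R]_2) (u : 'rV[R]_2 -> R).

Definition tangent (i : 'I_2) q : 'rV[R]_3 := partial i F q.

Definition jacobian_rows q : 'M[R]_(2, 3) := \matrix_(i, k) tangent i q 0 k.

Definition first_form q : 'M[R]_2 :=
  \matrix_(i, j) inner g (F q) (tangent i q) (tangent j q).

(* The covector v |-> det (F_0, F_1, v) annihilates the tangent plane; the
   unit normal is its normalised g-dual vector. *)
Definition conormal q : 'rV[R]_3 :=
  \row_k \det (col_mx (jacobian_rows q) (evec k) : 'M[R]_3).

Definition normal q : 'rV[R]_3 := conormal q *m invmx (g (F q)).

Definition unit_normal q : 'rV[R]_3 :=
  (Num.sqrt (inner g (F q) (normal q) (normal q)))^-1 *: normal q.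

(* Ambient Levi-Civita derivative of the coordinate field F_j along F_i. *)
Definition ambient_deriv (i j : 'I_2) q : 'rV[R]_3 :=
  partial i (tangent j) q +
  \row_k \sum_(l < 3) \sum_(m < 3)
    christoffel g k l m (F q) * tangent i q 0 l * tangent j q 0 m.

Definition second_form q : 'M[R]_2 :=
  \matrix_(i, j) inner g (F q) (ambient_deriv i j q) (unit_normal q).

Definition second_form_sqnorm q : R :=
  \sum_(i < 2) \sum_(j < 2) \sum_(k < 2) \sum_(l < 2)
    invmx (first_form q) i k * invmx (first_form q) j l
    * second_form q i j * second_form q k l.

Definition laplacian u q : R :=
  (Num.sqrt (\det (first_form q)))^-1 *
  \sum_(i < 2) \sum_(j < 2)
    partial i (fun y => Num.sqrt (\det (first_form y))
                        * invmx (first_form y) i j * partial j u y) q.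

Definition jacobi_operator u q : R :=
  - laplacian u q
  - (second_form_sqnorm q + ricci g (F q) (unit_normal q)) * u q.

End ImmersedSurface.

Section SurfacesOfRevolution.
Context {R : realType}.

Definition revolution (h : R -> R) (q : 'rV[R]_2) : 'rV[R]_3 :=
  let t := q 0 0 in let theta := q 0 1 in
  \row_k [:: h t * cos theta; h t * sin theta; t]`_k.

(* The parameter surface is the cylinder R x (R / 2 pi Z), handled through its
   universal cover: subsets and functions are lifted to 2 pi-periodic ones,
   and connectedness and compactness are read on the image under [to_cylinder], which
   identifies the quotient with the unit cylinder. *)
Definition to_cylinder : 'rV[R]_2 -> 'rV[R]_3 := revolution (fun=> 1).

Definition turn : 'rV[R]_2 := (2 * pi) *: evec 1.

Definition smooth_boundary (D : set 'rV[R]_2) : Prop :=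
  forall p, closure D p -> ~ D p ->
  exists (U : set 'rV[R]_2) (phi : 'rV[R]_2 -> R),
    [/\ open U, U p, (forall k, Ck k U phi),
        (exists i, partial i phi p != 0)
      & forall q, U q -> (D q <-> phi q < 0)].

Definition regular_domain (D : set 'rV[R]_2) : Prop :=
  [/\ (forall q, D (q + turn) <-> D q), open D /\ D !=set0,
      connected (to_cylinder @` D), compact (closure (to_cylinder @` D))
    & smooth_boundary D].

End SurfacesOfRevolution.

Section MorseIndex.
Context {R : realType}.
Variables (g : 'rV[R]_3 -> 'M[R]_3) (F : 'rV[R]_2 -> 'rV[R]_3).

Definition lin_indep {T : Type} (m : nat) (u : 'I_m -> T -> R) : Prop :=
  forall c : 'I_m -> R, (forall x, \sum_(i < m) c i * u i x = 0) ->
  forall i, c i = 0.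

Definition dimension {T : Type} (E : set (T -> R)) : \bar R :=
  ereal_sup [set m%:R%:E | m in
    [set m | exists u : 'I_m -> T -> R, (forall i, E (u i)) /\ lin_indep u]].

(* Classical Dirichlet eigenfunctions, in C^2(D) and C^0(closure D) with zero
   boundary values. Such a function is identified with its extension by zero,
   which is continuous on the whole surface. *)
Definition dirichlet_eigenspace (D : set 'rV[R]_2) (lambda : R)
  : set ('rV[R]_2 -> R) :=
  [set u | [/\ continuous u, (forall q, u (q + turn) = u q),
               (forall q, ~ D q -> u q = 0), Ck 2 D u
             & forall q, D q -> jacobi_operator g F u q = lambda * u q]].

Definition domain_index (D : set 'rV[R]_2) : \bar R :=
  \esum_(lambda in [set l : R | l < 0]) dimension (dirichlet_eigenspace D lambda).

Definition morse_index : \bar R :=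
  ereal_sup [set domain_index D | D in regular_domain].

End MorseIndex.

Section Nil3Catenoids.
Context {R : realType}.

(* dx^2 + dy^2 + eta^2 with eta = dz + (y dx - x dy) / 2; covectors are rows. *)
Definition nil3_metric (p : 'rV[R]_3) : 'M[R]_3 :=
  let x := p 0 0 in let y := p 0 1 in
  let dx : 'rV[R]_3 := evec 0 in
  let dy : 'rV[R]_3 := evec 1 in
  let dz : 'rV[R]_3 := evec 2%:R in
  let eta := dz + 2^-1 *: (y *: dx - x *: dy) in
  dx^T *m dx + dy^T *m dy + eta^T *m eta.

(* [h] is the global solution f(a, .), with values in [a, +oo). *)
Definition catenoid_profile (a : R) (h : R -> R) : Prop :=
  [/\ (forall t, a <= h t),
      (forall t, derivable h t 1 /\ derivable (derive1 h) t 1),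
      (forall t, h t * (h t ^+ 2 + 4) * derive1 (derive1 h) t
                 = 4 * (1 + derive1 h t ^+ 2))
    & h 0 = a /\ derive1 h 0 = 0].

Definition catenoid_index (h : R -> R) : \bar R :=
  morse_index nil3_metric (revolution h).

End Nil3Catenoids.

(* Main.v *)
Require Import Defs.
From HB Require Import structures.
From mathcomp Require Import all_boot all_order all_algebra.
From mathcomp Require Import all_classical all_reals all_analysis.
From mathcomp Require Import ring lra zify.
Import Order.TTheory GRing.Theory Num.Theory.
Import numFieldNormedType.Exports.
Local Open Scope classical_set_scope.
Local Open Scope ring_scope.

(** In the coordinates [t] (height) and [theta] of the catenoid, the Jacobi
   operator [J] satisfies ([jacobiE])

     [dens * J u = - (A u_t + (a / 2) u_theta)_t - ((a / 2) u_t + C u_theta)_theta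
                   - (W / A) u],

   where [A = cond], [C = cocond] and [W = pot] depend on the height only and
   [A * C - a ^ 2 / 4 = 1]. The mixed terms disappear in the twisted angle
   [theta - Phi t], where [Phi' = a / (2 A)]; a function [y] of the height times a
   cosine or sine of frequency [k] in this angle is an eigenfunction when
   [(A y')' = ((k ^ 2 - W) / A - lam * dens) y]. Everything rests on the bounds
   [a ^ 2 <= W <= a ^ 2 + 2] and on the explicit Jacobi fields that come from
   translations of the ambient space: [vert], of frequency [0], and [horiz], of
   frequency [1].

   Lower bound. Suppose that for the frequency [K] and [lam = 0] the separated
   equation has an even subsolution with a positive zero. By shooting, each
   frequency [k <= K] then has a negative eigenvalue with a positive [y] in a
   common band [|t| < T]. These eigenvalues differ from each other, and have
   multiplicity at least [2] for [k > 0], so the index is at least [1 + 2 K]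
   ([index_ge]). The field [horiz] is such a subsolution for [K = 1]. If
   [4 K ^ 2 + 4 < 3 a ^ 2], there is one of the form [cos (2 nu Phi / a)]
   ([index_ge_large]), because [Phi] becomes large enough; this yields the growth
   rate [sqrt 3].

   Upper bound. Let [K] be the integer part of [sqrt (a ^ 2 + 2)]. The index form
   is nonnegative on the functions whose [2 K + 1] modes of frequency at most [K]
   vanish on the circle [t = 0] ([index_form_ge0]). Indeed, on each circle the
   higher modes contribute a nonnegative amount by Wirtinger's inequality, since
   [W < (K + 1) ^ 2]; and each lower mode is a function of the height that
   vanishes at [0], for which the one-dimensional form is nonnegative by Picone's
   identity for [vert], a solution of frequency [0] without zeros on either side
   of [t = 0]. Hence there cannot be [2 K + 2] independent eigenfunctions with
   negative eigenvalues ([no_large_family]): some combination of them would satisfy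
   the [2 K + 1] conditions.

   Eigenfunctions are only assumed to be continuous up to the boundary, which makes
   the integrations by parts in the last step delicate. They are done under a
   cutoff applied to the sum of the squares of the eigenfunctions. It is
   logarithmic in that sum, so that its derivative is small against the Dirichlet
   energy, and this energy is bounded independently of the cutoff, since the
   eigenvalues are negative ([grad_bound]). The coefficients of the combination
   depend on the cutoff, but range in a compact sphere. *)

Set Implicit Arguments.
Unset Strict Implicit.
Unset Printing Implicit Defensive.


(** * Continuity, derivatives and primitives *)

(** [is_derive] is a type class; under this name its instances are never
   searched for. *)
Definition has_deriv {R : realType} {V W : normedModType R} (x v : V)
  (f : V -> W) (d : W) : Prop := is_derive x v f d.

Section PointwiseContinuity.
Context {R : realType} {T : topologicalType}.
Implicit Types f g : T -> R.

Lemma continuous_cst (c : R) : continuous (fun _ : T => c).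
Proof. by move=> x; exact: cvg_cst. Qed.

Lemma continuous_add f g : continuous f -> continuous g ->
  continuous (fun x => f x + g x).
Proof. by move=> hf hg x; apply: cvgD; [exact: hf|exact: hg]. Qed.

Lemma continuous_opp f : continuous f -> continuous (fun x => - f x).
Proof. by move=> hf x; apply: cvgN; exact: hf. Qed.

Lemma continuous_mul f g : continuous f -> continuous g ->
  continuous (fun x => f x * g x).
Proof. by move=> hf hg x; apply: cvgM; [exact: hf|exact: hg]. Qed.

Lemma continuous_expn f n : continuous f -> continuous (fun x => f x ^+ n).
Proof.
move=> hf; elim: n => [|n IH] x; first exact: cvg_cst.
by under eq_fun do rewrite exprS; apply: cvgM; [exact: hf|exact: IH].
Qed.

Lemma continuous_inv f : (forall x, f x != 0) -> continuous f ->
  continuous (fun x => (f x)^-1).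
Proof. by move=> f0 hf x; apply: cvgV; [exact: f0|exact: hf]. Qed.

Lemma continuous_sum n (f : 'I_n -> T -> R) : (forall i, continuous (f i)) ->
  continuous (fun x => \sum_i f i x).
Proof.
elim: n f => [|n IH] f hf.
  by under eq_fun do rewrite big_ord0; exact: continuous_cst.
under eq_fun do rewrite big_ord_recl.
by apply: continuous_add => //; apply: IH.
Qed.

Lemma continuous_after (g : R -> R) f : continuous g -> continuous f ->
  continuous (fun x => g (f x)).
Proof. by move=> hg hf x; apply: continuous_comp; [exact: hf|exact: hg]. Qed.

End PointwiseContinuity.

Lemma continuous_ident {R : realType} : continuous (fun x : R => x).
Proof. by move=> x; exact: cvg_id. Qed.

Section PointwiseDerivatives.
Context {R : realType} {V : normedModType R}.
Implicit Types (f g : V -> R) (x v : V).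

Lemma pderiveC (c : R) x v : has_deriv x v (fun _ => c) 0.
Proof. exact: is_derive_cst. Qed.

Lemma pderive_id (x v : R) : has_deriv x v (fun y => y) v.
Proof. exact: is_derive_id. Qed.

Lemma pderiveD f g x v df dg : has_deriv x v f df -> has_deriv x v g dg ->
  has_deriv x v (fun y => f y + g y) (df + dg).
Proof. by move=> hf hg; exact: is_deriveD. Qed.

Lemma pderiveN f x v df : has_deriv x v f df ->
  has_deriv x v (fun y => - f y) (- df).
Proof. by move=> hf; exact: is_deriveN. Qed.

Lemma pderiveM f g x v df dg : has_deriv x v f df -> has_deriv x v g dg ->
  has_deriv x v (fun y => f y * g y) (df * g x + f x * dg).
Proof.
move=> hf hg; have -> : df * g x + f x * dg = f x *: dg + g x *: df.
  by rewrite /GRing.scale /= addrC (mulrC df).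
exact: (@is_deriveM R V f g x v df dg).
Qed.

Lemma pderiveV f x v df : f x != 0 -> has_deriv x v f df ->
  has_deriv x v (fun y => (f y)^-1) (- df / f x ^+ 2).
Proof.
move=> f0 hf; apply: DeriveDef; first by apply: derivableV => //; case: hf.
by case: hf => d1 d2; rewrite deriveV // d2 /GRing.scale /= mulNr mulrC mulNr.
Qed.

Lemma pderiveX f n x v df : has_deriv x v f df ->
  has_deriv x v (fun y => f y ^+ n) (n%:R * f x ^+ n.-1 * df).
Proof.
move=> hf; have -> : (fun y => f y ^+ n) = f ^+ n by rewrite exprfctE.
exact: is_deriveX.
Qed.

(** A directional derivative only sees the restriction to a line, which
   reduces the chain rule [pderive_comp] to one variable. *)
Lemma derive_along_line (W : normedModType R) (F : V -> W) x v d :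
  has_deriv x v F d <-> has_deriv (0 : R) 1 (fun h : R => F (h *: v + x)) d.
Proof.
have E : (fun h : R => h^-1 *: ((F \o shift x) (h *: v) - F x)) =
  (fun h : R => h^-1 *: (((fun h : R => F (h *: v + x)) \o shift 0) (h *: 1)
     - (fun h : R => F (h *: v + x)) 0)).
  rewrite funeqE => h /=.
  by rewrite addr0 scale0r add0r [_%:A]mulr1.
have L h0 (G : R -> W) : (fun h : R => h^-1 *: ((F \o shift x) (h *: v) - F x)) =
  (fun h : R => h^-1 *: ((G \o shift h0) (h *: 1) - G h0)) ->
  has_deriv x v F d <-> has_deriv h0 1 G d.
  move=> EG; split=> -[d1 d2]; split.
  - by move: d1; rewrite /derivable EG.
  - by rewrite -d2 /derive EG.
  - by rewrite /derivable EG.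
  - by rewrite -d2 /derive EG.
exact: L E.
Qed.

Lemma pderive_comp (g : R -> R) f x v df dg :
  has_deriv (f x) 1 g dg -> has_deriv x v f df ->
  has_deriv x v (fun y => g (f y)) (dg * df).
Proof.
move=> hg /derive_along_line hf; apply/derive_along_line.
have := @is_derive1_comp R g (fun h => f (h *: v + x)) 0 dg df.
rewrite scale0r add0r => /(_ hg hf) H.
exact: H.
Qed.

Lemma pderive_sum n (f : 'I_n -> V -> R) x v (df : 'I_n -> R) :
  (forall i, has_deriv x v (f i) (df i)) ->
  has_deriv x v (fun y => \sum_i f i y) (\sum_i df i).
Proof.
move=> hf; have := @is_derive_sum R V R n f x v df hf.
by congr is_derive; apply/funext => y; rewrite fct_sumE.
Qed.

Lemma near_eq_deriv f g x v d : (\near x, f x = g x) ->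
  has_deriv x v f d -> has_deriv x v g d.
Proof. exact: near_eq_is_derive. Qed.

End PointwiseDerivatives.

Section Real.
Context {R : realType}.
Implicit Types (f g h : R -> R) (a b c x y : R).

Lemma deriv_continuous f x d : has_deriv x 1 f d -> {for x, continuous f}.
Proof. by move=> -[/derivable1_diffP/differentiable_continuous]. Qed.

Lemma MVT_le f df a b : a <= b ->
  (forall x, a <= x <= b -> has_deriv x 1 f (df x)) ->
  exists2 c, a <= c <= b & f b - f a = df c * (b - a).
Proof.
move=> ab hf.
have [||c] := @MVT_segment R f df a b ab.
- by move=> x; rewrite in_itv /= => /andP[/ltW ax /ltW xb]; apply: hf; rewrite ax.
- apply: derivable_within_continuous => x; rewrite in_itv /= => xab.
  by have [] := hf x xab.
by rewrite in_itv /= => cab E; exists c.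
Qed.

Lemma derive_ge0_le f df a b : a <= b ->
  (forall x, a <= x <= b -> has_deriv x 1 f (df x)) ->
  (forall x, a <= x <= b -> 0 <= df x) -> f a <= f b.
Proof.
move=> ab hf h0; have [c cab E] := MVT_le ab hf.
by rewrite -subr_ge0 E mulr_ge0 ?h0 // subr_ge0.
Qed.

Lemma derive_gt0_lt f df a b : a < b ->
  (forall x, a <= x <= b -> has_deriv x 1 f (df x)) ->
  (forall x, a < x < b -> 0 < df x) -> f a < f b.
Proof.
move=> ab hf h0.
have [||c] := @MVT R f df a b ab.
- by move=> x; rewrite in_itv /= => /andP[/ltW ax /ltW xb]; apply: hf; rewrite ax.
- apply: derivable_within_continuous => x; rewrite in_itv /= => xab.
  by have [] := hf x xab.
by rewrite in_itv /= => cab E; rewrite -subr_gt0 E mulr_gt0 ?h0 // subr_gt0.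
Qed.

Lemma derive0_const f : (forall x, has_deriv x 1 f 0) -> forall x y, f x = f y.
Proof.
move=> hf x y; wlog xy : x y / x <= y.
  by move=> W; case: (leP x y) => [/W //|/ltW/W].
have [c _ E] := @MVT_le f (fun=> 0) x y xy (fun z _ => hf z).
by apply/eqP; rewrite eq_sym -subr_eq0 E mul0r.
Qed.

(** The Lebesgue integrals over the segments starting at [- n] are
   antiderivatives to the right of [- n]. Normalised at [0], any two of them
   agree where both are defined. *)
Lemma continuous_primitive g : continuous g ->
  exists G, G 0 = 0 /\ forall x, has_deriv x 1 G (g x).
Proof.
move=> cg.
pose mu := @lebesgue_measure R.
pose F (n : nat) (x : R) := \int[mu]_(t in [set` `[- n%:R, x]%R]) g t.
have dF n x : - n%:R < x -> has_deriv x 1 (F n) (g x).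
  move=> nx; have [//| | | |d e] := @continuous_FTC1 R g (BLeft (- n%:R)) x (x + 1).
  - by rewrite ltrDl.
  - apply: continuous_compact_integrable; first exact: segment_compact.
    by apply: continuous_subspaceT => y; exact: cg.
  - by [].
  - exact: cg.
  by split; [exact: d|rewrite -derive1E; exact: e].
pose H n x := F n x - F n 0.
have dH n x : - n%:R < x -> has_deriv x 1 (H n) (g x).
  move=> nx; have := pderiveD (dF n x nx) (pderiveN (pderiveC (F n 0) x (1 : R))).
  by rewrite oppr0 addr0.
have EH n m x : (n <= m)%N -> (0 < n)%N -> - n%:R < x -> H n x = H m x.
  move=> nm n0 nx.
  have nm' : - m%:R <= - n%:R :> R by rewrite lerN2 ler_nat.
  have n0' : - n%:R < 0 :> R by rewrite oppr_lt0 ltr0n.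
  have dD (z : R) : - n%:R < z -> has_deriv z 1 (fun z => H n z - H m z) 0.
    move=> nz; rewrite -(subrr (g z)); apply: pderiveD; first exact: dH.
    by apply: pderiveN; apply: dH; apply: le_lt_trans nz.
  have H0 k : H k 0 = 0 by rewrite /H subrr.
  case: (leP 0 x) => x0.
    have [|c _] := @MVT_le (fun z => H n z - H m z) (fun=> 0) 0 x x0.
      by move=> z /andP[z0 _]; apply: dD; exact: lt_le_trans z0.
    by rewrite !H0 !subrr subr0 mul0r => /eqP; rewrite subr_eq0 => /eqP.
  have [|c _] := @MVT_le (fun z => H n z - H m z) (fun=> 0) x 0 (ltW x0).
    by move=> z /andP[z0 _]; apply: dD; exact: lt_le_trans z0.
  by rewrite !H0 !subrr sub0r mul0r => /eqP; rewrite oppr_eq0 subr_eq0 => /eqP.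
pose N x := (Num.truncn `|x|).+1.
have HN x : `|x| < (N x)%:R by exact: truncnS_gt.
exists (fun x => H (N x) x); split; first by rewrite /H subrr.
move=> x.
apply: (@near_eq_deriv _ _ (H (N x).+1)); last first.
  by apply: dH; move: (HN x); rewrite ltr_norml => /andP[+ _]; apply: le_lt_trans;
    rewrite lerN2 ler_nat.
have B : \forall z \near x, `|z - x| < 1.
  by near=> z; rewrite distrC; near: z; exact: cvgr_dist_lt.
near=> z.
have zx : `|z - x| < 1 by near: z.
have nz : `|z| < (N x).+1%:R.
  have -> : z = (z - x) + x by rewrite subrK.
  apply: le_lt_trans (ler_normD _ _) _.
  by rewrite -natr1 addrC ltrD.
have [le|/ltnW le] := leqP (N x).+1 (N z).
  by apply: EH => //; move: nz; rewrite ltr_norml => /andP[].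
by symmetry; apply: EH => //; move: (HN z); rewrite ltr_norml => /andP[].
Unshelve. all: by end_near. Qed.

(** A choice of antiderivative. For continuous [g] it is determined by [prim0]
   and [derive_prim], from which the whole calculus of integrals below is
   derived. *)
Definition prim g : R -> R :=
  xget (fun=> 0) [set G | G 0 = 0 /\ forall x, has_deriv x 1 G (g x)].

Lemma primP g : continuous g ->
  prim g 0 = 0 /\ forall x, has_deriv x 1 (prim g) (g x).
Proof. by move=> /continuous_primitive[G hG]; exact: (@xgetPex _ _ [set G | G 0 = 0 /\ forall x, has_deriv x 1 G (g x)] (ex_intro _ G hG)). Qed.

Lemma prim0 g : continuous g -> prim g 0 = 0.
Proof. by case/primP. Qed.

Lemma derive_prim g x : continuous g -> has_deriv x 1 (prim g) (g x).
Proof. by case/primP. Qed.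

(** The oriented integral of a continuous function, as an increment of its
   antiderivative. *)
Definition defint a b g := prim g b - prim g a.

Lemma FTC f df a b : continuous df -> (forall x, has_deriv x 1 f (df x)) ->
  defint a b df = f b - f a.
Proof.
move=> cdf hf.
have H x : has_deriv x 1 (fun x => prim df x - f x) 0.
  rewrite -(subrr (df x)); apply: pderiveD; first exact: derive_prim.
  exact/pderiveN/hf.
have E := derive0_const H b a; rewrite /defint.
by apply/eqP; rewrite subr_eq addrAC -addrA -E addrCA subrr addr0.
Qed.

Lemma continuous_prim g : continuous g -> continuous (prim g).
Proof. by move=> cg x; apply: deriv_continuous (derive_prim x cg). Qed.

Lemma defint_ext a b f g : f =1 g -> defint a b f = defint a b g.
Proof. by move=> /funext ->. Qed.

Lemma defintD a b f g : continuous f -> continuous g ->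
  defint a b (fun x => f x + g x) = defint a b f + defint a b g.
Proof.
move=> cf cg.
rewrite (@FTC (fun x => prim f x + prim g x) (fun x => f x + g x)).
- by rewrite /defint opprD addrACA.
- by move=> x; apply: cvgD; [exact: cf|exact: cg].
- by move=> x; apply: pderiveD; exact: derive_prim.
Qed.

Lemma defintZ a b f c : continuous f ->
  defint a b (fun x => c * f x) = c * defint a b f.
Proof.
move=> cf; rewrite (@FTC (fun x => c * prim f x) (fun x => c * f x)).
- by rewrite /defint mulrBr.
- by move=> x; apply: cvgMr; exact: cf.
- move=> x; have := pderiveM (pderiveC c x 1) (derive_prim x cf).
  by rewrite mul0r add0r.
Qed.

Lemma defintN a b f : continuous f ->
  defint a b (fun x => - f x) = - defint a b f.
Proof.
move=> cf; rewrite -mulN1r -defintZ //.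
by apply: defint_ext => x; rewrite mulN1r.
Qed.

Lemma defintB a b f g : continuous f -> continuous g ->
  defint a b (fun x => f x - g x) = defint a b f - defint a b g.
Proof.
move=> cf cg; rewrite defintD ?defintN //.
by move=> x; apply: cvgN; exact: cg.
Qed.

Lemma defint_cst a b c : defint a b (fun=> c) = c * (b - a).
Proof.
rewrite (@FTC (fun x => c * x) (fun=> c)) ?mulrBr //; first by move=> x; exact: cvg_cst.
move=> x; have := pderiveM (pderiveC c x 1) (pderive_id x (1:R)).
by rewrite mul0r add0r mulr1.
Qed.

Lemma defint_sum a b n (f : 'I_n -> R -> R) : (forall i, continuous (f i)) ->
  defint a b (fun x => \sum_i f i x) = \sum_i defint a b (f i).
Proof.
move=> cf; rewrite (@FTC (fun x => \sum_i prim (f i) x) (fun x => \sum_i f i x)).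
- by rewrite /defint sumrB.
- exact: continuous_sum.
- by move=> x; apply: pderive_sum => i; exact: derive_prim.
Qed.

Lemma defint_ge0 a b f : continuous f -> a <= b ->
  (forall x, a <= x <= b -> 0 <= f x) -> 0 <= defint a b f.
Proof.
move=> cf ab f0; rewrite subr_ge0.
by apply: (derive_ge0_le ab) f0 => x _; exact: derive_prim.
Qed.

Lemma le_defint a b f g : continuous f -> continuous g -> a <= b ->
  (forall x, a <= x <= b -> f x <= g x) -> defint a b f <= defint a b g.
Proof.
move=> cf cg ab fg; rewrite -subr_ge0 -defintB //; apply: defint_ge0 => //.
  by move=> x; apply: cvgB; [exact: cg|exact: cf].
by move=> x /fg; rewrite subr_ge0.
Qed.

Lemma defint_norm_le a b f (M : R) : continuous f -> a <= b ->
  (forall x, a <= x <= b -> `|f x| <= M) -> `|defint a b f| <= M * (b - a).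
Proof.
move=> cf ab fM; rewrite ler_norml -mulNr -!defint_cst.
have cM (c : R) : continuous (fun _ : R => c) by exact: continuous_cst.
apply/andP; split; apply: le_defint => // x /fM; rewrite ler_norml;
  by case/andP.
Qed.

Lemma defint_split a b c f : defint a b f + defint b c f = defint a c f.
Proof. by rewrite /defint; ring. Qed.

Lemma defint_same a f : defint a a f = 0.
Proof. by rewrite /defint subrr. Qed.

Lemma defint_shift a b c f : continuous f ->
  defint a b (fun x => f (x + c)) = defint (a + c) (b + c) f.
Proof.
move=> cf; rewrite (@FTC (fun x => prim f (x + c)) (fun x => f (x + c))) //.
- move=> x; apply: continuous_comp; last exact: cf.
  by apply: cvgD; [exact: cvg_id|exact: cvg_cst].
- move=> x; rewrite -[f (x + c)]mulr1; apply: pderive_comp.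
    exact: derive_prim.
  rewrite -[X in has_deriv _ _ _ X]addr0; apply: pderiveD.
    exact: pderive_id.
  exact: pderiveC.
Qed.

Lemma defint_reflect a b f : continuous f ->
  defint a b (fun x => f (- x)) = defint (- b) (- a) f.
Proof.
move=> cf; rewrite (@FTC (fun x => - prim f (- x)) (fun x => f (- x))).
- by rewrite /defint; ring.
- move=> x; apply: continuous_comp; last exact: cf.
  by apply: cvgN; exact: cvg_id.
- move=> x; have -> : f (- x) = - (f (- x) * -1) by rewrite mulrN1 opprK.
  apply: pderiveN; apply: pderive_comp; first exact: derive_prim.
  by apply: pderiveN; exact: pderive_id.
Qed.

Lemma defint_parts a b f df g dg :
  (forall x, has_deriv x 1 f (df x)) -> (forall x, has_deriv x 1 g (dg x)) ->
  continuous df -> continuous dg ->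
  defint a b (fun x => df x * g x) =
  f b * g b - f a * g a - defint a b (fun x => f x * dg x).
Proof.
move=> hf hg cdf cdg.
have cf : continuous f by move=> x; apply: deriv_continuous (hf x).
have cg : continuous g by move=> x; apply: deriv_continuous (hg x).
have c1 : continuous (fun x => df x * g x).
  by move=> x; apply: cvgM; [exact: cdf|exact: cg].
have c2 : continuous (fun x => f x * dg x).
  by move=> x; apply: cvgM; [exact: cf|exact: cdg].
rewrite -(@FTC (fun x => f x * g x) (fun x => df x * g x + f x * dg x)).
- by rewrite defintD // addrK.
- by move=> x; apply: cvgD; [exact: c1|exact: c2].
- by move=> x; exact: pderiveM.
Qed.

End Real.

Lemma has_deriv_eq {R : realType} {V W : normedModType R} (x v : V)
  (f : V -> W) (d d' : W) : has_deriv x v f d' -> d' = d -> has_deriv x v f d.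
Proof. by move=> h <-. Qed.

Lemma pderive_mull {R : realType} (c x v : R) : has_deriv x v ( *%R c) (c * v).
Proof.
apply: has_deriv_eq; first exact: (pderiveM (pderiveC c x v) (pderive_id x v)).
by rewrite mul0r add0r.
Qed.

(** [der leaf] differentiates along the syntax of a function and leaves the
   equation between the resulting expression and the expected one; [leaf]
   treats the functions that are not of a recognised form. [cont] does the
   same for continuity. *)
Ltac solve_deriv leaf :=
  lazymatch goal with
  | |- has_deriv _ _ (GRing.mul ?c) _ => exact: pderive_mull
  | |- has_deriv _ _ (fun _ => ?c) _ => exact: pderiveC
  | |- has_deriv _ _ (fun y => y) _ => exact: pderive_id
  | |- has_deriv _ _ (fun y => @?f y + @?g y) _ =>
      eapply pderiveD; solve_deriv leaf
  | |- has_deriv _ _ (fun y => - @?f y) _ => eapply pderiveN; solve_deriv leaf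
  | |- has_deriv _ _ (fun y => @?f y * @?g y) _ =>
      eapply pderiveM; solve_deriv leaf
  | |- has_deriv _ _ (fun y => @?f y ^+ ?n) _ =>
      eapply pderiveX; solve_deriv leaf
  | |- has_deriv _ _ (fun y => (@?f y)^-1) _ =>
      eapply pderiveV; [|solve_deriv leaf]
  | |- has_deriv _ _ (fun y => cos (@?f y)) _ =>
      eapply (@pderive_comp _ _ cos f); [exact: is_derive_cos|solve_deriv leaf]
  | |- has_deriv _ _ (fun y => sin (@?f y)) _ =>
      eapply (@pderive_comp _ _ sin f); [exact: is_derive_sin|solve_deriv leaf]
  | |- _ => leaf
  end.

Ltac der leaf := eapply has_deriv_eq; [solve_deriv leaf|lazy beta].

Ltac cont leaf :=
  lazymatch goal with
  | |- continuous (fun _ => ?c) => exact: continuous_cst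
  | |- continuous (GRing.mul ?c) => exact: (continuous_mul (continuous_cst c) continuous_ident)
  | |- continuous (fun y => y) => exact: continuous_ident
  | |- continuous (fun y => @?f y + @?g y) => apply: continuous_add; cont leaf
  | |- continuous (fun y => - @?f y) => apply: continuous_opp; cont leaf
  | |- continuous (fun y => @?f y * @?g y) => apply: continuous_mul; cont leaf
  | |- continuous (fun y => @?f y ^+ ?n) => apply: continuous_expn; cont leaf
  | |- continuous (fun y => (@?f y)^-1) => apply: continuous_inv; [|cont leaf]
  | |- continuous (fun y => \sum_i @?f i y) =>
      apply: continuous_sum => ?; cont leaf
  | |- continuous (fun y => cos (@?f y)) =>
      apply: (continuous_after (@continuous_cos _)); cont leaf
  | |- continuous (fun y => sin (@?f y)) =>
      apply: (continuous_after (@continuous_sin _)); cont leaf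
  | |- _ => leaf
  end.

(** * Integration over the cylinder *)

Section Plane.
Context {R : realType}.
Local Notation plane := 'rV[R]_2.
Local Notation e0 := (evec 0 : plane).
Local Notation e1 := (evec 1 : plane).
Implicit Types (t th a b : R) (q : plane) (w P Q : plane -> R).

Definition pt t th : plane := t *: e0 + th *: e1.

Lemma pt0 t th : pt t th 0 0 = t.
Proof. by rewrite !mxE /= !mulr1 mulr0 addr0. Qed.

Lemma pt1 t th : pt t th 0 1 = th.
Proof. by rewrite !mxE /= !mulr1 mulr0 add0r. Qed.

Lemma ptE q : q = pt (q 0 0) (q 0 1).
Proof.
apply/rowP => i; rewrite !mxE.
case: i => -[|[|//]] i /=; rewrite !mulr1 mulr0 ?addr0 ?add0r;
  by congr (q _ _); apply/val_inj.
Qed.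

Lemma pt_add_e0 h t th : h *: e0 + pt t th = pt (h + t) th.
Proof. by rewrite /pt scalerDl addrA. Qed.

Lemma pt_add_e1 h t th : h *: e1 + pt t th = pt t (h + th).
Proof. by rewrite /pt scalerDl addrCA. Qed.

Lemma continuous_ptr t : continuous (fun th => pt t th).
Proof.
by move=> x; apply: cvgD; (apply: cvgZ; last exact: cvg_cst);
  [exact: cvg_cst|exact: cvg_id].
Qed.

Lemma continuous_slice w t : continuous w -> continuous (fun th => w (pt t th)).
Proof.
by move=> cw x; apply: continuous_comp; [exact: continuous_ptr|exact: cw].
Qed.

Lemma continuous_t : continuous (fun q => q 0 0).
Proof. exact: coord_continuous. Qed.

Lemma continuous_th : continuous (fun q => q 0 1).
Proof. exact: coord_continuous. Qed.

Lemma shift_deriv (g : R -> R) t d :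
  has_deriv t 1 g d <-> has_deriv (0 : R) 1 (fun h => g (h + t)) d.
Proof.
have H := @derive_along_line R R R g t 1 d.
rewrite H; have -> : (fun h : R => g (h *: 1 + t)) = (fun h => g (h + t)) => //.
by apply/funext => h; rewrite [_%:A]mulr1.
Qed.

Lemma slice0_deriv w t th d :
  has_deriv (pt t th) e0 w d <-> has_deriv t 1 (fun t => w (pt t th)) d.
Proof.
rewrite derive_along_line (shift_deriv (fun t => w (pt t th))).
have -> // : (fun h : R => w (h *: e0 + pt t th)) = (fun h => w (pt (h + t) th)).
by apply/funext => h; rewrite pt_add_e0.
Qed.

Lemma slice1_deriv w t th d :
  has_deriv (pt t th) e1 w d <-> has_deriv th 1 (fun th => w (pt t th)) d.
Proof.
rewrite derive_along_line (shift_deriv (fun th => w (pt t th))).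
have -> // : (fun h : R => w (h *: e1 + pt t th)) = (fun h => w (pt t (h + th))).
by apply/funext => h; rewrite pt_add_e1.
Qed.

(** The tube lemma: the segment is compact, so the continuity in [t] is
   uniform in [th]. *)
Lemma slice_uniform w t a b (e : R) : continuous w -> 0 < e ->
  \forall s \near t, forall th, a <= th <= b -> `|w (pt s th) - w (pt t th)| <= e.
Proof.
move=> cw e0.
have /compact_near_coveringP K : compact `[a, b] by exact: segment_compact.
have := K R (nbhs t) (fun s th => `|w (pt s th) - w (pt t th)| <= e).
move=> /(_ _) H; have {H} : \forall s \near t, `[a, b] `<=`
    (fun th => `|w (pt s th) - w (pt t th)| <= e).
  apply: H => th _.
  have c1 : continuous (fun x : R * R => w (pt x.2 x.1)).
    move=> x; apply: (@continuous_comp _ _ _ (fun x : R * R => pt x.2 x.1)).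
      apply: cvgD; (apply: cvgZ; last exact: cvg_cst).
        exact: cvg_snd.
      exact: cvg_fst.
    exact: cw.
  have c2 : continuous (fun x : R * R => w (pt t x.1)).
    move=> x; apply: (@continuous_comp _ _ _ (fun x : R * R => x.1) (fun y => w (pt t y))).
      exact: cvg_fst.
    exact: continuous_slice.
  have c3 := continuous_add c1 (continuous_opp c2).
  have /cvgr_dist_le/(_ e e0) := c3 (th, t).
  apply: filterS => -[y s] /=.
  by rewrite subrr sub0r normrN.
by apply: filterS => s H th ab; apply: H; rewrite /= in_itv.
Qed.

Lemma continuous_inner w a b : a <= b -> continuous w ->
  continuous (fun t => defint a b (fun th => w (pt t th))).
Proof.
move=> ab cw t; apply/cvgrPdist_le => /= e e0.
(* The summand [1] covers the case of an empty interval. *)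
have d0 : 0 < e / (b - a + 1) by rewrite divr_gt0 // ltr_wpDl // subr_ge0.
near=> s.
rewrite distrC -defintB; try exact: continuous_slice.
have cs : continuous (fun x => w (pt s x) - w (pt t x)).
  by apply: continuous_add; [|apply: continuous_opp]; exact: continuous_slice.
apply: le_trans (@defint_norm_le _ a b _ (e / (b - a + 1)) cs ab _) _.
  by near: s; exact: slice_uniform.
rewrite -mulrA ler_piMr ?(ltW e0) // mulrC ler_pdivrMr ?mul1r ?lerDl //.
by rewrite ltr_wpDl // subr_ge0.
Unshelve. all: by end_near. Qed.

(** Differentiation under the integral sign: by the mean value theorem the
   difference quotients are values of [P0] at nearby heights, and
   [slice_uniform] compares these with [P0 (pt t th)] uniformly in [th]. *)
Lemma derive_inner P P0 a b t : a <= b -> continuous P -> continuous P0 ->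
  (forall q, has_deriv q e0 P (P0 q)) ->
  has_deriv t 1 (fun t => defint a b (fun th => P (pt t th)))
    (defint a b (fun th => P0 (pt t th))).
Proof.
move=> ab cP cP0 dP.
have ba1 : 0 < b - a + 1 by rewrite ltr_wpDl // subr_ge0.
suff H : (fun h : R => h^-1 *: ((fun t => defint a b (fun th => P (pt t th)))
      (h *: 1 + t) - defint a b (fun th => P (pt t th)))) @ 0^' -->
    defint a b (fun th => P0 (pt t th)).
  split; first by apply/cvg_ex; eexists; exact: H.
  by apply: cvg_lim => //; exact: H.
apply/cvgrPdist_le => /= e e0'.
have d0 : 0 < e / (b - a + 1) by rewrite divr_gt0.
have /nbhs_ballP[r /= r0 Hr] := slice_uniform t a b cP0 d0.
near=> h.
have h0 : h != 0 by near: h; exact: nbhs_dnbhs_neq.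
have hr : `|h| < r by near: h; exact: dnbhs0_lt.
rewrite [_%:A]mulr1.
have c1 := continuous_slice (t := h + t) cP.
have c2 := continuous_slice (t := t) cP.
have c3 := continuous_slice (t := t) cP0.
rewrite distrC -defintB // [_ *: _]mulrC mulrC -defintZ; last first.
  by apply: continuous_add => //; exact: continuous_opp.
rewrite -defintB //; last first.
  apply: continuous_mul; first exact: continuous_cst.
  by apply: continuous_add => //; exact: continuous_opp.
apply: (@le_trans _ _ (e / (b - a + 1) * (b - a))).
  apply: defint_norm_le => //.
    apply: continuous_add; last exact: continuous_opp.
    apply: continuous_mul; first exact: continuous_cst.
    by apply: continuous_add => //; exact: continuous_opp.
  move=> th thab.
  have dsl (s : R) : has_deriv s 1 (fun s => P (pt s th)) (P0 (pt s th)).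
    exact/slice0_deriv.
  have [c ct E] : exists2 c, `|t - c| < r & P (pt (h + t) th) - P (pt t th) = h * P0 (pt c th).
    case: (leP 0 h) => hh.
      have [|c /andP[c1' c2'] E] := @MVT_le _ (fun s => P (pt s th))
        (fun s => P0 (pt s th)) t (h + t) _ (fun x _ => dsl x).
        by rewrite lerDr.
      exists c; last by rewrite E addrK mulrC.
      rewrite distrC ger0_norm ?subr_ge0 //; apply: le_lt_trans hr.
      by rewrite ger0_norm // lerBlDr.
    have [|c /andP[c1' c2'] E] := @MVT_le _ (fun s => P (pt s th))
        (fun s => P0 (pt s th)) (h + t) t _ (fun x _ => dsl x).
      by rewrite gerDr ltW.
    exists c.
      rewrite ger0_norm ?subr_ge0 //; apply: le_lt_trans hr.
      by rewrite ltr0_norm // lerBlDr -lerBlDl opprK addrC.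
    by rewrite -opprB E opprD addrCA subrr addr0 mulrN opprK mulrC.
  rewrite E mulrA mulVf // mul1r.
  exact: (Hr c ct).
by rewrite mulrAC ler_pdivrMr // ler_wpM2l ?(ltW e0') // lerDl.
Unshelve. all: by end_near. Qed.

Definition int2 (T : R) w : R :=
  defint (- T) T (fun t => defint 0 (2 * pi) (fun th => w (pt t th))).

Lemma twopi_ge0 : 0 <= 2 * pi :> R.
Proof. by rewrite mulr_ge0 // pi_ge0. Qed.

Lemma continuous_loop w : continuous w ->
  continuous (fun t => defint 0 (2 * pi) (fun th => w (pt t th))).
Proof. exact/continuous_inner/twopi_ge0. Qed.

Lemma int2_ext T w w' : w =1 w' -> int2 T w = int2 T w'.
Proof. by move=> /funext ->. Qed.

Lemma int2D T w w' : continuous w -> continuous w' ->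
  int2 T (fun q => w q + w' q) = int2 T w + int2 T w'.
Proof.
move=> cw cw'; rewrite /int2 -defintD; try exact: continuous_loop.
by apply: defint_ext => t; rewrite defintD //; exact: continuous_slice.
Qed.

Lemma int2Z T w c : continuous w -> int2 T (fun q => c * w q) = c * int2 T w.
Proof.
move=> cw; rewrite /int2 -defintZ; last exact: continuous_loop.
by apply: defint_ext => t; rewrite defintZ //; exact: continuous_slice.
Qed.

Lemma int2N T w : continuous w -> int2 T (fun q => - w q) = - int2 T w.
Proof.
by move=> cw; rewrite -mulN1r -int2Z //; apply: int2_ext => q; rewrite mulN1r.
Qed.

Lemma int2B T w w' : continuous w -> continuous w' ->
  int2 T (fun q => w q - w' q) = int2 T w - int2 T w'.
Proof. by move=> cw cw'; rewrite int2D ?int2N //; exact: continuous_opp. Qed.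

Lemma int2_sum T n (w : 'I_n -> plane -> R) : (forall i, continuous (w i)) ->
  int2 T (fun q => \sum_i w i q) = \sum_i int2 T (w i).
Proof.
move=> cw; rewrite /int2 -defint_sum; last by move=> i; exact: continuous_loop.
apply: defint_ext => t; rewrite defint_sum // => i.
exact: continuous_slice.
Qed.

Lemma int2_ge0 T w : continuous w -> 0 <= T ->
  (forall q, 0 <= w q) -> 0 <= int2 T w.
Proof.
move=> cw T0 w0; apply: defint_ge0; first exact: continuous_loop.
  by rewrite ge0_cp.
move=> t _; apply: defint_ge0 => //; first exact: continuous_slice.
exact: twopi_ge0.
Qed.

Lemma le_int2 T w w' : continuous w -> continuous w' -> 0 <= T ->
  (forall q, w q <= w' q) -> int2 T w <= int2 T w'.
Proof.
move=> cw cw' T0 ww'; rewrite -subr_ge0 -int2B //; apply: int2_ge0 => //.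
  by apply: continuous_add => //; exact: continuous_opp.
by move=> q; rewrite subr_ge0.
Qed.

Lemma int2_norm_le T w w' : continuous w -> continuous w' -> 0 <= T ->
  (forall q, `|w q| <= w' q) -> `|int2 T w| <= int2 T w'.
Proof.
move=> cw cw' T0 ww'; rewrite ler_norml -int2N //.
apply/andP; split; apply: le_int2 => //; first exact: continuous_opp.
  by move=> q; have := ww' q; rewrite ler_norml => /andP[].
by move=> q; have := ww' q; rewrite ler_norml => /andP[].
Qed.

Definition periodic w := forall q, w (q + turn) = w q.

Lemma pt_turn t th : pt t th + turn = pt t (th + 2 * pi).
Proof. by rewrite /pt /turn scalerDl addrA. Qed.

(** The [t]-derivative integrates to boundary values of [P], which vanish, and
   the [th]-derivative integrates to zero on each circle by periodicity. *)
Lemma divergence_theorem T P P0 Q Q1 :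
  continuous P -> continuous P0 -> continuous Q1 ->
  (forall q, has_deriv q e0 P (P0 q)) -> (forall q, has_deriv q e1 Q (Q1 q)) ->
  (forall q, T <= `|q 0 0| -> P q = 0) -> 0 <= T -> periodic Q ->
  int2 T (fun q => P0 q + Q1 q) = 0.
Proof.
move=> cP cP0 cQ1 dP dQ PT T0 perQ.
rewrite int2D // {2}/int2 -[RHS](addr0 0); congr (_ + _); last first.
  under defint_ext => t.
    rewrite (@FTC _ (fun th => Q (pt t th))); last 2 first.
    - exact: continuous_slice.
    - by move=> th; apply/slice1_deriv.
    rewrite -[2 * pi]add0r -pt_turn perQ subrr; over.
  by rewrite defint_cst mul0r.
rewrite /int2 (@FTC _ (fun t => defint 0 (2 * pi) (fun th => P (pt t th)))).
- have Z t : T <= `|t| -> defint 0 (2 * pi) (fun th => P (pt t th)) = 0.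
    move=> tT; under defint_ext => th do rewrite PT ?pt0 //.
    by rewrite defint_cst mul0r.
  by rewrite !Z ?subrr // ?normrN ger0_norm.
- exact: continuous_loop.
- by move=> t; apply: derive_inner => //; exact: twopi_ge0.
Qed.

End Plane.

(** * Trigonometric modes on the circle *)

Section LinearAlgebra.
Context {F : fieldType}.

(** Linear equations with more unknowns than equations: this provides every
   combination of functions that has to satisfy prescribed linear conditions. *)
Lemma left_kernel n (M : 'M[F]_(n.+1, n)) :
  exists2 a : 'rV[F]_n.+1, a != 0 & a *m M = 0.
Proof.
have : kermx M != 0.
  rewrite -mxrank_eq0 mxrank_ker subn_eq0 -ltnNge ltnS.
  exact: rank_leq_col.
by case/rowV0Pn => v /sub_kermxP vM v0; exists v.
Qed.

End LinearAlgebra.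

Section OrthogonalExpansion.
Context {R : realType} (a b : R) (n : nat) (p : 'I_n -> R -> R) (d : 'I_n -> R).
Hypothesis cp : forall j, continuous (p j).
Hypothesis orth : forall i j,
  defint a b (fun x => p i x * p j x) = (i == j)%:R * d j.

(** Pythagoras, for a function [z] that need not be orthogonal to the [p j];
   used both for the trigonometric functions and for their derivatives. *)
Lemma defint_sqr_expand (z : R -> R) (s : 'I_n -> R) (al : R) (l : 'I_n -> R) :
  continuous z -> (forall j, defint a b (fun x => z x * p j x) = s j) ->
  defint a b (fun x => (al * z x + \sum_j l j * p j x) ^+ 2) =
  al ^+ 2 * defint a b (fun x => z x ^+ 2) + 2 * al * (\sum_j l j * s j)
  + \sum_j d j * l j ^+ 2.
Proof.
move=> cz hs.
have cS : continuous (fun x => \sum_j l j * p j x).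
  by cont ltac:(solve [exact: cp]).
under defint_ext => x.
  have -> : (al * z x + \sum_j l j * p j x) ^+ 2 =
    al ^+ 2 * z x ^+ 2 + ((2 * al) * (\sum_j l j * (z x * p j x))
     + \sum_j l j * (\sum_i l i * (p i x * p j x))).
    have -> : \sum_j l j * (z x * p j x) = z x * (\sum_j l j * p j x).
      by rewrite mulr_sumr; apply: eq_bigr => j _; rewrite mulrCA.
    have -> : \sum_j l j * (\sum_i l i * (p i x * p j x)) =
       (\sum_j l j * p j x) ^+ 2.
      rewrite expr2 big_distrl /=; apply: eq_bigr => j _.
      rewrite mulr_sumr mulr_sumr; apply: eq_bigr => i _; ring.
    by ring.
  over.
have c1 : continuous (fun x => \sum_j l j * (z x * p j x)).
  by cont ltac:(solve [exact: cp|exact: cz]).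
have c2 j : continuous (fun x => \sum_i l i * (p i x * p j x)).
  by cont ltac:(solve [exact: cp|exact: cz]).
have c3 : continuous (fun x => \sum_j l j * \sum_i l i * (p i x * p j x)).
  by apply: continuous_sum => j; apply: continuous_mul => //; exact: continuous_cst.
rewrite defintD; last 2 first.
- by cont ltac:(solve [exact: cz]).
- by apply: continuous_add => //; apply: continuous_mul => //; exact: continuous_cst.
rewrite defintD //; last first.
  by apply: continuous_mul => //; exact: continuous_cst.
rewrite defintZ; last by cont ltac:(solve [exact: cz]).
rewrite defintZ // -addrA; congr (_ + (_ * _ + _)).
  rewrite defint_sum; last by move=> j; cont ltac:(solve [exact: cp|exact: cz]).
  apply: eq_bigr => j _; rewrite defintZ ?hs //.
  by cont ltac:(solve [exact: cp|exact: cz]).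
rewrite defint_sum; last first.
  by move=> j; apply: continuous_mul => //; exact: continuous_cst.
apply: eq_bigr => j _; rewrite defintZ // defint_sum; last first.
  by move=> i; cont ltac:(solve [exact: cp|exact: cz]).
under eq_bigr => i _.
  rewrite defintZ; last by cont ltac:(solve [exact: cp]).
  rewrite orth; over.
rewrite (bigD1 j) //= eqxx mul1r big1 ?addr0; first by ring.
by move=> i /negbTE ->; rewrite mul0r mulr0.
Qed.

End OrthogonalExpansion.

Section Trigonometric.
Context {R : realType}.
Implicit Types (x th : R) (v g : R -> R).

(** The Fourier basis as one sequence: [trig 0] is constant, [trig (2 k - 1)]
   and [trig (2 k)] are the normalised cosine and sine of frequency [k]. The
   modes of frequency at most [K] are thus the first [2 K + 1] ones. *)
Definition freq (j : nat) : nat := uphalf j.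

Definition trig_amp (j : nat) : R := (Num.sqrt (if j == 0%N then 2 * pi else pi))^-1.

Definition trig (j : nat) th : R :=
  trig_amp j * (if odd j || (j == 0%N) then cos ((freq j)%:R * th)
                else sin ((freq j)%:R * th)).

Definition dtrig (j : nat) th : R :=
  (freq j)%:R * (trig_amp j * (if odd j || (j == 0%N) then - sin ((freq j)%:R * th)
                else cos ((freq j)%:R * th))).

Lemma derive_trig j th : has_deriv th 1 (trig j) (dtrig j th).
Proof.
rewrite /trig /dtrig; case: ifP => _; der ltac:(fail); ring.
Qed.

Lemma derive_dtrig j th : has_deriv th 1 (dtrig j) (- (freq j)%:R ^+ 2 * trig j th).
Proof.
rewrite /trig /dtrig; case: ifP => _; der ltac:(fail); ring.
Qed.

Lemma continuous_trig j : continuous (trig j).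
Proof. by move=> x; apply: deriv_continuous (derive_trig j x). Qed.

Lemma continuous_dtrig j : continuous (dtrig j).
Proof. by move=> x; apply: deriv_continuous (derive_dtrig j x). Qed.

Lemma cos_sin_turns n x :
  cos (x + n%:R * (2 * pi)) = cos x /\ sin (x + n%:R * (2 * pi)) = sin x.
Proof.
elim: n => [|n [IHc IHs]]; first by rewrite mul0r addr0.
rewrite -natr1 mulrDl mul1r addrA; split.
  by rewrite cosD IHc IHs mulr_natl cos2pi sin2pi mulr1 mulr0 subr0.
by rewrite sinD IHc IHs mulr_natl cos2pi sin2pi mulr1 mulr0 addr0.
Qed.

Lemma trig_turn j th : trig j (th + 2 * pi) = trig j th.
Proof.
rewrite /trig mulrDr; have [-> ->] := cos_sin_turns (freq j) ((freq j)%:R * th).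
by [].
Qed.

Lemma dtrig_turn j th : dtrig j (th + 2 * pi) = dtrig j th.
Proof.
rewrite /dtrig mulrDr; have [-> ->] := cos_sin_turns (freq j) ((freq j)%:R * th).
by [].
Qed.

Lemma freq_eq i j : freq i = freq j -> i != j ->
  [/\ (0 < freq i)%N, i != 0%N, j != 0%N & odd i = ~~ odd j].
Proof.
by rewrite /freq => E ij; split; lia.
Qed.

Lemma freq_gt0 j : j != 0%N -> (0 < freq j)%N.
Proof. by case: j => // j _; rewrite /freq /= ltnS. Qed.

(** For different frequencies, the Wronskian of the two functions is a
   primitive of a multiple of their product, and it is periodic. For equal
   frequencies there are elementary primitives. *)
Lemma trig_orth i j :
  defint 0 (2 * pi) (fun x => trig i x * trig j x) = (i == j)%:R.
Proof.
have ci := @continuous_trig i; have cj := @continuous_trig j.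
have cdi := @continuous_dtrig i; have cdj := @continuous_dtrig j.
have cij : continuous (fun x => trig i x * trig j x) by exact: continuous_mul.
have t2 k : trig k (2 * pi) = trig k 0 by rewrite -[2 * pi]add0r trig_turn.
have dt2 k : dtrig k (2 * pi) = dtrig k 0 by rewrite -[2 * pi]add0r dtrig_turn.
have [E|E] := eqVneq (freq i) (freq j); last first.
  have -> : (i == j) = false by apply/negbTE; apply: contraNneq E => ->.
  pose D : R := (freq i)%:R ^+ 2 - (freq j)%:R ^+ 2.
  have D0 : D != 0.
    by rewrite subr_eq0 eqrXn2 ?ler0n // eqr_nat.
  apply: (mulfI D0); rewrite mulr0 -defintZ //.
  rewrite (@FTC _ (fun x => trig i x * dtrig j x - dtrig i x * trig j x)).
  - by rewrite !t2 !dt2 subrr.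
  - by cont ltac:(solve [done]).
  - by move=> x; der ltac:(solve [exact: derive_trig|exact: derive_dtrig]);
      rewrite /D; ring.
have [ij|ij] := eqVneq i j; last first.
  have [f0 i0 j0 oij] := freq_eq E ij.
  have f0' : (freq j)%:R != 0 :> R by rewrite pnatr_eq0 -lt0n -E.
  pose F x : R := trig_amp i * trig_amp j *
     (sin ((freq j)%:R * x) ^+ 2 / (2 * (freq j)%:R)).
  rewrite (@FTC _ F).
  - rewrite /F mulr0 sin0.
    by have [_] := cos_sin_turns (freq j) 0; rewrite add0r sin0 => ->; rewrite subrr.
  - exact: cij.
  - move=> x; rewrite /F; der ltac:(fail).
    rewrite /trig (negbTE i0) (negbTE j0) !orbF oij E.
    by case: (odd j) => /=; field.
rewrite -{j E cj cdj cij t2 dt2}ij.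
have pi0 := @pi_gt0 R.
have [->|i0] := eqVneq i 0%N.
  under defint_ext => x.
    rewrite /trig /= /freq /= mul0r cos0 mulr1 /trig_amp /= -expr2 exprVn sqr_sqrtr ?mulr_ge0 ?pi_ge0 //; over.
  by rewrite defint_cst subr0 mulVf // gt_eqF // mulr_gt0.
have f0 : (freq i)%:R != 0 :> R by rewrite pnatr_eq0 -lt0n freq_gt0.
pose F x : R := pi^-1 * (x / 2 + (if odd i then 1 else -1) *
     (sin ((freq i)%:R * x) * cos ((freq i)%:R * x) / (2 * (freq i)%:R))).
rewrite (@FTC _ F).
- rewrite /F mulr0 sin0.
  have [_] := cos_sin_turns (freq i) 0; rewrite add0r sin0 => ->.
  by rewrite !(mul0r, mulr0, addr0) subr0 [2 * pi]mulrC mulfK ?mulVf ?gt_eqF // pnatr_eq0.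
- by apply: continuous_mul.
- move=> x; rewrite /F; der ltac:(fail).
  rewrite /trig /trig_amp (negbTE i0) orbF.
  set s := sin _; set c := cos _; set q := Num.sqrt pi.
  have E1 : c ^+ 2 + s ^+ 2 = 1 by exact: cos2Dsin2.
  have q0 : q != 0 by rewrite gt_eqF // sqrtr_gt0.
  have -> : (pi : R) = q ^+ 2 by rewrite sqr_sqrtr // pi_ge0.
  have E2 : c ^+ 2 + s ^+ 2 - 1 = 0 by rewrite E1 subrr.
  apply/eqP; rewrite -subr_eq0; apply/eqP.
  have E3 : (- (q ^+ 2)^-1 / 2) * (c ^+ 2 + s ^+ 2 - 1) = 0 by rewrite E2 mulr0.
  by rewrite -[RHS]E3; case: (odd i) => /=; field; rewrite q0.
Qed.

End Trigonometric.

(** * Wirtinger's inequality above a given frequency *)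

Section Wirtinger.
Context {R : realType}.
Implicit Types (x th a b : R) (v dv g : R -> R).

Lemma defint_periodic g a : continuous g -> (forall x, g (x + 2 * pi) = g x) ->
  defint a (a + 2 * pi) g = defint 0 (2 * pi) g.
Proof.
move=> cg pg; rewrite /defint -{2}[2 * pi]add0r.
apply: (@derive0_const _ (fun a => prim g (a + 2 * pi) - prim g a)) => x.
have H : has_deriv x 1 (fun a => prim g (a + 2 * pi)) (g (x + 2 * pi) * (1 + 0)).
  apply: pderive_comp; first exact: derive_prim.
  by apply: pderiveD; [exact: pderive_id|exact: pderiveC].
apply: has_deriv_eq; first by apply: pderiveD H (pderiveN _); exact: derive_prim.
by rewrite addr0 mulr1 pg subrr.
Qed.

Lemma periodic_reflect g : continuous g -> (forall x, g (x + 2 * pi) = g x) ->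
  defint 0 (2 * pi) (fun x => g (- x)) = defint 0 (2 * pi) g.
Proof.
move=> cg pg; rewrite defint_reflect // oppr0 -(defint_periodic (- (2 * pi))) //.
by rewrite addNr.
Qed.

Section C1.
Variables (v dv : R -> R).
Hypotheses (hv : forall x : R, has_deriv x 1 v (dv x)) (cdv : continuous dv).

Let cv : continuous v.
Proof. by move=> x; apply: deriv_continuous (hv x). Qed.

Let cE mu : continuous (fun x => dv x ^+ 2 - mu ^+ 2 * v x ^+ 2).
Proof. by cont ltac:(solve [done]). Qed.

(** The square [(dv + mu * tan (mu * (x - c)) * v) ^+ 2], with [c] the middle of
   the segment, differs from the integrand by the derivative of
   [mu * tan (mu * (x - c)) * v ^+ 2], which vanishes at both ends. The tangent
   is defined since the segment is shorter than [pi / mu]. *)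
Lemma wirtinger_segment mu a b : 0 < mu -> a <= b -> mu * (b - a) < pi ->
  v a = 0 -> v b = 0 ->
  0 <= defint a b (fun x => dv x ^+ 2 - mu ^+ 2 * v x ^+ 2).
Proof.
move=> mu0 ab mupi va vb.
pose c := (a + b) / 2.
pose s x := sin (mu * (x - c)); pose k x := cos (mu * (x - c)).
have k0 x : a <= x <= b -> k x != 0.
  move=> /andP[ax xb]; rewrite gt_eqF // cos_gt0_pihalf //.
  have H1 : mu * (a - c) <= mu * (x - c) by rewrite ler_pM2l // lerD2r.
  have H2 : mu * (x - c) <= mu * (b - c) by rewrite ler_pM2l // lerD2r.
  have E1 : mu * (a - c) = - (mu * (b - a)) / 2 by rewrite /c; field.
  have E2 : mu * (b - c) = (mu * (b - a)) / 2 by rewrite /c; field.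
  move: H1 H2; rewrite E1 E2; lra.
pose G x := prim (fun x => dv x ^+ 2 - mu ^+ 2 * v x ^+ 2) x
            + mu * (s x / k x) * v x ^+ 2.
have dG x : a <= x <= b -> has_deriv x 1 G ((dv x + mu * (s x / k x) * v x) ^+ 2).
  move=> /k0 kx; rewrite /G /s /k.
  der ltac:(solve [exact: derive_prim|exact: hv]); first exact: kx.
  rewrite -/(s x) -/(k x).
  by field; exact: kx.
have := derive_ge0_le ab dG (fun x _ => sqr_ge0 _).
by rewrite /G va vb !expr0n /= !mulr0 !addr0 -subr_ge0.
Qed.

Lemma wirtinger_chain mu a h n : 0 < mu -> 0 <= h -> mu * h < pi ->
  (forall i, (i <= n)%N -> v (a + i%:R * h) = 0) ->
  0 <= defint a (a + n%:R * h) (fun x => dv x ^+ 2 - mu ^+ 2 * v x ^+ 2).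
Proof.
move=> mu0 h0 muh; elim: n => [|n IH] H; first by rewrite mul0r addr0 defint_same.
rewrite -(defint_split _ (a + n%:R * h)) addr_ge0 //.
  by apply: IH => i ni; apply: H; rewrite leqW.
apply: wirtinger_segment => //; try exact: H.
  by rewrite -natr1 mulrDl mul1r addrA lerDl.
have -> // : a + n.+1%:R * h - (a + n%:R * h) = h by rewrite -natr1; ring.
Qed.

End C1.

Section Nodes.
Variables (K : nat) (v dv : R -> R) (mu : R).
Hypotheses (hv : forall x : R, has_deriv x 1 v (dv x)) (cdv : continuous dv).
Hypothesis perv : forall x, v (x + 2 * pi) = v x.
Hypothesis mu0 : 0 < mu.
Hypothesis muK : mu < K.+1%:R.

Let h : R := pi / K.+1%:R.

Let cv : continuous v.
Proof. by move=> x; apply: deriv_continuous (hv x). Qed.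

(** The even part of [v] vanishes at the [2K + 2] zeros of [cos ((K+1) th)], and
   its odd part at those of [sin ((K+1) th)], once [v] satisfies [K + 1] and [K]
   linear conditions respectively. *)
Definition node_condition (g : R -> R) (j : nat) : R :=
  if (j <= K)%N then g ((2 * j + 1)%:R * (h / 2)) + g (- ((2 * j + 1)%:R * (h / 2)))
  else g ((j - K)%:R * h) - g (- ((j - K)%:R * h)).

(** The even and the odd part of [v] each vanish at the nodes of a chain of [2
   K + 2] segments of length [h] that covers a period, and the forms of the
   two parts add up to the form of [v]. *)
Lemma wirtinger_nodes : (forall j, (j < (2 * K).+1)%N -> node_condition v j = 0) ->
  (forall x, dv (x + 2 * pi) = dv x) ->
  mu ^+ 2 * defint 0 (2 * pi) (fun x => v x ^+ 2)
  <= defint 0 (2 * pi) (fun x => dv x ^+ 2).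
Proof.
move=> nc perdv.
have K0 : 0 < K.+1%:R :> R by rewrite ltr0n.
have hK : (2 * K.+1)%:R * h = 2 * pi.
  by rewrite /h natrM; field; rewrite gt_eqF.
have h0 : 0 <= h by rewrite /h divr_ge0 ?pi_ge0 // ltW.
have muh : mu * h < pi.
  by rewrite /h mulrCA gtr_pMr ?pi_gt0 // ltr_pdivrMr ?mul1r.
have perB x : v (x - 2 * pi) = v x by rewrite -[in RHS](subrK (2 * pi) x) perv.
pose ve x := (v x + v (- x)) / 2; pose dve x := (dv x - dv (- x)) / 2.
pose vo x := (v x - v (- x)) / 2; pose dvo x := (dv x + dv (- x)) / 2.
have hvN x : has_deriv x 1 (fun x => v (- x)) (dv (- x) * (- 1)).
  by apply: pderive_comp; [exact: hv|apply: pderiveN; exact: pderive_id].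
have hve x : has_deriv x 1 ve (dve x).
  by rewrite /ve /dve; der ltac:(solve [exact: hv|exact: hvN]); ring.
have hvo x : has_deriv x 1 vo (dvo x).
  by rewrite /vo /dvo; der ltac:(solve [exact: hv|exact: hvN]); ring.
have cdvN : continuous (fun x => dv (- x)).
  by apply: (@continuous_after _ _ dv) => //; apply: continuous_opp; exact: continuous_ident.
have cvN : continuous (fun x => v (- x)).
  by apply: (@continuous_after _ _ v) => //; apply: continuous_opp; exact: continuous_ident.
have cdve : continuous dve by rewrite /dve; cont ltac:(solve [done]).
have cdvo : continuous dvo by rewrite /dvo; cont ltac:(solve [done]).
have pN (g : R -> R) : (forall x, g (x + 2 * pi) = g x) ->
   forall x, g (- (x + 2 * pi)) = g (- x).
  by move=> pg x; rewrite -[LHS]pg; congr g; ring.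
have pve x : ve (x + 2 * pi) = ve x by rewrite /ve perv pN.
have veN x : ve (- x) = ve x by rewrite /ve opprK addrC.
have voN x : vo (- x) = - vo x by rewrite /vo opprK -mulNr opprB.
have pvo x : vo (x + 2 * pi) = vo x by rewrite /vo perv pN.
have ve0 j : (j <= K)%N -> ve ((2 * j + 1)%:R * (h / 2)) = 0.
  move=> jK; have := nc j; rewrite /node_condition jK /ve => ->.
    by rewrite mul0r.
  by lia.
have vo0 j : (j <= K.+1)%N -> vo (j%:R * h) = 0.
  case: (posnP j) => [->|j0].
    by rewrite mul0r /vo oppr0 subrr mul0r.
  rewrite leq_eqVlt => /orP[/eqP->|].
    have -> : K.+1%:R * h = pi by rewrite /h mulrCA divff ?mulr1 // gt_eqF.
    have := voN pi; have := pvo (- pi).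
    have -> : - pi + 2 * pi = pi :> R by ring.
    by move=> <-; lra.
  rewrite ltnS => jK; have := nc (j + K)%N; rewrite /node_condition addnK.
  have -> : (j + K <= K)%N = false by lia.
  by rewrite /vo => ->; [rewrite mul0r|lia].
(* The left end of the chain for the even part; its nodes are the zeros of
   [cos ((K + 1) th)]. *)
pose al : R := h / 2 - K.+1%:R * h.
have al2 : al + (2 * K.+1)%:R * h = al + 2 * pi by rewrite hK.
have Ee : 0 <= defint 0 (2 * pi) (fun x => dve x ^+ 2 - mu ^+ 2 * ve x ^+ 2).
  rewrite -(@defint_periodic _ al); last 2 first.
  - by rewrite /ve; cont ltac:(solve [done]).
  - by move=> x; rewrite /dve /ve perdv perv !pN.
  rewrite -al2; apply: wirtinger_chain => // i ile.
  have [iK|iK] := leqP i K.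
    rewrite -veN; have := ve0 (K - i)%N (leq_subr _ _); congr (ve _ = _).
    by rewrite /al natrD natrM natrB // -natr1; field.
  have [iK2|iK2] := leqP i (2 * K).+1.
    have := ve0 (i - K.+1)%N; rewrite leq_subLR => /(_ _) H.
    rewrite -[RHS]H; last by lia.
    by congr ve; rewrite /al natrD natrM natrB // -natr1; field.
  have -> : i = (2 * K.+1)%N by lia.
  rewrite al2 pve -veN; have := ve0 K (leqnn _); congr (ve _ = _).
  by rewrite /al natrD natrM -natr1; field.
have Eo : 0 <= defint 0 (2 * pi) (fun x => dvo x ^+ 2 - mu ^+ 2 * vo x ^+ 2).
  rewrite -hK -[_ * h]add0r; apply: wirtinger_chain => // i ile.
  rewrite add0r; have [iK|iK] := leqP i K.+1; first exact: vo0.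
  rewrite -[LHS]opprK -voN -pvo -hK.
  have -> : - (i%:R * h) + (2 * K.+1)%:R * h = (2 * K.+1 - i)%:R * h.
    by rewrite natrB //; ring.
  by rewrite vo0 ?oppr0 //; lia.
have cmv : continuous (fun x => mu ^+ 2 * v x ^+ 2) by cont ltac:(solve [done]).
have cdv2 : continuous (fun x => dv x ^+ 2) by cont ltac:(solve [done]).
have cv2 : continuous (fun x => v x ^+ 2) by cont ltac:(solve [done]).
rewrite -subr_ge0 -defintZ // -defintB //.
have c0 : continuous (fun x => dv x ^+ 2 - mu ^+ 2 * v x ^+ 2).
  by cont ltac:(solve [done]).
have c1 : continuous (fun x => dv (- x) ^+ 2 - mu ^+ 2 * v (- x) ^+ 2).
  by cont ltac:(solve [done]).
have := addr_ge0 Ee Eo; rewrite -defintD; last 2 first.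
- by rewrite /ve; cont ltac:(solve [done]).
- by rewrite /vo; cont ltac:(solve [done]).
have -> : (fun x => dve x ^+ 2 - mu ^+ 2 * ve x ^+ 2 + (dvo x ^+ 2 - mu ^+ 2 * vo x ^+ 2))
  = (fun x => 2^-1 * ((dv x ^+ 2 - mu ^+ 2 * v x ^+ 2) +
              (dv (- x) ^+ 2 - mu ^+ 2 * v (- x) ^+ 2))).
  by apply/funext => x; rewrite /dve /ve /dvo /vo; field.
rewrite defintZ; last by apply: continuous_add.
rewrite (defintD _ _ c0 c1).
have -> := @periodic_reflect (fun x => dv x ^+ 2 - mu ^+ 2 * v x ^+ 2) c0 _.
  by lra.
by move=> x; rewrite perdv perv.
Qed.

End Nodes.

Section Modes.
Variable K : nat.
Local Notation N := (2 * K).+1.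

Lemma freq_le (j : 'I_N) : (freq j <= K)%N.
Proof. by case: j => j /= jN; rewrite /freq; lia. Qed.

Lemma trig_orth_ord (i j : 'I_N) :
  defint 0 (2 * pi) (fun x : R => trig i x * trig j x) = (i == j)%:R * 1.
Proof. by rewrite mulr1 trig_orth. Qed.

Lemma trig_parts (v dv : R -> R) (j : nat) :
  (forall x : R, has_deriv x 1 v (dv x)) -> continuous dv ->
  (forall x, v (x + 2 * pi) = v x) ->
  defint 0 (2 * pi) (fun x => dv x * dtrig j x) =
  (freq j)%:R ^+ 2 * defint 0 (2 * pi) (fun x => v x * trig j x).
Proof.
move=> hv cdv pv.
have cv : continuous v by move=> x; apply: deriv_continuous (hv x).
have ct := @continuous_trig R j.
rewrite (defint_parts _ _ hv (derive_dtrig j) cdv); last by cont ltac:(solve [done]).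
rewrite -[2 * pi]add0r pv dtrig_turn subrr sub0r -defintZ; last first.
  by apply: continuous_mul.
rewrite -defintN; last by cont ltac:(solve [done]).
by apply: defint_ext => x; ring.
Qed.

Lemma dtrig_orth_ord (i j : 'I_N) :
  defint 0 (2 * pi) (fun x : R => dtrig i x * dtrig j x) =
  (i == j)%:R * (freq j)%:R ^+ 2.
Proof.
rewrite (@trig_parts (trig i)).
- by rewrite trig_orth mulrC.
- exact: derive_trig.
- exact: continuous_dtrig.
- exact: trig_turn.
Qed.

Lemma bessel (v : R -> R) : continuous v ->
  \sum_(j < N) defint 0 (2 * pi) (fun x => v x * trig j x) ^+ 2
  <= defint 0 (2 * pi) (fun x => v x ^+ 2).
Proof.
move=> cv; pose s (j : 'I_N) := defint 0 (2 * pi) (fun x => v x * trig j x).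
have := @defint_sqr_expand R 0 (2 * pi) N (fun j => trig j) (fun=> 1)
  (fun j => @continuous_trig R j) trig_orth_ord v s 1 (fun j => - s j) cv (fun=> erefl).
set L := defint _ _ _ => E.
have L0 : 0 <= L.
  apply: defint_ge0; last by move=> x _; exact: sqr_ge0.
    by cont ltac:(solve [exact: continuous_trig|done]).
  by rewrite mulr_ge0 ?pi_ge0.
rewrite -subr_ge0; apply: (le_trans L0); rewrite E.
under [X in _ + _ * X]eq_bigr => j _ do rewrite mulNr -expr2.
under [X in _ + X]eq_bigr => j _ do rewrite mul1r sqrrN.
by rewrite sumrN expr1n mul1r mulr1 -/s; lra.
Qed.

(** Min-max: [z] and the [2K + 1] lowest modes span a space of dimension
   [2K + 2], so some non-zero combination [v] meets the [2K + 1] node conditions.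
   By orthogonality the inequality for [v] splits into one for [z] and a sum over
   the modes, and the modes alone violate it since their frequencies are below
   [mu]. *)
Lemma wirtinger_orthogonal (z dz : R -> R) mu :
  (forall x : R, has_deriv x 1 z (dz x)) -> continuous dz ->
  (forall x, z (x + 2 * pi) = z x) -> (forall x, dz (x + 2 * pi) = dz x) ->
  K%:R < mu -> mu < K.+1%:R ->
  (forall j : 'I_N, defint 0 (2 * pi) (fun x => z x * trig j x) = 0) ->
  mu ^+ 2 * defint 0 (2 * pi) (fun x => z x ^+ 2)
  <= defint 0 (2 * pi) (fun x => dz x ^+ 2).
Proof.
move=> hz cdz pz pdz Kmu muK orth.
have mu0 : 0 < mu by apply: le_lt_trans Kmu; rewrite ler0n.
have cz : continuous z by move=> x; apply: deriv_continuous (hz x).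
pose M : 'M[R]_(N.+1, N) := \matrix_(i, j)
  if unlift ord0 i is Some k then node_condition K (trig k) j
  else node_condition K z j.
have [a a0 aM] := left_kernel M.
pose al := a 0 ord0; pose l (k : 'I_N) := a 0 (lift ord0 k).
pose v x := al * z x + \sum_(k < N) l k * trig k x.
pose dv x := al * dz x + \sum_(k < N) l k * dtrig k x.
have hv x : has_deriv x 1 v (dv x).
  apply: has_deriv_eq.
    apply: pderiveD; first by apply: pderiveM; [exact: pderiveC|exact: hz].
    apply: pderive_sum => k; apply: pderiveM; first exact: pderiveC.
    exact: derive_trig.
  rewrite /dv mul0r add0r; congr (_ + _).
  by apply: eq_bigr => k _; rewrite mul0r add0r.
have cdv : continuous dv.
  by rewrite /dv; cont ltac:(solve [exact: continuous_dtrig|exact: cdz]).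
have pv x : v (x + 2 * pi) = v x.
  by rewrite /v pz; congr (_ + _); apply: eq_bigr => k _; rewrite trig_turn.
have pdv x : dv (x + 2 * pi) = dv x.
  by rewrite /dv pdz; congr (_ + _); apply: eq_bigr => k _; rewrite dtrig_turn.
have nc j : (j < N)%N -> node_condition K v j = 0.
  move=> jN; have /rowP/(_ (Ordinal jN)) := aM.
  rewrite !mxE big_ord_recl !mxE unlift_none /=.
  under eq_bigr => k _ do rewrite !mxE liftK /=.
  move=> <-; rewrite -/al.
  under [in RHS]eq_bigr => k _ do rewrite -/(l k).
  rewrite /v /node_condition; case: ifP => _.
    rewrite mulrDr addrACA -big_split /=; congr (_ + _).
    by apply: eq_bigr => k _; rewrite mulrDr.
  rewrite mulrBr opprD addrACA -sumrN -big_split /=; congr (_ + _).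
  by apply: eq_bigr => k _; rewrite mulrBr.
have := wirtinger_nodes hv cdv pv mu0 muK nc pdv.
rewrite (@defint_sqr_expand R 0 (2 * pi) N (fun j => trig j) (fun=> 1)
  (fun j => @continuous_trig R j) trig_orth_ord z (fun=> 0) al l cz orth).
have orth' (j : 'I_N) : defint 0 (2 * pi) (fun x => dz x * dtrig j x) = 0.
  by rewrite (trig_parts _ hz) // orth mulr0.
rewrite (@defint_sqr_expand R 0 (2 * pi) N (fun j => dtrig j)
  (fun j => (freq j)%:R ^+ 2)
  (fun j => @continuous_dtrig R j) dtrig_orth_ord dz (fun=> 0) al l cdz orth').
have -> : \sum_(j < N) l j * 0 = 0 by rewrite big1 // => j _; rewrite mulr0.
rewrite !mulr0 !addr0; set Z := defint _ _ _; set Z' := defint _ _ _ => H.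
have {H} H : \sum_(j < N) (mu ^+ 2 - (freq j)%:R ^+ 2) * l j ^+ 2
    <= al ^+ 2 * (Z' - mu ^+ 2 * Z).
  under eq_bigr => j _ do rewrite mulrBl.
  rewrite sumrB -mulr_sumr; move: H.
  under [X in _ * (_ + X) <= _]eq_bigr => j _ do rewrite mul1r.
  by lra.
have fmu (j : 'I_N) : 0 < mu ^+ 2 - (freq j)%:R ^+ 2.
  rewrite subr_gt0 ltrXn2r ?ler0n // ?(ltW mu0) //.
  by apply: le_lt_trans Kmu; rewrite ler_nat freq_le.
have S0 : 0 <= \sum_(j < N) (mu ^+ 2 - (freq j)%:R ^+ 2) * l j ^+ 2.
  by apply: sumr_ge0 => j _; rewrite mulr_ge0 ?sqr_ge0 // ltW.
have [al0|al0] := eqVneq al 0; last first.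
  have := le_trans S0 H; rewrite pmulr_rge0 ?exprn_even_gt0 //.
  by rewrite subr_ge0.
move: H; rewrite al0 expr0n mul0r => H.
have /eqP : \sum_(j < N) (mu ^+ 2 - (freq j)%:R ^+ 2) * l j ^+ 2 = 0.
  by apply/eqP; rewrite eq_le H S0.
rewrite psumr_eq0; last by move=> j _; rewrite mulr_ge0 ?sqr_ge0 // ltW.
move=> /allP L; case/negP: a0; apply/eqP/rowP => i; rewrite mxE.
case: (unliftP ord0 i) => [k ->|->]; last exact: al0.
have := L k (mem_index_enum _); rewrite mulf_eq0 gt_eqF //= sqrf_eq0.
by move/eqP.
Qed.

(** What remains of [v] without its modes of frequency at most [K] is subject
   to [wirtinger_orthogonal], while these modes contribute exactly the sum on
   the left. *)
Lemma wirtinger_modes (v dv : R -> R) mu W :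
  (forall x : R, has_deriv x 1 v (dv x)) -> continuous dv ->
  (forall x, v (x + 2 * pi) = v x) -> (forall x, dv (x + 2 * pi) = dv x) ->
  K%:R < mu -> mu < K.+1%:R -> W <= mu ^+ 2 ->
  \sum_(j < N) ((freq j)%:R ^+ 2 - W)
      * defint 0 (2 * pi) (fun x => v x * trig j x) ^+ 2
  <= defint 0 (2 * pi) (fun x => dv x ^+ 2)
     - W * defint 0 (2 * pi) (fun x => v x ^+ 2).
Proof.
move=> hv cdv pv pdv Kmu muK Wmu.
have cv : continuous v by move=> x; apply: deriv_continuous (hv x).
pose s (j : 'I_N) := defint 0 (2 * pi) (fun x => v x * trig j x).
pose z x := 1 * v x + \sum_(k < N) (- s k) * trig k x.
pose dz x := 1 * dv x + \sum_(k < N) (- s k) * dtrig k x.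
have hz x : has_deriv x 1 z (dz x).
  apply: has_deriv_eq.
    apply: pderiveD; first by apply: pderiveM; [exact: pderiveC|exact: hv].
    apply: pderive_sum => k; apply: pderiveM; first exact: pderiveC.
    exact: derive_trig.
  rewrite /dz mul0r add0r; congr (_ + _).
  by apply: eq_bigr => k _; rewrite mul0r add0r.
have cdz : continuous dz.
  by rewrite /dz; cont ltac:(solve [exact: continuous_dtrig|exact: cdv]).
have pz x : z (x + 2 * pi) = z x.
  by rewrite /z pv; congr (_ + _); apply: eq_bigr => k _; rewrite trig_turn.
have pdz x : dz (x + 2 * pi) = dz x.
  by rewrite /dz pdv; congr (_ + _); apply: eq_bigr => k _; rewrite dtrig_turn.
have oz (j : 'I_N) : defint 0 (2 * pi) (fun x => z x * trig j x) = 0.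
  under defint_ext => x.
    have -> : z x * trig j x =
       v x * trig j x + \sum_(k < N) (- s k) * (trig k x * trig j x).
      rewrite /z mul1r mulrDl mulr_suml; congr (_ + _).
      by apply: eq_bigr => k _; ring.
    over.
  rewrite defintD; last 2 first.
  - by apply: continuous_mul => //; exact: continuous_trig.
  - by cont ltac:(solve [exact: continuous_trig]).
  rewrite defint_sum; last by move=> k; cont ltac:(solve [exact: continuous_trig]).
  under eq_bigr => k _.
    rewrite defintZ; last by cont ltac:(solve [exact: continuous_trig]).
    rewrite trig_orth; over.
  rewrite (bigD1 j) //= eqxx mulr1 big1 ?addr0 -/(s j) ?subrr //.
  by move=> k kj; rewrite -val_eqE /= in kj; rewrite (negbTE kj) mulr0.
have := wirtinger_orthogonal hz cdz pz pdz Kmu muK oz.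
rewrite (@defint_sqr_expand R 0 (2 * pi) N (fun j => trig j) (fun=> 1)
  (fun j => @continuous_trig R j) trig_orth_ord v s 1 (fun k => - s k) cv (fun=> erefl)).
rewrite (@defint_sqr_expand R 0 (2 * pi) N (fun j => dtrig j)
  (fun j => (freq j)%:R ^+ 2)
  (fun j => @continuous_dtrig R j) dtrig_orth_ord dv (fun j => (freq j)%:R ^+ 2 * s j)
   1 (fun k => - s k) cdv (fun j => trig_parts _ hv cdv pv)).
set V := defint _ _ (fun x => v x ^+ 2); set V' := defint _ _ (fun x => dv x ^+ 2).
have -> : \sum_(j < N) (- s j) * s j = - \sum_(j < N) s j ^+ 2.
  by rewrite -sumrN; apply: eq_bigr => j _; rewrite mulNr expr2.
have -> : \sum_(j < N) 1 * (- s j) ^+ 2 = \sum_(j < N) s j ^+ 2.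
  by apply: eq_bigr => j _; rewrite sqrrN mul1r.
have -> : \sum_(j < N) (- s j) * ((freq j)%:R ^+ 2 * s j) =
    - \sum_(j < N) (freq j)%:R ^+ 2 * s j ^+ 2.
  by rewrite -sumrN; apply: eq_bigr => j _; ring.
have -> : \sum_(j < N) (freq j)%:R ^+ 2 * (- s j) ^+ 2 =
    \sum_(j < N) (freq j)%:R ^+ 2 * s j ^+ 2.
  by apply: eq_bigr => j _; rewrite sqrrN.
have -> : \sum_(j < N) ((freq j)%:R ^+ 2 - W) * s j ^+ 2 =
   \sum_(j < N) (freq j)%:R ^+ 2 * s j ^+ 2 - W * \sum_(j < N) s j ^+ 2.
  by rewrite mulr_sumr -sumrB; apply: eq_bigr => j _; rewrite mulrBl.
have B : 0 <= V - \sum_(j < N) s j ^+ 2 by rewrite subr_ge0; exact: bessel.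
have := ler_wpM2r B Wmu.
by rewrite expr1n !mul1r mulr1; lra.
Qed.

End Modes.
End Wirtinger.

(** * The profile of the catenoid *)

(** [d * s - E s * exp (- C * s)] is nondecreasing in [s]. *)
Lemma gronwall {R : realType} (E dE : R -> R) (C d T : R) :
  0 <= C -> 0 <= d ->
  (forall t : R, 0 <= t <= T -> has_deriv t 1 E (dE t)) ->
  (forall t, 0 <= t <= T -> dE t <= C * E t + d) -> E 0 = 0 ->
  forall t, 0 <= t <= T -> E t <= d * t * expR (C * t).
Proof.
move=> C0 d0 hE hC EE t /andP[t0 tT].
pose G s := d * s - E s * expR (- C * s).
have dexp (s : R) : has_deriv s 1 (fun s => expR (- C * s)) (expR (- C * s) * (- C)).
  apply: (@pderive_comp _ _ expR (fun s => - C * s)); first exact: is_derive_expR.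
  by der ltac:(fail); ring.
have hG (s : R) : 0 <= s <= t ->
    has_deriv s 1 G (d - (dE s - C * E s) * expR (- C * s)).
  move=> /andP[s0 st]; rewrite /G.
  der ltac:(solve [exact: dexp|by apply: hE; rewrite s0 (le_trans st tT)]).
  by ring.
have : 0 <= G t.
  have -> : 0 = G 0 by rewrite /G EE mul0r mulr0 subrr.
  apply: (derive_ge0_le t0 hG) => s /andP[s0 st].
  have H1 : dE s - C * E s <= d by rewrite lerBlDl hC // s0 (le_trans st).
  have H2 : expR (- C * s) <= 1.
    by rewrite -expR0 ler_expR mulNr oppr_le0 mulr_ge0.
  have H3 := expR_ge0 (- C * s).
  rewrite subr_ge0; apply: le_trans (ler_wpM2r H3 H1) _.
  by rewrite ler_piMr.
rewrite subr_ge0 => H; have /(ler_wpM2r) := H => /(_ (expR (C * t)) (expR_ge0 _)).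
by rewrite -[E t * _ * _]mulrA -expRD mulNr addNr expR0 mulr1.
Qed.

Section Profile.
Context {R : realType}.
Variables (a : R) (f : R -> R).
Hypotheses (a0 : 0 < a) (hf : catenoid_profile a f).
Implicit Types t : R.

Definition f1 := derive1 f.
Definition f2 := derive1 f1.

Lemma derive_f t : has_deriv t 1 f (f1 t).
Proof. by case: hf => _ /(_ t)[+ _] _ _; rewrite /f1 derive1E => /derivableP. Qed.

Lemma derive_f1 t : has_deriv t 1 f1 (f2 t).
Proof. by case: hf => _ /(_ t)[_ +] _ _; rewrite /f2 derive1E => /derivableP. Qed.

Lemma f_ge t : a <= f t.
Proof. by case: hf. Qed.

Lemma f_gt0 t : 0 < f t.
Proof. exact: lt_le_trans (f_ge t). Qed.

Lemma f_at0 : f 0 = a.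
Proof. by case: hf => _ _ _ []. Qed.

Lemma f1_at0 : f1 0 = 0.
Proof. by case: hf => _ _ _ []. Qed.

Lemma f_neq0 t : f t != 0.
Proof. by rewrite gt_eqF // f_gt0. Qed.

Lemma f24_gt0 t : 0 < f t ^+ 2 + 4.
Proof. by have := sqr_ge0 (f t); lra. Qed.

Lemma f24_neq0 t : f t ^+ 2 + 4 != 0.
Proof. by rewrite gt_eqF // f24_gt0. Qed.

Lemma a_neq0 : a != 0.
Proof. by rewrite gt_eqF. Qed.

Hint Resolve f_neq0 f24_neq0 a_neq0 : core.

Lemma f2_ode t : f2 t = 4 * (1 + f1 t ^+ 2) / (f t * (f t ^+ 2 + 4)).
Proof.
case: hf => _ _ /(_ t) E _; rewrite -[derive1 (derive1 f)]/f2 -[derive1 f]/f1 in E.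
by rewrite -E mulrC mulKf // mulf_neq0.
Qed.

(** [(1 + f1 ^ 2) (f ^ 2 + 4) / f ^ 2] is constant by the profile equation.
   With its help all derivatives of [f] are expressed through [f] and [f1],
   and the squares of [f1] through [f]. *)
Lemma first_integral t : 1 + f1 t ^+ 2 = (a ^+ 2 + 4) * f t ^+ 2 / (a ^+ 2 * (f t ^+ 2 + 4)).
Proof.
pose G t := (1 + f1 t ^+ 2) * (f t ^+ 2 + 4) * (f t ^+ 2)^-1.
have hG (s : R) : has_deriv s 1 G 0.
  rewrite /G; der ltac:(solve [exact: derive_f|exact: derive_f1]).
    by rewrite expf_neq0.
  rewrite f2_ode; field; by rewrite f_neq0 f24_neq0.
have := derive0_const hG t 0; rewrite /G f_at0 f1_at0 expr0n addr0 mul1r => E.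
have -> : 1 + f1 t ^+ 2 = G t * f t ^+ 2 / (f t ^+ 2 + 4).
  by rewrite /G; field; rewrite f_neq0 f24_neq0.
by rewrite [G t]E; field; rewrite a_neq0 f24_neq0.
Qed.

Lemma f1_sqr t : f1 t ^+ 2 = 4 * (f t ^+ 2 - a ^+ 2) / (a ^+ 2 * (f t ^+ 2 + 4)).
Proof.
have := first_integral t => /(congr1 (fun x => x - 1)).
rewrite addrAC subrr add0r => ->; field; by rewrite f24_neq0 a_neq0.
Qed.

Lemma f2E t : f2 t = 4 * (a ^+ 2 + 4) * f t / (a ^+ 2 * (f t ^+ 2 + 4) ^+ 2).
Proof.
by rewrite f2_ode first_integral; field; rewrite f_neq0 f24_neq0 a_neq0.
Qed.

Lemma f2_gt0 t : 0 < f2 t.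
Proof.
rewrite f2E divr_gt0 ?mulr_gt0 ?f_gt0 ?exprn_gt0 ?f24_gt0 //.
by have := sqr_ge0 a; lra.
Qed.

Lemma f1_gt0 t : 0 < t -> 0 < f1 t.
Proof.
move=> t0; rewrite -f1_at0.
apply: (derive_gt0_lt t0 (fun x _ => derive_f1 x)) => x _; exact: f2_gt0.
Qed.

Lemma f_unbounded M : exists2 t, 0 < t & M < f t.
Proof.
have d1 : 0 < f1 1 by exact: f1_gt0.
pose t := 1 + (`|M| + 1) / f1 1.
have t1 : 1 <= t by rewrite lerDl divr_ge0 ?ltW // ltr_wpDl.
exists t; first exact: lt_le_trans t1.
have [c /andP[c1 _] E] := MVT_le t1 (fun x _ => derive_f x).
have : f1 1 <= f1 c.
  by apply: (derive_ge0_le c1 (fun x _ => derive_f1 x)) => x _; rewrite ltW ?f2_gt0.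
move=> H; have Et : f1 1 * (t - 1) = `|M| + 1.
  by rewrite /t addrAC subrr add0r mulrC divfK // gt_eqF.
have H2 : f1 1 * (t - 1) <= f1 c * (t - 1) by rewrite ler_wpM2r // subr_ge0.
have := ler_norm M; have := f_gt0 1; rewrite Et in H2; lra.
Qed.

(** The first integral expresses the second derivative of [f ^ 2] through [f ^
   2] alone. Therefore [d t = f t ^ 2 - f (- t) ^ 2] solves a linear equation
   with a bounded coefficient and zero initial data, and Gronwall's
   inequality applies. *)
Lemma f_even t : f (- t) = f t.
Proof.
wlog t0 : t / 0 <= t.
  move=> W; case: (leP 0 t) => [/W //|tn].
  by rewrite -[in RHS](opprK t) [RHS]W // oppr_ge0 ltW.
pose d t := f t ^+ 2 - f (- t) ^+ 2.
pose d1 t := 2 * (f t * f1 t + f (- t) * f1 (- t)).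
pose c := 32 * (a ^+ 2 + 4) / a ^+ 2.
pose q t := c * (f t ^+ 2 + f (- t) ^+ 2 + 8) /
              ((f t ^+ 2 + 4) ^+ 2 * (f (- t) ^+ 2 + 4) ^+ 2).
have hN (g dg : R -> R) : (forall s : R, has_deriv s 1 g (dg s)) ->
    forall s : R, has_deriv s 1 (fun s => g (- s)) (dg (- s) * (- 1)).
  move=> hg s; apply: pderive_comp; first exact: hg.
  by apply: pderiveN; exact: pderive_id.
have hfN := hN _ _ derive_f; have hf1N := hN _ _ derive_f1.
have hd (s : R) : has_deriv s 1 d (d1 s).
  rewrite /d /d1; der ltac:(solve [exact: derive_f|exact: hfN]).
  by move: (f s) (f (- s)) (f1 s) (f1 (- s)) => u u' p p'; ring.
have H s : f1 s * f1 s + f s * f2 s =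
  4 / a ^+ 2 - 16 * (a ^+ 2 + 4) / (a ^+ 2 * (f s ^+ 2 + 4) ^+ 2).
  by rewrite -expr2 f1_sqr f2E; field; rewrite f24_neq0 a_neq0.
have hd1 (s : R) : has_deriv s 1 d1 (q s * d s).
  rewrite /d1; der ltac:(solve [exact: derive_f|exact: hfN|exact: derive_f1|exact: hf1N]).
  move: (H s) (H (- s)) (f24_neq0 s) (f24_neq0 (- s)); rewrite /q /d /c.
  move: (f s) (f (- s)) (f1 s) (f1 (- s)) (f2 s) (f2 (- s)) => u u' p p' r r'.
  move=> Hu Hu' u0 u0'.
  transitivity (2 * ((p * p + u * r) - (p' * p' + u' * r'))); first by ring.
  rewrite Hu Hu'; field; by rewrite u0 u0' a_neq0.
have c0 : 0 <= c.
  by rewrite /c divr_ge0 ?sqr_ge0 // mulr_ge0 // addr_ge0 ?sqr_ge0.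
have qb s : 0 <= q s <= c.
  have e1 := sqr_ge0 (f s); have e2 := sqr_ge0 (f (- s)).
  rewrite /q; set u := f s ^+ 2 in e1 *; set v := f (- s) ^+ 2 in e2 *.
  have u4 : 0 < u + 4 by lra.
  have v4 : 0 < v + 4 by lra.
  have D : 0 < (u + 4) ^+ 2 * (v + 4) ^+ 2 by rewrite mulr_gt0 ?exprn_gt0.
  apply/andP; split; first by rewrite divr_ge0 ?(ltW D) // mulr_ge0 //; lra.
  rewrite ler_pdivrMr // ler_wpM2l //.
  have : 1 <= (u + 4) * (v + 4) by nra.
  have : u + v + 8 <= (u + 4) * (v + 4) by nra.
  have -> : (u + 4) ^+ 2 * (v + 4) ^+ 2 = ((u + 4) * (v + 4)) * ((u + 4) * (v + 4)) by ring.
  by move=> h1 h2; nra.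
pose E s := d s ^+ 2 + d1 s ^+ 2.
have hE (s : R) : has_deriv s 1 E (2 * (1 + q s) * (d s * d1 s)).
  by rewrite /E; der ltac:(solve [exact: hd|exact: hd1]); ring.
have Z : E t = 0.
  apply/eqP; rewrite eq_le addr_ge0 ?sqr_ge0 // andbT.
  suff H0 : E t <= 0 * t * expR ((1 + c) * t) by move: H0; rewrite !mul0r.
  apply: (@gronwall _ E (fun s => 2 * (1 + q s) * (d s * d1 s)) (1 + c) 0 t) => //;
    rewrite ?addr_ge0 ?t0 ?lexx //.
  - move=> s _; rewrite /E addr0.
    have /andP[q0 qc] := qb s.
    have H1 : 2 * (d s * d1 s) <= d s ^+ 2 + d1 s ^+ 2.
      by have := sqr_ge0 (d s - d1 s); lra.
    have H2 : 0 <= d s ^+ 2 + d1 s ^+ 2 by rewrite addr_ge0 ?sqr_ge0.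
    apply: (@le_trans _ _ ((1 + q s) * (d s ^+ 2 + d1 s ^+ 2))).
      have -> : 2 * (1 + q s) * (d s * d1 s) = (1 + q s) * (2 * (d s * d1 s)) by ring.
      by rewrite ler_wpM2l // addr_ge0.
    by rewrite ler_wpM2r // lerD2l.
  - by rewrite /E /d /d1 oppr0 f1_at0 !mulr0 addr0 mulr0 subrr expr0n addr0.
have : d t ^+ 2 = 0.
  by have := sqr_ge0 (d t); have := sqr_ge0 (d1 t); rewrite /E in Z; lra.
move/eqP; rewrite sqrf_eq0 subr_eq0 eqrXn2 ?(ltW (f_gt0 _)) //.
by move/eqP.
Qed.

Lemma continuous_f : continuous f.
Proof. by move=> t; apply: deriv_continuous (derive_f t). Qed.

Lemma continuous_f1 : continuous f1.
Proof. by move=> t; apply: deriv_continuous (derive_f1 t). Qed.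

Definition rate t : R := 2 / (f t ^+ 2 + 4).

Lemma continuous_rate : continuous rate.
Proof.
by rewrite /rate; cont ltac:(solve [exact: continuous_f|move=> ?; exact: f24_neq0]);
  move=> ?; exact: f24_neq0.
Qed.

Lemma rate_gt0 t : 0 < rate t.
Proof. by rewrite divr_gt0 ?f24_gt0. Qed.

(** The twist angle: [theta - Phi t] is constant along the orthogonal
   trajectories of the parallels, and [2 * Phi / a] is the conformal height. *)
Definition Phi : R -> R := prim rate.

Lemma derive_Phi t : has_deriv t 1 Phi (rate t).
Proof. exact/derive_prim/continuous_rate. Qed.

Lemma Phi_at0 : Phi 0 = 0.
Proof. exact/prim0/continuous_rate. Qed.

Lemma continuous_Phi : continuous Phi.
Proof. by move=> t; apply: deriv_continuous (derive_Phi t). Qed.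

Lemma Phi_le s t : s <= t -> Phi s <= Phi t.
Proof.
move=> st; apply: (derive_ge0_le st (fun x _ => derive_Phi x)) => x _.
by rewrite ltW ?rate_gt0.
Qed.

Lemma Phi_gt0 t : 0 < t -> 0 < Phi t.
Proof.
move=> t0; rewrite -[X in X < _]Phi_at0.
by apply: (derive_gt0_lt t0 (fun x _ => derive_Phi x)) => x _; exact: rate_gt0.
Qed.

(** The coefficients of the Jacobi operator [J]. The area density of the
   catenoid is [dens]; with respect to the conformal height [s], where [ds /
   dt = 1 / cond], and the twisted angle, the operator [- dens * cond * J] is
   the flat Laplacian plus the potential [pot]. *)
Definition cond t : R := a * (f t ^+ 2 + 4) / 4.

Lemma cond_gt0 t : 0 < cond t.
Proof. by rewrite /cond divr_gt0 ?mulr_gt0 ?f24_gt0. Qed.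

Lemma cond_neq0 t : cond t != 0.
Proof. by rewrite gt_eqF ?cond_gt0. Qed.

Lemma cond_rate t : cond t * rate t = a / 2.
Proof. by rewrite /cond /rate; field. Qed.

Lemma derive_cond t : has_deriv t 1 cond (a * f t * f1 t / 2).
Proof. by rewrite /cond; der ltac:(solve [exact: derive_f]); field. Qed.

Lemma continuous_cond : continuous cond.
Proof. by move=> t; apply: deriv_continuous (derive_cond t). Qed.

Definition dens t : R := f t ^+ 2 / a.

Lemma dens_gt0 t : 0 < dens t.
Proof. by rewrite /dens divr_gt0 ?exprn_gt0 ?f_gt0. Qed.

Lemma continuous_dens : continuous dens.
Proof. by rewrite /dens; cont ltac:(solve [exact: continuous_f]). Qed.

Definition pot t : R := a ^+ 2 + 2 - 8 * (f t ^+ 2 - a ^+ 2) / (f t ^+ 2 * (f t ^+ 2 + 4)).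

Lemma continuous_pot : continuous pot.
Proof.
rewrite /pot; cont ltac:(solve [exact: continuous_f]).
by move=> t; rewrite mulf_neq0 ?expf_neq0.
Qed.

Lemma f2_ge t : a ^+ 2 <= f t ^+ 2.
Proof. by rewrite lerXn2r ?f_ge // nnegrE ltW // f_gt0. Qed.

Lemma pot_le t : pot t <= a ^+ 2 + 2.
Proof.
rewrite /pot lerBlDr lerDl divr_ge0 // mulr_ge0 ?subr_ge0 ?f2_ge //.
  exact: sqr_ge0.
by rewrite ltW // f24_gt0.
Qed.

Lemma pot_ge t : a ^+ 2 <= pot t.
Proof.
have y0 : 0 < f t ^+ 2 by rewrite exprn_gt0 ?f_gt0.
have := f24_gt0 t; have a2 := sqr_ge0 a; rewrite /pot.
set y := f t ^+ 2 in y0 * => y4.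
have D : 0 < y * (y + 4) by rewrite mulr_gt0.
have : 8 * (y - a ^+ 2) / (y * (y + 4)) <= 2.
  by rewrite ler_pdivrMr //; nra.
by lra.
Qed.

(** The Jacobi field induced by the vertical translations. *)
Definition vert t : R := a * f1 t / f t.
Definition dvert t : R := a * (f2 t * f t - f1 t ^+ 2) / f t ^+ 2.

Lemma derive_vert t : has_deriv t 1 vert (dvert t).
Proof.
rewrite /vert /dvert; der ltac:(solve [exact: derive_f|exact: derive_f1]) => //.
by field.
Qed.

Lemma cond_dvert t :
  cond t * dvert t = (a ^+ 2 + 4) / (f t ^+ 2 + 4) - 1 + a ^+ 2 / f t ^+ 2.
Proof.
rewrite /cond /dvert f1_sqr f2E; field.
by rewrite f_neq0 f24_neq0 a_neq0.
Qed.

(** The Jacobi equation for functions of the height alone. *)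
Lemma derive_cond_dvert t :
  has_deriv t 1 (fun t => cond t * dvert t) (- (pot t / cond t) * vert t).
Proof.
have -> : (fun t => cond t * dvert t) =
  (fun t => (a ^+ 2 + 4) / (f t ^+ 2 + 4) - 1 + a ^+ 2 / f t ^+ 2).
  by apply/funext => s; exact: cond_dvert.
der ltac:(solve [exact: derive_f]) => //; first by rewrite expf_neq0.
rewrite /pot /cond /vert; field; by rewrite f_neq0 f24_neq0 a_neq0.
Qed.

(** The even Jacobi field of frequency 1 induced by the horizontal
   translations. *)
Definition horiz t : R := cos (Phi t) / f t - f1 t / 2 * sin (Phi t).
Definition cond_dhoriz t : R :=
  - sin (Phi t) * (a / (2 * f t) + (a ^+ 2 + 4) * f t / (2 * a * (f t ^+ 2 + 4)))
  - cos (Phi t) * f1 t * (a * (f t ^+ 2 + 4) / (4 * f t ^+ 2) + a / 4).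

(** With [derive_cond_dhoriz], the Jacobi equation for the frequency [1],
   written as a first order system for the field and its flux [cond_dhoriz]. *)
Lemma derive_horiz t : has_deriv t 1 horiz (cond_dhoriz t / cond t).
Proof.
rewrite /horiz; der ltac:(solve [exact: derive_f|exact: derive_f1|exact: derive_Phi]) => //.
rewrite f2E /cond_dhoriz /cond /rate; field; by rewrite f_neq0 f24_neq0 a_neq0.
Qed.

Lemma derive_cond_dhoriz t :
  has_deriv t 1 cond_dhoriz ((1 - pot t) / cond t * horiz t).
Proof.
rewrite /cond_dhoriz.
der ltac:(solve [exact: derive_f|exact: derive_f1|exact: derive_Phi]).
- by rewrite mulf_neq0 ?pnatr_eq0.
- by rewrite !mulf_neq0 ?pnatr_eq0.
- by rewrite !mulf_neq0 ?expf_neq0 ?pnatr_eq0.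
rewrite f2E /horiz /pot /cond /rate.
have E3 : f1 t ^+ 2 - 4 * (f t ^+ 2 - a ^+ 2) / (a ^+ 2 * (f t ^+ 2 + 4)) = 0.
  by rewrite f1_sqr subrr.
set s := sin _; set c := cos _.
apply/eqP; rewrite -subr_eq0; apply/eqP.
rewrite -[RHS](mulr0 (2 * a * c / f t ^+ 3)) -[in RHS]E3.
field; by rewrite f_neq0 f24_neq0 a_neq0.
Qed.

(** The inverse radius [a / f] and the cosine both solve second order
   equations in the conformal height, which compare since [a / f <= 1]. *)
Lemma inv_radius_ge t : 0 <= t ->
  (forall s, 0 <= s <= t -> 0 < cos (Num.sqrt (a ^+ 2 + 4) / a * Phi s)) ->
  cos (Num.sqrt (a ^+ 2 + 4) / a * Phi t) <= a / f t.
Proof.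
move=> t0; set b := Num.sqrt (a ^+ 2 + 4) => cpos.
have b2 : b ^+ 2 = a ^+ 2 + 4.
  by rewrite sqr_sqrtr // addr_ge0 ?sqr_ge0.
pose m t := a / f t; pose dm t := - a * f1 t / f t ^+ 2.
pose c t := cos (b / a * Phi t); pose dc t := - (b / a * rate t) * sin (b / a * Phi t).
pose cdm t := - (a ^+ 2 / 4) * (f t ^+ 2 + 4) * f1 t / f t ^+ 2.
pose cdc t := - (b / 2) * sin (b / a * Phi t).
have hm (s : R) : has_deriv s 1 m (cdm s / cond s).
  rewrite /m; der ltac:(solve [exact: derive_f]) => //.
  by rewrite /cdm /cond; field; rewrite f_neq0 f24_neq0 a_neq0.
have hc (s : R) : has_deriv s 1 c (cdc s / cond s).
  rewrite /c; der ltac:(solve [exact: derive_Phi]).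
  by rewrite /cdc /rate /cond; field; rewrite f24_neq0 a_neq0.
have hcdm (s : R) : has_deriv s 1 cdm (m s * (4 - a ^+ 2 - 8 * m s ^+ 2) / 4 / cond s).
  rewrite /cdm; der ltac:(solve [exact: derive_f|exact: derive_f1]).
    by rewrite expf_neq0.
  rewrite f2E /m /cond.
  have E3 : f1 s ^+ 2 - 4 * (f s ^+ 2 - a ^+ 2) / (a ^+ 2 * (f s ^+ 2 + 4)) = 0.
    by rewrite f1_sqr subrr.
  apply/eqP; rewrite -subr_eq0; apply/eqP.
  rewrite -[RHS](mulr0 (2 * a ^+ 2 / f s ^+ 3)) -[in RHS]E3.
  field; by rewrite f_neq0 f24_neq0 a_neq0.
have hcdc (s : R) : has_deriv s 1 cdc (- (b ^+ 2 / 4) * c s / cond s).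
  rewrite /cdc /c; der ltac:(solve [exact: derive_Phi]).
  by rewrite /rate /cond; field; rewrite f24_neq0 a_neq0.
pose w s := cdm s * c s - m s * cdc s.
have hw (s : R) : has_deriv s 1 w (2 * m s * (1 - m s ^+ 2) * c s / cond s).
  rewrite /w; der ltac:(solve [exact: hm|exact: hc|exact: hcdm|exact: hcdc]).
  by rewrite b2; field; rewrite cond_neq0.
have m01 s : 0 < m s <= 1.
  by rewrite /m divr_gt0 ?f_gt0 //= ler_pdivrMr ?f_gt0 // mul1r f_ge.
have w0 s : 0 <= s <= t -> 0 <= w s.
  move=> /andP[s0 st].
  have <- : w 0 = 0.
    by rewrite /w /cdm /cdc f1_at0 Phi_at0 !(mulr0, mul0r, sin0) subrr.
  apply: (derive_ge0_le s0 (fun x _ => hw x)) => x /andP[x0 xs].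
  have /andP[m0 m1] := m01 x.
  rewrite divr_ge0 ?(ltW (cond_gt0 _)) // mulr_ge0 //.
    have : 0 <= 1 - m x ^+ 2 by rewrite subr_ge0 exprn_ile1 // ltW.
    by apply: mulr_ge0; rewrite mulr_ge0 // ltW.
  by rewrite ltW // cpos // x0 (le_trans xs).
have hr (s : R) : 0 <= s <= t -> has_deriv s 1 (fun s => m s / c s) (w s / (cond s * c s ^+ 2)).
  move=> st; have cn : c s != 0 by rewrite gt_eqF // cpos.
  der ltac:(solve [exact: hm|exact: hc]) => //.
  by rewrite /w; field; rewrite cn cond_neq0.
have := derive_ge0_le t0 hr; rewrite /m /c Phi_at0 mulr0 cos0 f_at0 divff // divr1 => H.
have {H} : 1 <= a / f t / cos (b / a * Phi t).
  apply: H => x xt; rewrite divr_ge0 ?w0 // mulr_ge0 ?sqr_ge0 //.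
  by rewrite ltW ?cond_gt0.
by rewrite ler_pdivlMr ?mul1r // cpos // t0 lexx.
Qed.

(** Otherwise [Phi <= phi] on the half-line, the cosine in [inv_radius_ge]
   stays away from zero, and [f] would be bounded. *)
Lemma Phi_attains phi : 0 <= phi -> Num.sqrt (a ^+ 2 + 4) / a * phi < pi / 2 ->
  exists2 t, 0 < t & phi < Phi t.
Proof.
move=> phi0 hphi; apply: contrapT => H.
have Hle t : 0 < t -> Phi t <= phi.
  by move=> t0; rewrite leNgt; apply/negP => h; apply: H; exists t.
set b := Num.sqrt (a ^+ 2 + 4) / a in hphi.
have b0 : 0 < b by rewrite divr_gt0 // sqrtr_gt0 ltr_wpDl ?sqr_ge0.
pose c0 := cos (b * phi).
have pi2 := @pi_gt0 R.
have c00 : 0 < c0.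
  rewrite cos_gt0_pihalf // hphi andbT; apply: (@lt_le_trans _ _ 0); first by lra.
  by rewrite mulr_ge0 // ltW.
have cge s : 0 <= s -> c0 <= cos (b * Phi s).
  move=> s0; have P0 : 0 <= Phi s by rewrite -Phi_at0 Phi_le.
  have Ple : Phi s <= phi.
    by move: s0; rewrite le_eqVlt => /orP[/eqP <-|/Hle //]; rewrite Phi_at0.
  have i1 : b * Phi s <= b * phi by rewrite ler_pM2l.
  have i0 : 0 <= b * Phi s by rewrite mulr_ge0 // ltW.
  rewrite /c0 leNgt; apply/negP; rewrite ltr_cos; first by rewrite ltNge i1.
    by rewrite in_itv /=; apply/andP; split; lra.
  by rewrite in_itv /= i0; lra.
have [t t0 ft] := f_unbounded (a / c0).
have := @inv_radius_ge t (ltW t0) => /(_ _) H1.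
have {H1} H1 : c0 <= a / f t.
  apply: le_trans (cge t (ltW t0)) (H1 _) => s /andP[s0 _].
  exact: lt_le_trans (cge s s0).
move: ft; rewrite ltr_pdivrMr // => h2; move: H1; rewrite ler_pdivlMr ?f_gt0 //.
by rewrite mulrC leNgt h2.
Qed.

End Profile.

(** * Linear systems on the line *)

Section Bounds.
Context {R : realType}.
Implicit Types (g : R -> R) (t T : R).

Lemma continuous_bounded g T : continuous g ->
  exists2 C, 0 <= C & forall t, `|t| <= T -> `|g t| <= C.
Proof.
move=> cg; case: (leP 0 T) => T0; last first.
  by exists 0 => // t tT; move: (le_lt_trans tT T0); rewrite normr_lt0.
have [||c _ H] := @EVT_max R (fun t => `|g t|) (- T) T; first by rewrite ge0_cp.
  apply: continuous_subspaceT => x; apply: cvg_norm; exact: cg.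
exists `|g c| => // t tT; apply: H.
by rewrite in_itv /= -ler_norml.
Qed.

Lemma prim_reflect g t : continuous g -> prim g (- t) = - prim (fun s => g (- s)) t.
Proof.
move=> cg; have := defint_reflect 0 t cg.
rewrite oppr0 /defint (prim0 cg) prim0; last first.
  by apply: (continuous_after cg); exact: continuous_opp continuous_ident.
by rewrite subr0 sub0r => ->; rewrite opprK.
Qed.

(** The majorant depends on the absolute value of the variable, which treats
   both half-lines at once. *)
Lemma prim_bound g (P p : R -> R) T : continuous g ->
  (forall t : R, has_deriv t 1 P (p t)) -> P 0 = 0 ->
  (forall t, `|t| <= T -> `|g t| <= p `|t|) ->
  forall t, `|t| <= T -> `|prim g t| <= P `|t|.
Proof.
move=> cg hP P0 gp t tT.
have main (h : R -> R) s : continuous h -> (forall t, `|t| <= T -> `|h t| <= p `|t|) ->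
    0 <= s -> s <= T -> `|prim h s| <= P s.
  move=> ch hp s0 sT; rewrite ler_norml; apply/andP; split.
    have := @derive_ge0_le R (fun s => prim h s + P s) (fun s => h s + p s) 0 s s0.
    rewrite prim0 // P0 addr0 => H; rewrite -subr_ge0 opprK; apply: H.
      by move=> x _; apply: pderiveD; [exact: derive_prim|exact: hP].
    move=> x /andP[x0 xs]; have := hp x; rewrite ger0_norm // (le_trans xs) //.
    by move=> /(_ isT); rewrite ler_norml => /andP[+ _]; rewrite -subr_ge0 opprK.
  have := @derive_ge0_le R (fun s => P s - prim h s) (fun s => p s - h s) 0 s s0.
  rewrite prim0 // P0 subrr => H; rewrite -subr_ge0; apply: H.
    by move=> x _; apply: pderiveD; [exact: hP|apply: pderiveN; exact: derive_prim].
  move=> x /andP[x0 xs]; have := hp x; rewrite ger0_norm // (le_trans xs) //.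
  by move=> /(_ isT); rewrite ler_norml => /andP[_ +]; rewrite -subr_ge0.
case: (leP 0 t) => t0.
  by rewrite (ger0_norm t0); apply: main => //; rewrite -(ger0_norm t0).
rewrite (ltr0_norm t0) -{1}[t]opprK prim_reflect // normrN.
apply: main; rewrite ?oppr_ge0 ?(ltW t0) //.
- by apply: (continuous_after cg); exact: continuous_opp continuous_ident.
- by move=> s sT; have := gp (- s); rewrite normrN; apply.
- by rewrite -(ltr0_norm t0).
Qed.

Lemma primD f g t : continuous f -> continuous g ->
  prim (fun x => f x + g x) t = prim f t + prim g t.
Proof.
move=> cf cg; have := defintD 0 t cf cg.
rewrite /defint !prim0 ?subr0 //; exact: continuous_add.
Qed.

Lemma primB f g t : continuous f -> continuous g ->
  prim (fun x => f x - g x) t = prim f t - prim g t.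
Proof.
move=> cf cg; have := defintB 0 t cf cg.
rewrite /defint !prim0 ?subr0 //; apply: continuous_add => //.
exact: continuous_opp.
Qed.

End Bounds.

Section Picard.
Context {R : realType} (B q : R -> R).
Hypotheses (cB : continuous B) (cq : continuous q).
Implicit Types (t T : R).

(** The integral operator of the system [y' = B z], [z' = q y] with [z 0 = 0],
   after elimination of [z]. *)
Definition picard_step (y : R -> R) : R -> R :=
  prim (fun s => B s * prim (fun r => q r * y r) s).

Lemma continuous_picard_inner y : continuous y ->
  continuous (fun s => B s * prim (fun r => q r * y r) s).
Proof.
by move=> cy; apply: continuous_mul => //; apply: continuous_prim; exact: continuous_mul.
Qed.

Lemma continuous_picard_step y : continuous y -> continuous (picard_step y).
Proof. by move=> cy; apply: continuous_prim; exact: continuous_picard_inner. Qed.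

Lemma picard_stepD y z t : continuous y -> continuous z ->
  picard_step (fun x => y x + z x) t = picard_step y t + picard_step z t.
Proof.
move=> cy cz; rewrite /picard_step -primD; try exact: continuous_picard_inner.
congr (prim _ t); apply/funext => s; rewrite -mulrDr -primD;
  try exact: continuous_mul.
by congr (_ * prim _ s); apply/funext => r; rewrite mulrDr.
Qed.

Lemma picard_stepB y z t : continuous y -> continuous z ->
  picard_step (fun x => y x - z x) t = picard_step y t - picard_step z t.
Proof.
move=> cy cz; rewrite /picard_step -primB; try exact: continuous_picard_inner.
congr (prim _ t); apply/funext => s; rewrite -mulrBr -primB;
  try exact: continuous_mul.
by congr (_ * prim _ s); apply/funext => r; rewrite mulrBr.
Qed.

Definition picard_term (n : nat) : R -> R := iter n picard_step (fun=> 1).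
Definition picard_sum (n : nat) t : R := \sum_(k < n) picard_term k t.

Lemma continuous_picard_term n : continuous (picard_term n).
Proof.
elim: n => [|n IH]; first exact: continuous_cst.
exact: continuous_picard_step.
Qed.

Lemma continuous_picard_sum n : continuous (picard_sum n).
Proof. by apply: continuous_sum => k; exact: continuous_picard_term. Qed.

Lemma picard_sumS n t : picard_sum n.+1 t = 1 + picard_step (picard_sum n) t.
Proof.
elim: n => [|n IH].
  rewrite /picard_sum big_ord1 /picard_step [picard_term 0 t]/=.
  have -> : (fun r => q r * \sum_(k < 0) picard_term k r) = (fun=> 0).
    by apply/funext => r; rewrite big_ord0 mulr0.
  have P0 : prim (fun _ : R => 0) = (fun=> 0 : R).
    apply/funext => s; have := @defint_cst R 0 s 0.
    by rewrite /defint prim0 ?subr0 ?mul0r //; exact: continuous_cst.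
  rewrite P0; have -> : (fun s => B s * (fun=> 0) s) = (fun=> 0).
    by apply/funext => s; rewrite mulr0.
  by rewrite P0 addr0.
rewrite {1}/picard_sum big_ord_recr /= -/(picard_sum n.+1 t) IH -addrA; congr (_ + _).
rewrite -picard_stepD; last 2 first.
- exact: continuous_picard_sum.
- exact: continuous_picard_term.
congr (picard_step _ t); apply/funext => s.
by rewrite /picard_sum big_ord_recr.
Qed.

Section OnSegment.
Variables (T C : R).
Hypotheses (T0 : 0 <= T) (C0 : 0 <= C).
Hypothesis BC : forall t, `|t| <= T -> `|B t| <= C.
Hypothesis qC : forall t, `|t| <= T -> `|q t| <= C.

Let M := C ^+ 2 * T.
Let M0 : 0 <= M. Proof. by rewrite mulr_ge0 ?sqr_ge0. Qed.

Lemma picard_inner_bound y (p : R -> R) : continuous y ->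
  (forall s t, 0 <= s -> s <= t -> p s <= p t) ->
  (forall t, `|t| <= T -> `|y t| <= p `|t|) ->
  forall t, `|t| <= T ->
    `|B t * prim (fun r => q r * y r) t| <= M * p `|t|.
Proof.
move=> cy pm yp t tT.
have -> : M * p `|t| = C * (C * p `|t| * T) by rewrite /M; ring.
rewrite normrM ler_pM // ?BC //.
have p0 : 0 <= p `|t| by apply: le_trans (yp t tT).
have H := @prim_bound R (fun r => q r * y r) (fun s => C * p `|t| * s)
  (fun=> C * p `|t|) `|t| _ _ _ _ t (lexx _).
apply: (le_trans (H _ _ _ _)).
- exact: continuous_mul.
- by move=> s; der ltac:(fail); ring.
- by rewrite mulr0.
- move=> s st; rewrite normrM ler_pM // ?qC ?(le_trans st) //.
  by rewrite (le_trans (yp s _)) ?(le_trans st) // pm.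
by rewrite ler_wpM2l // mulr_ge0.
Qed.

Lemma picard_term_bound n t : `|t| <= T ->
  `|picard_term n t| <= exp_coeff (M * `|t|) n.
Proof.
elim: n t => [|n IH] t tT.
  by rewrite /exp_coeff /= expr0 divr1 normr1.
have dE (s : R) : has_deriv s 1 (fun s => exp_coeff (M * s) n.+1)
    (M * exp_coeff (M * s) n).
  rewrite /exp_coeff /=; der ltac:(fail).
  rewrite factS natrM; field.
  by rewrite !pnatr_eq0 -lt0n fact_gt0 /=.
apply: (prim_bound _ dE _ _ tT).
- by apply: continuous_picard_inner; exact: continuous_picard_term.
- by rewrite /exp_coeff /= mulr0 expr0n mul0r.
move=> s sT; apply: (@picard_inner_bound _ (fun s => exp_coeff (M * s) n)) => //.
- exact: continuous_picard_term.
- move=> u v u0 uv; rewrite /exp_coeff /= ler_wpM2r ?invr_ge0 ?ler0n //.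
  have v0 := le_trans u0 uv.
  by apply: lerXn2r; rewrite ?nnegrE ?mulr_ge0 ?ler_wpM2l.
Qed.

Let x := M * T.
Let e n : R := series (exp_coeff x) n.

Lemma picard_sum_cauchy m n t : `|t| <= T -> (n <= m)%N ->
  `|picard_sum m t - picard_sum n t| <= expR x - e n.
Proof.
move=> tT nm.
have Le : e m <= expR x.
  apply: nondecreasing_cvgn_le; last exact: is_cvg_series_exp_coeff.
  apply: nondecreasing_series => k _ _.
  by apply: exp_coeff_ge0; rewrite mulr_ge0.
apply: (@le_trans _ _ (e m - e n)); last by rewrite lerD2r.
have -> : picard_sum m t - picard_sum n t = \sum_(n <= k < m) picard_term k t.
  rewrite -sub_series_geq // /series /=.
  by rewrite /picard_sum -!(big_mkord predT (fun k => picard_term k t)).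
rewrite /e sub_series_geq //.
apply: le_trans (ler_norm_sum _ _ _) _; apply: ler_sum => k _.
apply: le_trans (picard_term_bound _ tT) _.
rewrite /exp_coeff /= ler_wpM2r ?invr_ge0 ?ler0n //.
by apply: lerXn2r; rewrite ?nnegrE ?mulr_ge0 ?ler_wpM2l.
Qed.

Lemma picard_tail_cvg (d : R) : 0 < d -> exists n, forall m, (n <= m)%N -> expR x - e m <= d.
Proof.
move=> d0; have /cvgrPdist_le/(_ d d0) := is_cvg_series_exp_coeff x.
move=> [n _ H]; exists n => m /H; rewrite -/(expR x).
exact/le_trans/ler_norm.
Qed.

End OnSegment.

Definition picard_lim t : R := limn (fun n => picard_sum n t).

Lemma segment_bound T : exists2 C, 0 <= C &
  (forall t, `|t| <= T -> `|B t| <= C) /\ (forall t, `|t| <= T -> `|q t| <= C).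
Proof.
have [C1 C10 H1] := continuous_bounded T cB.
have [C2 C20 H2] := continuous_bounded T cq.
exists (C1 + C2); first exact: addr_ge0.
split=> t tT; first by apply: le_trans (H1 t tT) _; rewrite lerDl.
by apply: le_trans (H2 t tT) _; rewrite lerDr.
Qed.

Lemma picard_uniform T (d : R) : 0 <= T -> 0 < d ->
  exists n, forall m t, (n <= m)%N -> `|t| <= T -> `|picard_lim t - picard_sum m t| <= d.
Proof.
move=> T0 d0; have [C C0 [BC qC]] := segment_bound T.
have hc t : `|t| <= T -> cvgn (fun n => picard_sum n t).
  move=> tT; have -> : (fun n => picard_sum n t) = series (fun n => picard_term n t).
    by apply/funext => n; rewrite /picard_sum /series /= big_mkord.
  apply: normed_cvg; apply: series_le_cvg (is_cvg_series_exp_coeff (C ^+ 2 * T * T)).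
  - by move=> n; exact: normr_ge0.
  - by move=> n; apply: exp_coeff_ge0; rewrite !mulr_ge0 ?sqr_ge0.
  move=> n; apply: le_trans (picard_term_bound T0 C0 BC qC n tT) _.
  rewrite /exp_coeff /= ler_wpM2r ?invr_ge0 ?ler0n //.
  by apply: lerXn2r; rewrite ?nnegrE ?mulr_ge0 ?ler_wpM2l ?mulr_ge0 ?sqr_ge0.
have [n Hn] := picard_tail_cvg T C d0.
exists n => m t nm tT; apply/ler_addgt0Pr => d' d'0.
have /cvgrPdist_le/(_ d' d'0)[k _ Hk] := hc t tT.
pose j := maxn k m.
have h1 := Hk j (leq_maxl _ _).
have h2 := picard_sum_cauchy T0 C0 BC qC tT (leq_maxr k m : (m <= j)%N).
have h3 := Hn m nm.
have -> : picard_lim t - picard_sum m t =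
  (picard_sum j t - picard_sum m t) + (picard_lim t - picard_sum j t) by ring.
apply: le_trans (ler_normD _ _) _; apply: lerD => //.
exact: le_trans h2 h3.
Qed.

Lemma continuous_picard_lim : continuous picard_lim.
Proof.
move=> t; apply/cvgrPdist_le => /= d d0.
have d3 : 0 < d / 3 by rewrite divr_gt0.
have T0 : 0 <= `|t| + 1 by rewrite addr_ge0.
have [n Hn] := picard_uniform T0 d3.
have /cvgrPdist_le/(_ _ d3) Hs := @continuous_picard_sum n t.
near=> s.
have st : `|t - s| <= 1 by near: s; apply: cvgr_dist_le.
have sT : `|s| <= `|t| + 1.
  have -> : s = t - (t - s) by ring.
  by apply: le_trans (ler_normB _ _) _; rewrite lerD2l.
have tT : `|t| <= `|t| + 1 by rewrite lerDl.
have h1 := Hn n t (leqnn _) tT; have h2 := Hn n s (leqnn _) sT.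
have h3 : `|picard_sum n t - picard_sum n s| <= d / 3 by near: s.
have -> : picard_lim t - picard_lim s = (picard_lim t - picard_sum n t) +
  (picard_sum n t - picard_sum n s) - (picard_lim s - picard_sum n s) by ring.
apply: le_trans (ler_normB _ _) _; apply: (@le_trans _ _ (d / 3 + d / 3 + d / 3)); last by lra.
by apply: lerD => //; apply: le_trans (ler_normD _ _) _; apply: lerD.
Unshelve. all: by end_near. Qed.

Lemma picard_fixpoint t : picard_lim t = 1 + picard_step picard_lim t.
Proof.
have [C C0 [BC qC]] := segment_bound `|t|.
pose M := C ^+ 2 * `|t| * `|t|.
have M0 : 0 <= M by rewrite !mulr_ge0 ?sqr_ge0.
apply/eqP; rewrite -subr_eq0 -normr_le0; apply/ler_addgt0Pr => d d0.
rewrite add0r.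
have e0 : 0 < d / (1 + M) by rewrite divr_gt0 // ltr_wpDr.
have [n Hn] := picard_uniform (normr_ge0 t) e0.
have h1 := Hn n.+1 t (leqnSn n) (lexx _).
have cl := continuous_picard_lim; have cs := @continuous_picard_sum n.
have h2 : `|picard_step (fun s => picard_sum n s - picard_lim s) t| <= d / (1 + M) * M.
  have cd : continuous (fun s => picard_sum n s - picard_lim s).
    by apply: continuous_add => //; exact: continuous_opp.
  have -> : d / (1 + M) * M = (C ^+ 2 * `|t|) * (d / (1 + M)) * `|t|.
    by rewrite /M; ring.
  apply: (@prim_bound R _ (fun s => (C ^+ 2 * `|t|) * (d / (1 + M)) * s)
    (fun=> (C ^+ 2 * `|t|) * (d / (1 + M))) `|t|) => //.
  - exact: continuous_picard_inner.
  - by move=> s; der ltac:(fail); ring.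
  - by rewrite mulr0.
  move=> s st; apply: (@picard_inner_bound `|t| C C0 BC qC
      (fun s => picard_sum n s - picard_lim s) (fun=> d / (1 + M)) cd) => //.
  by move=> r rt; rewrite distrC; apply: Hn.
rewrite picard_stepB // in h2.
have -> : picard_lim t - (1 + picard_step picard_lim t) =
   (picard_lim t - picard_sum n.+1 t) + (picard_step (picard_sum n) t - picard_step picard_lim t).
  by rewrite picard_sumS; ring.
apply: le_trans (ler_normD _ _) _; apply: le_trans (lerD h1 h2) _.
by rewrite -[X in X + _]mulr1 -mulrDr divfK // gt_eqF // ltr_wpDr.
Qed.

(** Picard iteration: on each segment the increments of [y] are dominated by
   the terms of an exponential series ([picard_term_bound]), so they add up
   to a fixed point of [1 + picard_step] on the whole line. *)
Theorem linear_system_solution : exists y z : R -> R,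
  [/\ y 0 = 1, z 0 = 0, (forall t : R, has_deriv t 1 y (B t * z t))
    & (forall t : R, has_deriv t 1 z (q t * y t))].
Proof.
have cl := continuous_picard_lim.
have cqy : continuous (fun r => q r * picard_lim r) by exact: continuous_mul.
exists picard_lim, (prim (fun r => q r * picard_lim r)); split.
- rewrite picard_fixpoint /picard_step prim0 ?addr0 //.
  exact: continuous_picard_inner.
- exact: prim0.
- move=> t; have -> : picard_lim = (fun t => 1 + picard_step picard_lim t).
    by apply/funext => s; exact: picard_fixpoint.
  apply: has_deriv_eq.
    apply: pderiveD; first exact: pderiveC.
    apply: derive_prim; apply: continuous_picard_inner.
    exact: cl.
  rewrite add0r; congr (_ * prim _ t); apply/funext => s.
  by rewrite -picard_fixpoint.
- by move=> t; exact: derive_prim.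
Qed.

End Picard.

(** * Sturm comparison and shooting *)

Section FirstZero.
Context {R : realType}.

Lemma near_gt (p : R -> R) (t c : R) : continuous p -> c < p t ->
  exists2 r, 0 < r & forall x, `|t - x| < r -> c < p x.
Proof.
move=> cp ct; have d0 : 0 < p t - c by rewrite subr_gt0.
have /cvgrPdist_lt/(_ _ d0)[r /= r0 H] := cp t.
exists r => // x /H; rewrite ltr_norml => /andP[_ +]; lra.
Qed.

Lemma near_lt (p : R -> R) (t c : R) : continuous p -> p t < c ->
  exists2 r, 0 < r & forall x, `|t - x| < r -> p x < c.
Proof.
move=> cp; rewrite -ltrN2 => /(near_gt (continuous_opp cp))[r r0 H].
by exists r => // x /H; rewrite ltrN2.
Qed.

Lemma first_zero (p : R -> R) (s : R) : continuous p -> 0 < p 0 -> 0 <= s -> p s <= 0 ->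
  exists2 tau, 0 < tau <= s & p tau = 0 /\ forall t, 0 <= t < tau -> 0 < p t.
Proof.
move=> cp p0 s0 ps.
pose S := [set t | 0 <= t <= s /\ p t <= 0].
have Ss : S s by rewrite /S /= s0 lexx.
have Slb : has_lbound S by exists 0 => t [/andP[]].
have Sinf : has_inf S by split; [exists s|].
pose tau := inf S.
have tau0 : 0 <= tau by apply: lb_le_inf; [exists s|move=> t [/andP[]]].
have taus : tau <= s by apply: ge_inf.
have pos t : 0 <= t < tau -> 0 < p t.
  move=> /andP[t0 tt]; rewrite ltNge; apply/negP => pt.
  have : tau <= t by apply: ge_inf => //; rewrite /S /= t0 pt (ltW (lt_le_trans tt taus)).
  by rewrite leNgt tt.
have ptau : p tau <= 0.
  rewrite leNgt; apply/negP => h.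
  have [r r0 Hr] := near_gt cp h.
  have [x Sx xr] := @inf_adherent R S r r0 Sinf.
  have tx : tau <= x by apply: ge_inf.
  have H := Hr x.
  case: Sx => _ px; move: px; rewrite leNgt H //.
  by rewrite distrC ger0_norm ?subr_ge0 // ltrBlDl.
have tau1 : 0 < tau.
  rewrite lt_neqAle tau0 andbT; apply/eqP => E.
  by move: ptau; rewrite -E leNgt p0.
exists tau; first by rewrite tau1.
split=> //; apply/eqP; rewrite eq_le ptau /= leNgt; apply/negP => h.
have [r r0 Hr] := near_lt cp h.
pose x := Num.max 0 (tau - r / 2).
have x0 : 0 <= x by rewrite le_max lexx.
have xt : x < tau by rewrite gt_max tau1 /=; lra.
have := pos x; rewrite x0 xt => /(_ isT); rewrite ltNge ltW //.
apply: Hr; rewrite ger0_norm ?subr_ge0 ?(ltW xt) //.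
have : tau - r / 2 <= x by rewrite le_max lexx orbT.
lra.
Qed.

End FirstZero.

Section Shooting.
Context {R : realType} (B q r : R -> R).
Hypotheses (cB : continuous B) (cq : continuous q) (cr : continuous r).
Hypotheses (B0 : forall t, 0 < B t) (r0 : forall t, 0 < r t).
Hypotheses (evB : forall t, B (- t) = B t) (evq : forall t, q (- t) = q t)
  (evr : forall t, r (- t) = r t).

(** The Sturm-Liouville equation [(y' / B)' = (q - lam r) y] as a first order
   system for [y] and its flux [z = y' / B]. The initial values select the
   even solution. *)
Definition solution (lam : R) (y z : R -> R) :=
  [/\ y 0 = 1, z 0 = 0, (forall t : R, has_deriv t 1 y (B t * z t))
    & (forall t : R, has_deriv t 1 z ((q t - lam * r t) * y t))].

Lemma continuous_qr lam : continuous (fun t => q t - lam * r t).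
Proof. by cont ltac:(solve [done]). Qed.

Lemma solution_exists lam : exists yz : (R -> R) * (R -> R), solution lam yz.1 yz.2.
Proof.
have [y [z H]] := linear_system_solution cB (@continuous_qr lam).
by exists (y, z).
Qed.

Lemma solution_continuous lam y z : solution lam y z -> continuous y /\ continuous z.
Proof.
move=> [_ _ hy hz]; split=> t; first exact: deriv_continuous (hy t).
exact: deriv_continuous (hz t).
Qed.

(** Continuous dependence on the parameter, by Gronwall's inequality. *)
Lemma solution_stability T lam y z : 0 <= T -> solution lam y z ->
  exists2 D, 0 <= D & forall mu u w, solution mu u w -> `|mu - lam| <= 1 ->
    forall t, 0 <= t <= T -> (u t - y t) ^+ 2 + (w t - z t) ^+ 2 <= D * (mu - lam) ^+ 2.
Proof.
move=> T0 hs; have [cy cz] := solution_continuous hs.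
have cC : continuous (fun t => B t + q t - lam * r t) by cont ltac:(solve [done]).
have [C1 C10 H1] := continuous_bounded T cC.
have [C2 C20 H2] := continuous_bounded T cr.
have cry : continuous (fun t => r t * y t) by cont ltac:(solve [done]).
have [C3 C30 H3] := continuous_bounded T cry.
pose C := C1 + C2 + 1.
exists (C3 ^+ 2 * T * expR (C * T)); first by rewrite !mulr_ge0 ?sqr_ge0 ?expR_ge0.
move=> mu u w [u0 w0 hu hw] mul t tT.
have [y0 z0 hy hz] := hs.
pose d t := u t - y t; pose e t := w t - z t.
pose E t := d t ^+ 2 + e t ^+ 2.
have hd (s : R) : has_deriv s 1 d (B s * e s).
  by rewrite /d /e; der ltac:(solve [exact: hu|exact: hy]); ring.
have he (s : R) : has_deriv s 1 e ((q s - mu * r s) * d s - (mu - lam) * (r s * y s)).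
  by rewrite /d /e; der ltac:(solve [exact: hw|exact: hz]); ring.
pose dE s := 2 * (d s * e s) * (B s + q s - mu * r s) - 2 * e s * ((mu - lam) * (r s * y s)).
have hE (s : R) : has_deriv s 1 E (dE s).
  by rewrite /E /dE; der ltac:(solve [exact: hd|exact: he]); rewrite /=; ring.
have bd s : 0 <= s <= T -> dE s <= C * E s + (mu - lam) ^+ 2 * C3 ^+ 2.
  move=> /andP[s0 sT]; have sT' : `|s| <= T by rewrite ger0_norm.
  have h1 := H1 s sT'; have h2 := H2 s sT'; have h3 := H3 s sT'.
  have K : `|B s + q s - mu * r s| <= C1 + C2.
    have -> : B s + q s - mu * r s = (B s + q s - lam * r s) - (mu - lam) * r s by ring.
    apply: le_trans (ler_normB _ _) _; apply: lerD => //.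
    by rewrite normrM -[C2]mul1r ler_pM.
  have X1 : 2 * (d s * e s) * (B s + q s - mu * r s) <= (C1 + C2) * E s.
    apply: le_trans (ler_norm _) _; rewrite normrM mulrC.
    apply: ler_pM => //; rewrite normrM (ger0_norm (ler0n _ 2)) normrM /E.
    have := sqr_ge0 (`|d s| - `|e s|); rewrite -[d s ^+ 2]real_normK ?num_real //.
    by rewrite -[e s ^+ 2]real_normK ?num_real //; lra.
  have X2 : - (2 * e s * ((mu - lam) * (r s * y s))) <=
      E s + (mu - lam) ^+ 2 * C3 ^+ 2.
    have g1 : (r s * y s) ^+ 2 <= C3 ^+ 2.
      by rewrite -[X in X <= _]real_normK ?num_real // lerXn2r ?nnegrE.
    have g2 := ler_wpM2l (sqr_ge0 (mu - lam)) g1.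
    have g3 := sqr_ge0 (e s + (mu - lam) * (r s * y s)).
    have g4 := sqr_ge0 (d s).
    rewrite /E; apply: le_trans (lerD (lexx _) g2).
    have -> : (mu - lam) ^+ 2 * (r s * y s) ^+ 2 = ((mu - lam) * (r s * y s)) ^+ 2.
      by ring.
    by lra.
  have E0 : 0 <= E s by rewrite addr_ge0 ?sqr_ge0.
  rewrite /dE; apply: le_trans (lerD X1 X2) _.
  by rewrite le_eqVlt; apply/orP; left; apply/eqP; rewrite /C; ring.
have C0 : 0 <= C by rewrite /C !addr_ge0.
have := gronwall C0 (_ : 0 <= (mu - lam) ^+ 2 * C3 ^+ 2) (fun s _ => hE s) bd _ tT.
rewrite /E /d /e u0 w0 y0 z0 !subrr expr0n addr0 => H.
apply: le_trans (H _ erefl) _; first by rewrite mulr_ge0 ?sqr_ge0.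
have /andP[t0 tT'] := tT.
have -> : C3 ^+ 2 * T * expR (C * T) * (mu - lam) ^+ 2 =
   (mu - lam) ^+ 2 * C3 ^+ 2 * T * expR (C * T) by ring.
have P0 : 0 <= (mu - lam) ^+ 2 * C3 ^+ 2 by rewrite -exprMn sqr_ge0.
apply: ler_pM; rewrite ?expR_ge0 ?(mulr_ge0 P0) //.
  by rewrite ler_wpM2l.
by rewrite ler_expR ler_wpM2l.
Qed.

Lemma solution_unique lam y z u w : solution lam y z -> solution lam u w ->
  forall t, 0 <= t -> u t = y t /\ w t = z t.
Proof.
move=> h1 h2 t t0; have [D _ H] := solution_stability t0 h1.
have := H _ _ _ h2; rewrite subrr normr0 expr0n mulr0 => /(_ ler01 t).
rewrite t0 lexx => /(_ isT) L.
have g1 := sqr_ge0 (u t - y t); have g2 := sqr_ge0 (w t - z t).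
have e1 : (u t - y t) ^+ 2 = 0 by lra.
have e2 : (w t - z t) ^+ 2 = 0 by lra.
by split; apply/eqP; rewrite -subr_eq0 -sqrf_eq0 ?e1 ?e2.
Qed.

Lemma solution_even lam y z : solution lam y z -> forall t, y (- t) = y t.
Proof.
move=> hs t; have [y0 z0 hy hz] := hs.
have hN (g dg : R -> R) : (forall s : R, has_deriv s 1 g (dg s)) ->
    forall s : R, has_deriv s 1 (fun s => g (- s)) (dg (- s) * (- 1)).
  move=> hg s; apply: pderive_comp; first exact: hg.
  by apply: pderiveN; exact: pderive_id.
have hsN : solution lam (fun t => y (- t)) (fun t => - z (- t)).
  split; rewrite ?oppr0 ?y0 ?z0 ?oppr0 // => s.
    by apply: has_deriv_eq; [exact: hN hy s|rewrite /= evB mulrN1 mulrN].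
  by apply: has_deriv_eq; [apply: pderiveN; exact: hN hz s|
    rewrite /= evq evr mulrN1 opprK].
case: (leP 0 t) => t0; first by have [] := solution_unique hs hsN t0.
have tn : 0 <= - t by rewrite oppr_ge0 ltW.
by have [+ _] := solution_unique hs hsN tn; rewrite opprK.
Qed.

(** Gronwall's inequality backwards in time: otherwise [y ^ 2 + z ^ 2] would
   vanish at [0] too. *)
Lemma solution_nondegenerate lam y z t : solution lam y z -> 0 <= t ->
  y t = 0 -> z t = 0 -> False.
Proof.
move=> hs t0 yt zt; have [y0 z0 hy hz] := hs.
have cC : continuous (fun t => B t + (q t - lam * r t)) by cont ltac:(solve [done]).
have [C C0 H] := continuous_bounded t cC.
pose E s := y (t - s) ^+ 2 + z (t - s) ^+ 2.
have hN (g dg : R -> R) : (forall s : R, has_deriv s 1 g (dg s)) ->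
    forall s : R, has_deriv s 1 (fun s => g (t - s)) (dg (t - s) * (0 - 1)).
  move=> hg s; apply: pderive_comp; first exact: hg.
  apply: pderiveD; first exact: pderiveC.
  by apply: pderiveN; exact: pderive_id.
pose dE s := - (2 * (y (t - s) * z (t - s)) * (B (t - s) + (q (t - s) - lam * r (t - s)))).
have hE (s : R) : has_deriv s 1 E (dE s).
  rewrite /E; der ltac:(solve [exact: (hN _ _ hy)|exact: (hN _ _ hz)]).
  by rewrite /dE /=; ring.
have := @gronwall R E dE C 0 t C0 (lexx _) (fun s _ => hE s) _ _ t.
rewrite t0 lexx /E !subr0 yt zt subrr y0 z0 !mul0r expr0n expr1n !addr0 => X.
have : (1 : R) <= 0.
  apply: X => // s /andP[s0 st].
  have := H (t - s); rewrite ger0_norm ?subr_ge0 // => /(_ _) H'.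
  have {H'} H' := H' (_ : t - s <= t).
  have K := H' (ltac:(by rewrite gerBl)).
  rewrite addr0 /dE.
  apply: le_trans (ler_norm _) _; rewrite normrN normrM mulrC.
  apply: ler_pM => //; rewrite normrM (ger0_norm (ler0n _ 2)) normrM.
  have := sqr_ge0 (`|y (t - s)| - `|z (t - s)|); rewrite -[y (t - s) ^+ 2]real_normK ?num_real //.
  by rewrite -[z (t - s) ^+ 2]real_normK ?num_real //; lra.
by rewrite ler10.
Qed.

(** If [y] were positive up to [tau], then [p / y] would be nondecreasing,
   because the Wronskian of the two is nonnegative; but it decreases from [p
   0] to [0]. *)
Lemma sturm_zero y z (p cp dcp : R -> R) tau : solution 0 y z -> 0 <= tau ->
  (forall t : R, has_deriv t 1 p (B t * cp t)) ->
  (forall t : R, has_deriv t 1 cp (dcp t)) ->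
  (forall t, 0 <= t <= tau -> q t * p t <= dcp t) ->
  0 < p 0 -> cp 0 = 0 -> p tau = 0 ->
  exists2 s, 0 <= s <= tau & y s <= 0.
Proof.
move=> [y0 z0 hy hz] tau0 hp hcp sub p0 cp0 ptau; apply: contrapT => H.
have ypos s : 0 <= s <= tau -> 0 < y s.
  by move=> st; rewrite ltNge; apply/negP => h; apply: H; exists s.
pose w t := cp t * y t - p t * z t.
have hw (t : R) : has_deriv t 1 w ((dcp t - q t * p t) * y t).
  by rewrite /w; der ltac:(solve [exact: hy|exact: hz|exact: hp|exact: hcp]); ring.
have w0 t : 0 <= t <= tau -> 0 <= w t.
  move=> /andP[t0 tt]; have <- : w 0 = 0 by rewrite /w cp0 z0 mul0r mulr0 subrr.
  apply: (derive_ge0_le t0 (fun x _ => hw x)) => x /andP[x0 xt].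
  have xtau : 0 <= x <= tau by rewrite x0 (le_trans xt).
  by rewrite mulr_ge0 ?subr_ge0 ?sub // ltW // ypos.
have hr (t : R) : 0 <= t <= tau -> has_deriv t 1 (fun t => p t / y t) (B t * w t / y t ^+ 2).
  move=> /ypos yt; have yn : y t != 0 by rewrite gt_eqF.
  by der ltac:(solve [exact: hp|exact: hy]) => //; rewrite /w; field.
have := derive_ge0_le tau0 hr; rewrite ptau mul0r y0 divr1 => X.
have : p 0 <= 0.
  by apply: X => x xt; rewrite divr_ge0 ?sqr_ge0 // mulr_ge0 ?w0 // ltW.
by rewrite leNgt p0.
Qed.

(** As long as [y] is positive its flux [z] is nondecreasing, hence so is [y];
   a first zero contradicts this. *)
Lemma positive_solution lam y z T : solution lam y z ->
  (forall t, 0 <= t <= T -> 0 <= q t - lam * r t) ->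
  forall t, 0 <= t <= T -> 1 <= y t.
Proof.
move=> hs Q t tT; have [y0 z0 hy hz] := hs; have [cy cz] := solution_continuous hs.
have key s : 0 <= s <= T -> (forall x, 0 <= x < s -> 0 < y x) -> 1 <= y s.
  move=> /andP[s0 sT] pos.
  have posc x : 0 <= x <= s -> 0 <= x < s \/ x = s.
    by move=> /andP[x0]; rewrite le_eqVlt => /orP[/eqP ->|xs];
      [right|left; rewrite x0].
  have zge x : 0 <= x < s -> 0 <= z x.
    move=> /andP[x0 xs]; rewrite -z0.
    apply: (derive_ge0_le x0 (fun x _ => hz x)) => v /andP[v0 vx].
    have vs := le_lt_trans vx xs.
    rewrite mulr_ge0 ?Q ?v0 ?(le_trans (ltW vs)) //.
    by rewrite ltW // pos // v0 vs.
  rewrite leNgt; apply/negP => ys.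
  have s1 : 0 < s.
    rewrite lt_neqAle s0 andbT; apply/eqP => E.
    by move: ys; rewrite -E y0 ltxx.
  have [d d0 Hd] := near_lt cy ys.
  pose x := Num.max 0 (s - d / 2).
  have x0 : 0 <= x by rewrite le_max lexx.
  have xs : x < s by rewrite gt_max s1 /=; lra.
  have yx : y x < 1.
    apply: Hd; rewrite ger0_norm ?subr_ge0 ?(ltW xs) //.
    have : s - d / 2 <= x by rewrite le_max lexx orbT.
    lra.
  have : y 0 <= y x.
    apply: (derive_ge0_le x0 (fun x _ => hy x)) => v /andP[v0 vx].
    by rewrite mulr_ge0 ?(ltW (B0 _)) // zge // v0 (le_lt_trans vx xs).
  by rewrite y0 leNgt yx.
have /andP[t0 tT'] := tT.
apply: (key t tT) => x /andP[x0 xt].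
rewrite ltNge; apply/negP => yx.
have y0' : 0 < y 0 by rewrite y0.
have [tau /andP[tau0 taux] [ytau pos]] := first_zero cy y0' x0 yx.
have : 1 <= y tau.
  by apply: key => //; rewrite (ltW tau0) (le_trans taux) // (le_trans (ltW xt)).
by rewrite ytau ler10.
Qed.

(** The minimum [m lam] of the solution over [[0, T]] is continuous in [lam].
   It is positive for very negative [lam], and [m 0 <= 0] by comparison with
   the subsolution [p]. When [m lam = 0], an interior zero would be a
   minimum, hence a zero of the flux as well, which [solution_nondegenerate]
   excludes: the solution is positive up to its zero at [T]. *)
Theorem shooting (p cp dcp : R -> R) (tau T : R) : 0 <= tau < T ->
  (forall t : R, has_deriv t 1 p (B t * cp t)) ->
  (forall t : R, has_deriv t 1 cp (dcp t)) ->
  (forall t, 0 <= t <= tau -> q t * p t <= dcp t) ->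
  0 < p 0 -> cp 0 = 0 -> p tau = 0 ->
  exists lam y z, [/\ lam < 0, solution lam y z,
    (forall t, `|t| < T -> 0 < y t) & (y T = 0 /\ y (- T) = 0)].
Proof.
move=> /andP[tau0 tauT] hp hcp sub p0 cp0 ptau.
have T0 : 0 < T by exact: le_lt_trans tauT.
have [sol hsol] := choice solution_exists.
pose y lam := (sol lam).1; pose z lam := (sol lam).2.
have cy lam : continuous (y lam) by have [] := solution_continuous (hsol lam).
have argmin lam : exists c, 0 <= c <= T /\ forall t, 0 <= t <= T -> y lam c <= y lam t.
  have [||c cT H] := @EVT_min R (y lam) 0 T; first exact: ltW.
    by apply: continuous_subspaceT => x; exact: cy.
  exists c; split; first by move: cT; rewrite in_itv.
  by move=> t tT; apply: H; rewrite in_itv.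
have [c hc] := choice argmin.
pose m lam := y lam (c lam).
have cm : continuous m.
  move=> lam; apply/cvgrPdist_le => /= e e0.
  have [D D0 HD] := solution_stability (ltW T0) (hsol lam).
  rewrite -/(y lam) -/(z lam) in HD.
  have g0 : 0 < e / (D + 1) by rewrite divr_gt0 // ltr_wpDl.
  near=> mu.
  have mu1 : `|mu - lam| <= 1 by rewrite distrC; near: mu; exact: cvgr_dist_le.
  have mue : `|mu - lam| <= e / (D + 1) by rewrite distrC; near: mu; exact: cvgr_dist_le.
  have dist t : 0 <= t <= T -> `|y mu t - y lam t| <= e.
    move=> tT; have := HD mu (y mu) (z mu) (hsol mu) mu1 t tT.
    have z2 := sqr_ge0 (z mu t - z lam t) => H.
    have H2 : `|y mu t - y lam t| ^+ 2 <= D * `|mu - lam| ^+ 2.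
      by rewrite !real_normK ?num_real //; lra.
    have H3 : D * `|mu - lam| ^+ 2 <= ((D + 1) * `|mu - lam|) ^+ 2.
      rewrite exprMn ler_wpM2r ?sqr_ge0 //.
      have := sqr_ge0 D; lra.
    have H4 : `|y mu t - y lam t| <= (D + 1) * `|mu - lam|.
      by rewrite -(@ler_pXn2r _ 2) ?nnegrE ?mulr_ge0 ?addr_ge0 // (le_trans H2 H3).
    apply: le_trans H4 _; rewrite mulrC -ler_pdivlMr // ltr_wpDl //.
  have [cl Hl] := hc lam; have [cmu Hmu] := hc mu.
  have d1 := dist _ cl; have d2 := dist _ cmu.
  have i1 := Hl _ cmu; have i2 := Hmu _ cl.
  rewrite /m; move: d1 d2; rewrite !ler_norml => /andP[a1 a2] /andP[a3 a4].
  by apply/andP; split; lra.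
have [C1 C10 H1] := continuous_bounded T cq.
have [C2 _ H2] := @EVT_min R r 0 T (ltW T0) (continuous_subspaceT cr).
(* With this choice [q + L * r] is nonnegative on the segment. *)
pose L := C1 / r C2.
have L0 : 0 <= L by rewrite divr_ge0 // ltW.
have mL : 1 <= m (- L).
  have [cT _] := hc (- L).
  apply: (positive_solution (hsol (- L)) _ cT) => t /andP[t0 tT].
  have h1 := H1 t; rewrite ger0_norm // in h1; have {}h1 := h1 tT.
  have h2 := H2 t; rewrite in_itv /= t0 tT in h2; have {}h2 := h2 isT.
  have h3 : C1 <= L * r t.
    by rewrite /L mulrAC -mulrA ler_peMr // ler_pdivlMr // mul1r.
  by rewrite ler_norml in h1; case/andP: h1 => h1 _; rewrite mulNr opprK; lra.
have [s /andP[s0 stau] ys] := sturm_zero (hsol 0) tau0 hp hcp sub p0 cp0 ptau.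
have sT : 0 <= s <= T by rewrite s0 (le_trans stau) // ltW.
have m0 : m 0 <= 0 by have [_ H] := hc 0; apply: le_trans (H s sT) ys.
have [|||lam] := @IVT R m (- L) 0 0.
- by rewrite oppr_le0.
- exact: continuous_subspaceT.
- by rewrite ge_min le_max m0 orbT (le_trans ler01 mL).
rewrite in_itv /= => /andP[Ll lam0] mlam.
have [cT Hc] := hc lam.
have ynn t : 0 <= t <= T -> 0 <= y lam t by move=> /Hc; rewrite -/(m lam) mlam.
have hs := hsol lam; have [y0 z0 hy hz] := hs.
have zero_end t : 0 <= t <= T -> y lam t = 0 -> t = T.
  move=> /andP[t0 tT] yt; apply/eqP; rewrite eq_le tT /= leNgt; apply/negP => tT'.
  have t1 : 0 < t.
    rewrite lt_neqAle t0 andbT; apply/eqP => E.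
    by move: yt; rewrite -E /y y0 => /eqP; rewrite oner_eq0.
  apply: (solution_nondegenerate hs t0 yt).
  have : (y lam)^`()%classic t = 0.
    have [] := @derive1_at_min R (y lam) 0 T t; first exact: ltW.
    - by move=> x _; case: (hy x).
    - by rewrite in_itv /= t1 tT'.
    - by move=> x; rewrite in_itv /= => /andP[/ltW x0 /ltW xT]; rewrite yt ynn // x0 xT.
    by move=> d1 d2; rewrite derive1E.
  have [_] := hy t; rewrite -derive1E => -> /eqP.
  by rewrite mulf_eq0 gt_eqF //= => /eqP.
have ec : c lam = T by apply: zero_end.
have yT : y lam T = 0 by rewrite -ec.
have pos t : 0 <= t -> t < T -> 0 < y lam t.
  move=> t0 tT; rewrite lt_neqAle ynn ?t0 ?(ltW tT) // andbT.
  apply/eqP => E; have := zero_end t; rewrite t0 (ltW tT) -E => /(_ isT erefl) F.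
  by move: tT; rewrite F ltxx.
exists lam, (y lam), (z lam); split => //.
- rewrite lt_neqAle lam0 andbT; apply/eqP => E.
  have := pos s s0 (le_lt_trans stau tauT).
  by rewrite E ltNge ys.
- move=> t tT; case: (leP 0 t) => t0; first by apply: pos; rewrite // -(ger0_norm t0).
  rewrite -[y lam t](solution_even hs); apply: pos; first by rewrite oppr_ge0 ltW.
  by rewrite -(ltr0_norm t0).
- by rewrite yT [y lam _](solution_even hs) -/(y lam) yT.
Unshelve. all: by end_near. Qed.

End Shooting.

(** * The Jacobi operator in coordinates *)

Section SmallMatrices.
Context {R : realType}.

Lemma sum_ord2 (F : 'I_2 -> R) : \sum_i F i = F 0 + F 1.
Proof. by rewrite !big_ord_recl big_ord0 addr0; congr (_ + F _); apply/val_inj. Qed.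

Lemma sum_ord3 (F : 'I_3 -> R) : \sum_i F i = F 0 + F 1 + F 2%:R.
Proof.
rewrite !big_ord_recl big_ord0 addr0 addrA.
by congr (_ + F _ + F _); apply/val_inj.
Qed.

Lemma ord2_ind (P : 'I_2 -> Prop) : P 0 -> P 1 -> forall i, P i.
Proof.
move=> p0 p1 [[|[|//]] i].
  by have -> : Ordinal i = 0 by apply/val_inj.
by have -> : Ordinal i = 1 by apply/val_inj.
Qed.

Lemma ord3_ind (P : 'I_3 -> Prop) : P 0 -> P 1 -> P 2%:R -> forall i, P i.
Proof.
move=> p0 p1 p2 [[|[|[|//]]] i].
- by have -> : Ordinal i = 0 by apply/val_inj.
- by have -> : Ordinal i = 1 by apply/val_inj.
- by have -> : Ordinal i = 2%:R by apply/val_inj.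
Qed.

Lemma det2 (M : 'M[R]_2) : \det M = M 0 0 * M 1 1 - M 0 1 * M 1 0.
Proof.
rewrite (expand_det_row _ 0) sum_ord2 /cofactor !det_mx11 !mxE /=.
rewrite expr0 mul1r expr1 mulN1r mulrN.
by congr (_ * M _ _ - _ * M _ _); apply/val_inj.
Qed.

Lemma det3 (M : 'M[R]_3) : \det M =
  M 0 0 * (M 1 1 * M 2%:R 2%:R - M 1 2%:R * M 2%:R 1)
  - M 0 1 * (M 1 0 * M 2%:R 2%:R - M 1 2%:R * M 2%:R 0)
  + M 0 2%:R * (M 1 0 * M 2%:R 1 - M 1 1 * M 2%:R 0).
Proof.
rewrite (expand_det_row _ 0) sum_ord3 /cofactor !det2 !mxE /=.
have l00 : lift 0 0 = 1 :> 'I_3 by apply/val_inj.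
have l01 : lift 0 1 = 2%:R :> 'I_3 by apply/val_inj.
have l10 : lift 1 0 = 0 :> 'I_3 by apply/val_inj.
have l11 : lift 1 1 = 2%:R :> 'I_3 by apply/val_inj.
have l20 : lift 2%:R 0 = 0 :> 'I_3 by apply/val_inj.
have l21 : lift 2%:R 1 = 1 :> 'I_3 by apply/val_inj.
rewrite !(l00, l01, l10, l11, l20, l21) expr0.
ring.
Qed.

Lemma invmx_eq n (A B : 'M[R]_n) : A *m B = 1%:M -> invmx A = B.
Proof.
move=> AB; have [uA _] := mulmx1_unit AB.
by rewrite -[LHS]mulmx1 -AB mulmxA mulVmx // mul1mx.
Qed.

Lemma row_deriv (V : normedModType R) n (M : V -> 'rV[R]_n.+1) (q v : V)
    (d : 'I_n.+1 -> R) :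
  (forall j, has_deriv q v (fun y => M y 0 j) (d j)) ->
  'D_v M q = \row_j d j.
Proof.
move=> H; rewrite derive_mx.
  by apply/rowP => j; rewrite !mxE; case: (H j).
by apply/derivable_mxP => i j; rewrite (ord1 i); case: (H j).
Qed.

End SmallMatrices.

Section AmbientGeometry.
Context {R : realType}.
Local Notation E := 'rV[R]_3.
Implicit Types (p v w : E).

(** The left-invariant form [dz + (y dx - x dy) / 2] at the point [p]. *)
Definition contact p v : R := v 0 2%:R + 2^-1 * (p 0 1 * v 0 0 - p 0 0 * v 0 1).

(** The metric, its inverse, the Christoffel symbols and their derivatives are
   tabulated, so that every identity between tensors is checked entry by
   entry. *)
Definition nil3_entry (x y : R) (i j : 'I_3) : R :=
  match val i, val j with
  | 0%N, 0%N => 1 + y ^+ 2 / 4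
  | 1%N, 1%N => 1 + x ^+ 2 / 4
  | 2%N, 2%N => 1
  | 0%N, 1%N | 1%N, 0%N => - (x * y) / 4
  | 0%N, _ | _, 0%N => y / 2
  | _, _ => - x / 2
  end.

Definition nil3_coentry (x y : R) (i j : 'I_3) : R :=
  match val i, val j with
  | 0%N, 0%N | 1%N, 1%N => 1
  | 2%N, 2%N => 1 + (x ^+ 2 + y ^+ 2) / 4
  | 0%N, 1%N | 1%N, 0%N => 0
  | 0%N, _ | _, 0%N => - y / 2
  | _, _ => x / 2
  end.

Lemma nil3_metricE p i j : nil3_metric p i j = nil3_entry (p 0 0) (p 0 1) i j.
Proof.
elim/ord3_ind: i; elim/ord3_ind: j;
  rewrite /nil3_entry /nil3_metric /= !mxE !big_ord1 !mxE /=; by field.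
Qed.

Lemma nil3_innerE p v w :
  inner nil3_metric p v w = v 0 0 * w 0 0 + v 0 1 * w 0 1 + contact p v * contact p w.
Proof.
rewrite /inner !mxE sum_ord3 !mxE !sum_ord3 !nil3_metricE /nil3_entry /contact /=.
by field.
Qed.

Lemma nil3_invE p : invmx (nil3_metric p) = \matrix_(i, j) nil3_coentry (p 0 0) (p 0 1) i j.
Proof.
apply: invmx_eq; apply/matrixP => i j; rewrite !mxE sum_ord3 !nil3_metricE !mxE.
by elim/ord3_ind: i; elim/ord3_ind: j; rewrite /nil3_entry /nil3_coentry /=; field.
Qed.

Lemma coord_deriv p (i j : 'I_3) :
  has_deriv p (evec i) (fun y : E => y 0 j) ((i == j)%:R).
Proof.
apply/derive_along_line.
have -> : (fun h : R => (h *: evec i + p) 0 j) = (fun h => h * (i == j)%:R + p 0 j).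
  by apply/funext => h; rewrite !mxE /= eq_sym.
by der ltac:(fail); ring.
Qed.

Definition nil3_dentry (x y : R) (l i j : 'I_3) : R :=
  match val l, val i, val j with
  | 0%N, 1%N, 1%N => x / 2
  | 0%N, 0%N, 1%N | 0%N, 1%N, 0%N => - y / 4
  | 0%N, 1%N, 2%N | 0%N, 2%N, 1%N => - 2^-1
  | 1%N, 0%N, 0%N => y / 2
  | 1%N, 0%N, 1%N | 1%N, 1%N, 0%N => - x / 4
  | 1%N, 0%N, 2%N | 1%N, 2%N, 0%N => 2^-1
  | _, _, _ => 0
  end.

Lemma nil3_metric_deriv p l i j :
  partial l (fun y => nil3_metric y i j) p = nil3_dentry (p 0 0) (p 0 1) l i j.
Proof.
have -> : (fun y => nil3_metric y i j) = (fun y => nil3_entry (y 0 0) (y 0 1) i j).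
  by apply/funext => y; exact: nil3_metricE.
have H : has_deriv p (evec l) (fun y : E => nil3_entry (y 0 0) (y 0 1) i j)
   (nil3_dentry (p 0 0) (p 0 1) l i j).
  elim/ord3_ind: i; elim/ord3_ind: j; rewrite /nil3_entry /=;
  (der ltac:(solve [exact: coord_deriv]));
  elim/ord3_ind: l; rewrite /nil3_dentry /=; by field.
by case: H.
Qed.

Definition nil3_gamma (x y : R) (k i j : 'I_3) : R :=
  match val k, val i, val j with
  | 0%N, 0%N, 1%N | 0%N, 1%N, 0%N => y / 4
  | 0%N, 1%N, 1%N => - x / 2
  | 0%N, 1%N, 2%N | 0%N, 2%N, 1%N => 2^-1
  | 1%N, 0%N, 0%N => - y / 2
  | 1%N, 0%N, 1%N | 1%N, 1%N, 0%N => x / 4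
  | 1%N, 0%N, 2%N | 1%N, 2%N, 0%N => - 2^-1
  | 2%N, 0%N, 0%N => - (x * y) / 4
  | 2%N, 1%N, 1%N => x * y / 4
  | 2%N, 0%N, 1%N | 2%N, 1%N, 0%N => (x ^+ 2 - y ^+ 2) / 8
  | 2%N, 0%N, 2%N | 2%N, 2%N, 0%N => - x / 4
  | 2%N, 1%N, 2%N | 2%N, 2%N, 1%N => - y / 4
  | _, _, _ => 0
  end.

Lemma nil3_christoffel p k i j :
  christoffel nil3_metric k i j p = nil3_gamma (p 0 0) (p 0 1) k i j.
Proof.
rewrite /christoffel sum_ord3 nil3_invE !mxE !nil3_metric_deriv.
by elim/ord3_ind: k; elim/ord3_ind: i; elim/ord3_ind: j;
  rewrite /nil3_coentry /nil3_dentry /nil3_gamma /=; field.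
Qed.

Definition nil3_dgamma (x y : R) (l k i j : 'I_3) : R :=
  match val l, val k, val i, val j with
  | 1%N, 0%N, 0%N, 1%N | 1%N, 0%N, 1%N, 0%N => 4^-1
  | 0%N, 0%N, 1%N, 1%N => - 2^-1
  | 1%N, 1%N, 0%N, 0%N => - 2^-1
  | 0%N, 1%N, 0%N, 1%N | 0%N, 1%N, 1%N, 0%N => 4^-1
  | 0%N, 2%N, 0%N, 0%N => - y / 4
  | 1%N, 2%N, 0%N, 0%N => - x / 4
  | 0%N, 2%N, 1%N, 1%N => y / 4
  | 1%N, 2%N, 1%N, 1%N => x / 4
  | 0%N, 2%N, 0%N, 1%N | 0%N, 2%N, 1%N, 0%N => x / 4
  | 1%N, 2%N, 0%N, 1%N | 1%N, 2%N, 1%N, 0%N => - y / 4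
  | 0%N, 2%N, 0%N, 2%N | 0%N, 2%N, 2%N, 0%N => - 4^-1
  | 1%N, 2%N, 1%N, 2%N | 1%N, 2%N, 2%N, 1%N => - 4^-1
  | _, _, _, _ => 0
  end.

Lemma nil3_christoffel_deriv p l k i j :
  partial l (christoffel nil3_metric k i j) p = nil3_dgamma (p 0 0) (p 0 1) l k i j.
Proof.
have -> : christoffel nil3_metric k i j = (fun y => nil3_gamma (y 0 0) (y 0 1) k i j).
  by apply/funext => y; exact: nil3_christoffel.
have H : has_deriv p (evec l) (fun y : E => nil3_gamma (y 0 0) (y 0 1) k i j)
   (nil3_dgamma (p 0 0) (p 0 1) l k i j).
  elim/ord3_ind: k; elim/ord3_ind: i; elim/ord3_ind: j; rewrite /nil3_gamma /=;
  (der ltac:(solve [exact: coord_deriv]));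
  elim/ord3_ind: l; rewrite /nil3_dgamma /=; by field.
by case: H.
Qed.

Lemma nil3_ricci p v :
  ricci nil3_metric p v = 2^-1 * (contact p v ^+ 2 - v 0 0 ^+ 2 - v 0 1 ^+ 2).
Proof.
have T j k : ricci_tensor nil3_metric p j k =
    2^-1 * (contact p (evec j) * contact p (evec k)
            - (j == 0)%:R * (k == 0)%:R - (j == 1)%:R * (k == 1)%:R).
  rewrite /ricci_tensor !mxE !sum_ord3 !nil3_christoffel_deriv !nil3_christoffel.
  rewrite /contact !mxE.
  by elim/ord3_ind: j; elim/ord3_ind: k; rewrite /nil3_dgamma /nil3_gamma /=; field.
rewrite /ricci !mxE sum_ord3 !mxE !sum_ord3 !T /contact !mxE /=.
by field.
Qed.

End AmbientGeometry.

Section SurfaceGeometry.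
Context {R : realType}.
Variables (a : R) (f : R -> R).
Hypotheses (a0 : 0 < a) (hf : catenoid_profile a f).
Local Notation plane := 'rV[R]_2.
Implicit Types (q : plane).
Local Notation F := (revolution f).
Local Notation f1 := (f1 f).
Local Notation f2 := (f2 f).
Local Notation t q := (q 0 0).
Local Notation C q := (cos (q 0 1)).
Local Notation S q := (sin (q 0 1)).

Let fn0 s : f s != 0. Proof. exact: (f_neq0 a0 hf). Qed.
Let f4n0 s : f s ^+ 2 + 4 != 0. Proof. exact: f24_neq0. Qed.
Let an0 : a != 0. Proof. by rewrite gt_eqF. Qed.

Lemma plane_coord_deriv q (i j : 'I_2) :
  has_deriv q (evec i) (fun y : plane => y 0 j) ((i == j)%:R).
Proof.
apply/derive_along_line.
have -> : (fun h : R => (h *: evec i + q) 0 j) = (fun h => h * (i == j)%:R + q 0 j).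
  by apply/funext => h; rewrite !mxE /= eq_sym.
by der ltac:(fail); ring.
Qed.

Lemma height_deriv (g : R -> R) (dg : R) q i : has_deriv (t q) 1 g dg ->
  has_deriv q (evec i) (fun y : plane => g (y 0 0)) (dg * (i == 0)%:R).
Proof. by move=> hg; apply: pderive_comp hg (plane_coord_deriv q i 0). Qed.

Ltac surf := solve [exact: plane_coord_deriv
  | exact: height_deriv (derive_f hf _) | exact: height_deriv (derive_f1 hf _)].

Lemma tangent0 q : tangent F 0 q = \row_k [:: f1 (t q) * C q; f1 (t q) * S q; 1]`_k.
Proof.
rewrite /tangent /partial; apply: row_deriv; elim/ord3_ind;
  rewrite /revolution; under eq_fun do rewrite mxE /=.
- by der ltac:(surf); rewrite /=; ring.
- by der ltac:(surf); rewrite /=; ring.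
exact: plane_coord_deriv.
Qed.

Lemma tangent1 q : tangent F 1 q = \row_k [:: - f (t q) * S q; f (t q) * C q; 0]`_k.
Proof.
rewrite /tangent /partial; apply: row_deriv; elim/ord3_ind;
  rewrite /revolution; under eq_fun do rewrite mxE /=.
- by der ltac:(surf); rewrite /=; ring.
- by der ltac:(surf); rewrite /=; ring.
exact: plane_coord_deriv.
Qed.

Lemma tangent_deriv i j q : partial i (tangent F j) q =
  \row_k (match val i, val j with
    | 0%N, 0%N => [:: f2 (t q) * C q; f2 (t q) * S q; 0]
    | 1%N, 1%N => [:: - f (t q) * C q; - f (t q) * S q; 0]
    | _, _ => [:: - f1 (t q) * S q; f1 (t q) * C q; 0]
    end)`_k.
Proof.
rewrite /partial.
have -> : tangent F j = if j == 0 then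
    (fun q => \row_k [:: f1 (t q) * C q; f1 (t q) * S q; 1]`_k) else
    (fun q => \row_k [:: - f (t q) * S q; f (t q) * C q; 0]`_k).
  by apply/funext => y; elim/ord2_ind: j; rewrite ?tangent0 ?tangent1.
apply: row_deriv => k; elim/ord2_ind: j => /=; under eq_fun do rewrite mxE;
  elim/ord3_ind: k => /=; elim/ord2_ind: i => /=;
  by der ltac:(surf); rewrite /=; ring.
Qed.

Lemma surface_point q :
  (F q) 0 0 = f (t q) * C q /\ (F q) 0 1 = f (t q) * S q.
Proof. by rewrite /revolution !mxE. Qed.

Lemma trig2 q : S q ^+ 2 = 1 - C q ^+ 2.
Proof. by rewrite -(cos2Dsin2 (q 0 1)) addrAC subrr add0r. Qed.

Lemma first_formE q : first_form nil3_metric F q =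
  \matrix_(i, j) (match val i, val j with
    | 0%N, 0%N => 1 + f1 (t q) ^+ 2
    | 1%N, 1%N => f (t q) ^+ 2 + f (t q) ^+ 4 / 4
    | _, _ => - f (t q) ^+ 2 / 2 end).
Proof.
apply/matrixP => i j; rewrite !mxE nil3_innerE /contact.
have [-> ->] := surface_point q; have E := trig2 q.
by elim/ord2_ind: i; elim/ord2_ind: j; rewrite ?tangent0 ?tangent1 !mxE /=; field: E.
Qed.

Lemma first_form_det q : \det (first_form nil3_metric F q) = dens a f (t q) ^+ 2.
Proof.
rewrite det2 first_formE !mxE /= /dens.
have E := f1_sqr a0 hf (t q).
rewrite (_ : (1 + _) * _ - _ = (1 + f1 (t q) ^+ 2) * (f (t q) ^+ 2 + f (t q) ^+ 4 / 4) -
   f (t q) ^+ 4 / 4); last by field.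
by rewrite E; field; rewrite f4n0 an0.
Qed.

Lemma first_form_sqrt_det q : Num.sqrt (\det (first_form nil3_metric F q)) = dens a f (t q).
Proof. by rewrite first_form_det sqrtr_sqr gtr0_norm // (dens_gt0 a0 hf). Qed.

(** Determined by [cond * cocond - a ^ 2 / 4 = 1]. *)
Definition cocond s : R := (a ^+ 2 + 4) / (a * (f s ^+ 2 + 4)).

(** The inverse of the first fundamental form, multiplied by the area density:
   the coefficients of the Laplacian in divergence form. *)
Definition conductivity s (i j : 'I_2) : R :=
  match val i, val j with
  | 0%N, 0%N => cond a f s
  | 1%N, 1%N => cocond s
  | _, _ => a / 2
  end.

Lemma first_form_inv q : invmx (first_form nil3_metric F q) =
  \matrix_(i, j) ((dens a f (t q))^-1 * conductivity (t q) i j).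
Proof.
apply: invmx_eq; apply/matrixP => i j; rewrite !mxE sum_ord2 first_formE !mxE.
have E := f1_sqr a0 hf (t q).
by elim/ord2_ind: i; elim/ord2_ind: j;
  rewrite /conductivity /dens /cond /cocond /= ?E; field; rewrite ?f4n0 ?an0 ?fn0.
Qed.

Lemma conormalE q : conormal F q =
  \row_k [:: - f (t q) * C q; - f (t q) * S q; f (t q) * f1 (t q)]`_k.
Proof.
apply/rowP => k; rewrite !mxE det3.
have e0 : 0 = lshift 1 (0 : 'I_2) :> 'I_3 by apply/val_inj.
have e1 : 1 = lshift 1 (1 : 'I_2) :> 'I_3 by apply/val_inj.
have e2 : 2%:R = rshift 2 (0 : 'I_1) :> 'I_3 by apply/val_inj.
have r0 (j : 'I_3) : (col_mx (jacobian_rows F q) (evec k) : 'M[R]_3) 0 j = tangent F 0 q 0 j.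
  by rewrite {1}e0 (col_mxEu (jacobian_rows F q) (evec k)) mxE.
have r1 (j : 'I_3) : (col_mx (jacobian_rows F q) (evec k) : 'M[R]_3) 1 j = tangent F 1 q 0 j.
  by rewrite {1}e1 (col_mxEu (jacobian_rows F q) (evec k)) mxE.
have r2 (j : 'I_3) : (col_mx (jacobian_rows F q) (evec k) : 'M[R]_3) 2%:R j = (j == k)%:R.
  by rewrite {1}e2 (col_mxEd (jacobian_rows F q) (evec k)) !mxE.
rewrite !(r0, r1, r2) tangent0 tangent1 !mxE.
have E := trig2 q => {e0 e1 e2 r0 r1 r2}.
by elim/ord3_ind: k; rewrite /=; ring: E.
Qed.

Lemma normalE q : normal nil3_metric F q =
  \row_k [:: - f (t q) * C q - f (t q) ^+ 2 * f1 (t q) * S q / 2;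
             - f (t q) * S q + f (t q) ^+ 2 * f1 (t q) * C q / 2;
             f (t q) * f1 (t q) * (1 + f (t q) ^+ 2 / 4)]`_k.
Proof.
apply/rowP => k; rewrite !mxE sum_ord3 conormalE nil3_invE !mxE.
rewrite ?mxE /=; have E := trig2 q.
by elim/ord3_ind: k; rewrite /nil3_coentry /=; field: E.
Qed.

Lemma normal_norm q :
  Num.sqrt (inner nil3_metric (F q) (normal nil3_metric F q) (normal nil3_metric F q))
  = dens a f (t q).
Proof.
rewrite -[RHS]gtr0_norm ?(dens_gt0 a0 hf) // -sqrtr_sqr; congr Num.sqrt.
rewrite nil3_innerE /contact normalE !mxE /=.
rewrite ?mxE /=; have E := trig2 q; have E1 := f1_sqr a0 hf (t q).
transitivity (f (t q) ^+ 2 + (f (t q) ^+ 4 / 4 + f (t q) ^+ 2) * f1 (t q) ^+ 2).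
  by field: E.
by rewrite E1 /dens; field; rewrite f4n0 an0.
Qed.

Lemma second_formE q : second_form nil3_metric F q =
  \matrix_(i, j) ((dens a f (t q))^-1 *
    match val i, val j with
    | 0%N, 0%N => - f (t q) * f2 (t q) - f (t q) ^+ 2 * f1 (t q) ^+ 2 / 2
    | 1%N, 1%N => f (t q) ^+ 2 + f (t q) ^+ 4 / 2
    | _, _ => - f (t q) ^+ 2 / 2 + f (t q) ^+ 4 * f1 (t q) ^+ 2 / 8
    end).
Proof.
apply/matrixP => i j; rewrite !mxE nil3_innerE.
have -> : contact (F q) (unit_normal nil3_metric F q) = (dens a f (t q))^-1 * (f (t q) * f1 (t q)).
  rewrite /contact /unit_normal normal_norm normalE !mxE /=.
  rewrite ?mxE /=; have E := trig2 q.
  by field: E; rewrite gt_eqF ?(dens_gt0 a0 hf).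
rewrite /unit_normal normal_norm normalE /contact /ambient_deriv.
rewrite !mxE !sum_ord3 !nil3_christoffel tangent_deriv !mxE.
rewrite ?mxE /=; have E := trig2 q.
move: (dens a f (t q))^-1 => d.
elim/ord2_ind: i; elim/ord2_ind: j; rewrite ?tangent0 ?tangent1 !mxE /nil3_gamma /=;
  by field: E.
Qed.

(** The derivatives of [f] are eliminated by the profile equation and its
   first integral. *)
Lemma shape_potential q :
  second_form_sqnorm nil3_metric F q + ricci nil3_metric (F q) (unit_normal nil3_metric F q)
  = pot a f (t q) / (cond a f (t q) * dens a f (t q)).
Proof.
have -> : ricci nil3_metric (F q) (unit_normal nil3_metric F q) =
   (dens a f (t q))^-1 ^+ 2 * 2^-1 * (f (t q) ^+ 2 * f1 (t q) ^+ 2 - f (t q) ^+ 2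
       - f (t q) ^+ 4 * f1 (t q) ^+ 2 / 4).
  rewrite nil3_ricci /contact /unit_normal normal_norm normalE !mxE /=.
  rewrite ?mxE /=; have E := trig2 q.
  move: (dens a f (t q))^-1 => d.
  by field: E.
rewrite /second_form_sqnorm !sum_ord2 first_form_inv second_formE !mxE.
rewrite /conductivity /cond /cocond /dens /pot /=.
rewrite (f2E a0 hf) (f1_sqr a0 hf).
field; by rewrite f4n0 an0 fn0.
Qed.

Lemma conductivity_deriv q k i j : has_deriv q (evec k)
  (fun y : plane => conductivity (t y) i j)
  ((match val i, val j with
    | 0%N, 0%N => a * f (t q) * f1 (t q) / 2
    | 1%N, 1%N => - 2 * (a ^+ 2 + 4) * f (t q) * f1 (t q) / (a * (f (t q) ^+ 2 + 4) ^+ 2)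
    | _, _ => 0 end) * (k == 0)%:R).
Proof.
elim/ord2_ind: i; elim/ord2_ind: j; rewrite /conductivity /=.
- by apply: height_deriv; exact: derive_cond.
- by rewrite mul0r; exact: pderiveC.
- by rewrite mul0r; exact: pderiveC.
rewrite /cocond; der ltac:(surf); first by rewrite mulf_neq0.
field; by rewrite f4n0 an0.
Qed.

Lemma laplacian_term (u v : plane -> R) q i j d :
  (\forall y \near q, partial j u y = v y) -> has_deriv q (evec i) v d ->
  partial i (fun y => Num.sqrt (\det (first_form nil3_metric F y)) *
     invmx (first_form nil3_metric F y) i j * partial j u y) q =
   (match val i, val j with
    | 0%N, 0%N => a * f (t q) * f1 (t q) / 2
    | _, _ => 0 end) * v q + conductivity (t q) i j * d.
Proof.
move=> uv hv.
have H := pderiveM (conductivity_deriv q i i j) hv.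
suff [_ K] : has_deriv q (evec i)
    (fun y => Num.sqrt (\det (first_form nil3_metric F y)) *
     invmx (first_form nil3_metric F y) i j * partial j u y)
    ((match val i, val j with
    | 0%N, 0%N => a * f (t q) * f1 (t q) / 2
    | _, _ => 0 end) * v q + conductivity (t q) i j * d) by rewrite /partial K.
apply: near_eq_deriv.
  near=> y; have E : partial j u y = v y by near: y.
  rewrite E; symmetry; rewrite first_form_sqrt_det first_form_inv mxE mulVKf.
    reflexivity.
  by rewrite gt_eqF ?(dens_gt0 a0 hf).
apply: has_deriv_eq; first exact: H.
by congr (_ * _ + _); elim/ord2_ind: i H hv; elim/ord2_ind: j uv => _ _ _ /=; ring.
Unshelve. all: by end_near. Qed.

(** The coefficients depend on the height only, whence the separation of
   variables. The partial derivatives of [u] are prescribed near [q], because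
   they are differentiated once more. *)
Lemma jacobiE (u u0 u1 : plane -> R) q d00 d01 d10 d11 :
  (\forall y \near q, partial 0 u y = u0 y) ->
  (\forall y \near q, partial 1 u y = u1 y) ->
  has_deriv q (evec 0) u0 d00 -> has_deriv q (evec 0) u1 d01 ->
  has_deriv q (evec 1) u0 d10 -> has_deriv q (evec 1) u1 d11 ->
  jacobi_operator nil3_metric F u q =
  - (dens a f (t q))^-1 *
    (a * f (t q) * f1 (t q) / 2 * u0 q + cond a f (t q) * d00
     + a / 2 * (d01 + d10) + cocond (t q) * d11)
  - pot a f (t q) / (cond a f (t q) * dens a f (t q)) * u q.
Proof.
move=> n0 n1 h00 h01 h10 h11.
transitivity (- laplacian nil3_metric F u q -
  (second_form_sqnorm nil3_metric F q +
   ricci nil3_metric (F q) (unit_normal nil3_metric F q)) * u q); first by [].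
rewrite (shape_potential q); congr (_ - _); rewrite mulNr; congr (- _).
rewrite /laplacian; congr (_ * _); first by rewrite first_form_sqrt_det.
rewrite !sum_ord2 (laplacian_term n0 h00) (laplacian_term n1 h01).
rewrite (laplacian_term n0 h10) (laplacian_term n1 h11) /conductivity /=.
ring.
Qed.

End SurfaceGeometry.

(** * Bands and separated modes *)

Section Smoothness.
Context {R : realType} {n : nat}.
Local Notation V := 'rV[R]_n.+1.
Implicit Types (D : set V) (u v w : V -> R).

Lemma Ck_ext k D u v : open D -> (forall x, D x -> u x = v x) ->
  Ck k D v -> Ck k D u.
Proof.
move=> oD; elim: k u v => [|k IH] u v uv.
  case=> cv _; split => // x Dx.
  have E : \forall y \near x, v y = u y.
    by near=> y; symmetry; apply: uv; near: y; apply: open_nbhs_nbhs.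
  suff : u @ x --> u x by [].
  by rewrite (uv x Dx); apply: cvg_trans (cv x Dx); exact: near_eq_cvg E.
case=> cv dv.
have E x : D x -> \forall y \near x, v y = u y.
  by move=> Dx; near=> y; symmetry; apply: uv; near: y; apply: open_nbhs_nbhs.
split.
  move=> x Dx; suff : u @ x --> u x by [].
  by rewrite (uv x Dx); apply: cvg_trans (cv x Dx); exact: near_eq_cvg (E x Dx).
move=> i; have [dvi Ci] := dv i; split.
  by move=> x Dx; apply: near_eq_derivable (E x Dx) _; exact: dvi.
apply: IH Ci => x Dx; rewrite /partial; apply: near_eq_derive.
by apply: filterS (E x Dx) => y ->.
Unshelve. all: by end_near. Qed.

Lemma C0_intro D u : continuous u -> Ck 0 D u.
Proof. by move=> cu; split => // x _; exact: cu. Qed.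

Lemma CkS_intro k D u (du : 'I_n.+1 -> V -> R) : continuous u ->
  (forall i x, has_deriv x (evec i) u (du i x)) ->
  (forall i, Ck k D (du i)) -> Ck k.+1 D u.
Proof.
move=> cu hu Cdu; split; first by move=> x _; exact: cu.
move=> i; split; first by move=> x _; case: (hu i x).
have -> : partial i u = du i by apply/funext => x; case: (hu i x).
exact: Cdu.
Qed.

End Smoothness.

Section Band.
Context {R : realType}.
Variable T : R.
Hypothesis T0 : 0 < T.
Local Notation plane := 'rV[R]_2.

Definition band : set plane := [set q | `|q 0 0| < T].

Lemma turn0 : (turn : plane) 0 0 = 0.
Proof. by rewrite /turn !mxE mulr0. Qed.

Lemma turn1 : (turn : plane) 0 1 = 2 * pi.
Proof. by rewrite /turn !mxE /= mulr1. Qed.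

Lemma open_band : open band.
Proof.
have -> : band = (fun q : plane => q 0 0) @^-1` `]-T, T[%classic.
  by apply/seteqP; split => q; rewrite /band /= in_itv /= ltr_norml.
apply: open_comp; first by move=> q _; exact: continuous_t.
exact: interval_open.
Qed.

Lemma to_cylinder_continuous : continuous (@to_cylinder R).
Proof.
move=> q; have E : @to_cylinder R = fun y : plane =>
    cos (y 0 1) *: evec 0 + sin (y 0 1) *: evec 1 + y 0 0 *: evec 2%:R.
  apply/funext => y; apply/rowP => k; rewrite /to_cylinder /revolution !mxE.
  by elim/ord3_ind: k; rewrite /= ?mul1r !(mulr1, mulr0, addr0, add0r).
have c0 : continuous (fun y : plane => cos (y 0 1)).
  exact: (continuous_after (@continuous_cos R) continuous_th).
have c1 : continuous (fun y : plane => sin (y 0 1)).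
  exact: (continuous_after (@continuous_sin R) continuous_th).
have h0 : continuous (fun y : plane => cos (y 0 1) *: (evec 0 : 'rV[R]_3)).
  by move=> y; exact: (cvgZ (c0 y) (cvg_cst _)).
have h1 : continuous (fun y : plane => sin (y 0 1) *: (evec 1 : 'rV[R]_3)).
  by move=> y; exact: (cvgZ (c1 y) (cvg_cst _)).
have h2 : continuous (fun y : plane => y 0 0 *: (evec 2%:R : 'rV[R]_3)).
  by move=> y; exact: (cvgZ (continuous_t (x:=y)) (cvg_cst _)).
rewrite E; exact: (cvgD (cvgD (h0 q) (h1 q)) (h2 q)).
Qed.

(** A band is star-shaped. *)
Lemma band_connected : connected band.
Proof.
have -> : band = \bigcup_(q in band) ((fun s : R => s *: q) @` `[0, 1]).
  apply/seteqP; split => q.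
    by move=> Dq; exists q => //; exists 1; rewrite ?scale1r //= in_itv /= ler01 lexx.
  case=> p Dp [s /=]; rewrite in_itv /= => /andP[s0 s1] <-.
  rewrite /band /= mxE normrM (ger0_norm s0).
  by apply: le_lt_trans Dp; rewrite ler_piMl.
apply: bigcup_connected.
  exists 0 => q _; exists 0; last by rewrite scale0r.
  by rewrite /= in_itv /= lexx ler01.
move=> q _; apply: connected_continuous_connected; first exact: segment_connected.
apply: continuous_subspaceT => s; apply: cvgZ; [exact: cvg_id|exact: cvg_cst].
Qed.

Lemma band_compact : compact (closure (@to_cylinder R @` band)).
Proof.
pose M := T + 1.
pose B := [set v : 'rV[R]_3 | forall i, `[- M, M]%classic (v ord0 i)].
have cB : compact B by apply: (@rV_compact _ _ (fun=> `[- M, M]%classic)) => i; exact: segment_compact.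
have clB : closed B by apply: compact_closed cB; exact: norm_hausdorff.
apply: (subclosed_compact _ cB); first exact: closed_closure.
rewrite closureE; apply: smallest_sub => // v [q Dq <-] i.
rewrite /= in_itv /= -ler_norml /to_cylinder /revolution mxE.
have h (x : R) : `|x| <= 1 -> `|x| <= M.
  by move=> x1; apply: (le_trans x1); rewrite lerDr ltW.
elim/ord3_ind: i => /=.
- by rewrite mul1r; apply: h; rewrite ler_norml cos_geN1 cos_le1.
- by rewrite mul1r; apply: h; rewrite ler_norml sin_geN1 sin_le1.
- by apply: (le_trans (ltW Dq)); rewrite lerDl.
Qed.

Lemma Ck_quadratic k (c d e : R) :
  Ck k setT (fun q : plane => c * q 0 0 ^+ 2 + d * q 0 0 + e).
Proof.
have cq c' d' e' : continuous (fun q : plane => c' * q 0 0 ^+ 2 + d' * q 0 0 + e').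
  by cont ltac:(solve [exact: continuous_t]).
elim: k c d e => [|k IH] c d e; first exact: C0_intro.
apply: (@CkS_intro _ _ _ _ _ (fun i (q : plane) => 0 * q 0 0 ^+ 2 +
    (2 * c * (i == 0)%:R) * q 0 0 + d * (i == 0)%:R)) => //.
move=> i x; der ltac:(solve [exact: plane_coord_deriv]).
by rewrite /=; ring.
Qed.

Lemma band_regular : regular_domain band.
Proof.
split.
- by move=> q; rewrite /band /= mxE turn0 addr0.
- by split; [exact: open_band|exists 0; rewrite /band /= mxE normr0].
- apply: connected_continuous_connected; first exact: band_connected.
  by apply: continuous_subspaceT; exact: to_cylinder_continuous.
- exact: band_compact.
(* The boundary is a level set of [t ^ 2 - T ^ 2]. *)
move=> p _ Dp; exists setT, (fun q => 1 * q 0 0 ^+ 2 + 0 * q 0 0 + - T ^+ 2).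
split => //; first exact: openT.
- by move=> k; exact: Ck_quadratic.
- exists 0; have [_ d0] : has_deriv p (evec 0)
    (fun q : plane => 1 * q 0 0 ^+ 2 + 0 * q 0 0 + - T ^+ 2) (2 * p 0 0).
    by der ltac:(solve [exact: plane_coord_deriv]); rewrite /=; ring.
  rewrite /partial d0 mulf_neq0 ?pnatr_eq0 //; apply/eqP => E.
  by apply: Dp; rewrite /band /= E normr0.
move=> q _; rewrite /band /= mul1r mul0r addr0 subr_lt0.
rewrite -[q 0 0 ^+ 2]real_normK ?num_real // ltr_pXn2r ?nnegrE //.
exact: ltW.
Qed.

End Band.

Section SeparatedModes.
Context {R : realType}.
Variables (a : R) (f : R -> R).
Hypotheses (a0 : 0 < a) (hf : catenoid_profile a f).
Local Notation plane := 'rV[R]_2.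
Local Notation B t := ((cond a f t)^-1).
Local Notation mode k t := ((k%:R ^+ 2 - pot a f t) / cond a f t).

Lemma cond_even t : cond a f (- t) = cond a f t.
Proof. by rewrite /cond (f_even a0 hf). Qed.

Lemma pot_even t : pot a f (- t) = pot a f t.
Proof. by rewrite /pot (f_even a0 hf). Qed.

Lemma dens_even t : dens a f (- t) = dens a f t.
Proof. by rewrite /dens (f_even a0 hf). Qed.

Lemma continuous_B : continuous (fun t => B t).
Proof.
apply: continuous_inv; first by move=> t; exact: cond_neq0.
exact: (continuous_cond hf).
Qed.

Lemma continuous_mode k : continuous (fun t => mode k t).
Proof.
by apply: continuous_mul continuous_B; cont ltac:(solve [exact: (continuous_pot a0 hf)]).
Qed.

Definition dB t : R := - (a * f t * f1 f t / 2) / cond a f t ^+ 2.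

Lemma derive_B (t : R) : has_deriv t 1 (fun t => B t) (dB t).
Proof. by apply: pderiveV; [exact: cond_neq0|exact: (derive_cond hf)]. Qed.

Lemma continuous_dB : continuous dB.
Proof.
rewrite /dB; cont ltac:(solve [exact: (continuous_cond hf)|exact: (continuous_f hf)|exact: (continuous_f1 hf)]).
by move=> t; rewrite expf_neq0 // cond_neq0.
Qed.

Lemma rateE t : rate f t = a / 2 * B t.
Proof. by rewrite -(cond_rate a f t) mulrAC divff ?mul1r // cond_neq0. Qed.

Section SeparatedMode.
Variables (k : nat) (lam T : R) (y z : R -> R) (cs dcs : R -> R).
Hypothesis T0 : 0 < T.
Hypothesis sol : solution (fun t => B t) (fun t => mode k t) (dens a f) lam y z.
Hypotheses (yT : y T = 0) (yNT : y (- T) = 0).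
Hypotheses (hcs : forall x : R, has_deriv x 1 cs (dcs x))
           (hdcs : forall x : R, has_deriv x 1 dcs (- cs x)).
Hypothesis csturn : forall x, cs (x + k%:R * (2 * pi)) = cs x.

Let arg (q : plane) : R := k%:R * (q 0 1 - Phi f (q 0 0)).
Let P t : R := mode k t - lam * dens a f t.

(* The mode inside the band and its partial derivatives up to order two. *)
Let w (q : plane) : R := y (q 0 0) * cs (arg q).
Let w0 (q : plane) : R := B (q 0 0) *
  (z (q 0 0) * cs (arg q) - k%:R * a / 2 * (y (q 0 0) * dcs (arg q))).
Let w1 (q : plane) : R := k%:R * (y (q 0 0) * dcs (arg q)).
Let w00 (q : plane) : R := dB (q 0 0) *
  (z (q 0 0) * cs (arg q) - k%:R * a / 2 * (y (q 0 0) * dcs (arg q))) +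
  B (q 0 0) * (P (q 0 0) * y (q 0 0) * cs (arg q)
   - k%:R * a / 2 * B (q 0 0) * z (q 0 0) * dcs (arg q)
   - k%:R * a / 2 * (B (q 0 0) * z (q 0 0) * dcs (arg q)
     + k%:R * a / 2 * B (q 0 0) * y (q 0 0) * cs (arg q))).
Let w01 (q : plane) : R := k%:R * (B (q 0 0) * z (q 0 0) * dcs (arg q)
     + k%:R * a / 2 * B (q 0 0) * y (q 0 0) * cs (arg q)).
Let w10 (q : plane) : R := k%:R * B (q 0 0) *
  (z (q 0 0) * dcs (arg q) + k%:R * a / 2 * (y (q 0 0) * cs (arg q))).
Let w11 (q : plane) : R := - (k%:R ^+ 2) * (y (q 0 0) * cs (arg q)).

Let hy (t : R) : has_deriv t 1 y (B t * z t). Proof. by case: sol. Qed.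
Let hz (t : R) : has_deriv t 1 z (P t * y t). Proof. by case: sol. Qed.

Let harg q i : has_deriv q (evec i) arg
  (k%:R * ((i == 1)%:R - a / 2 * B (q 0 0) * (i == 0)%:R)).
Proof.
rewrite /arg; der ltac:(solve [exact: plane_coord_deriv|
  exact: height_deriv (derive_Phi hf _)]).
by rewrite rateE /=; ring.
Qed.

Let hcsarg q i : has_deriv q (evec i) (fun q => cs (arg q))
  (dcs (arg q) * (k%:R * ((i == 1)%:R - a / 2 * B (q 0 0) * (i == 0)%:R))).
Proof. by apply: pderive_comp; [exact: hcs|exact: harg]. Qed.

Let hdcsarg q i : has_deriv q (evec i) (fun q => dcs (arg q))
  (- cs (arg q) * (k%:R * ((i == 1)%:R - a / 2 * B (q 0 0) * (i == 0)%:R))).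
Proof. by apply: pderive_comp; [exact: hdcs|exact: harg]. Qed.

Ltac leaf := solve [exact: hcsarg|exact: hdcsarg|exact: height_deriv (hy _)|
  exact: height_deriv (hz _)|exact: height_deriv (derive_B _)].

Let hB q i : has_deriv q (evec i) (fun q : plane => B (q 0 0)) (dB (q 0 0) * (i == 0)%:R).
Proof. exact: height_deriv (derive_B _). Qed.

Let hw0 q : has_deriv q (evec 0) w (w0 q).
Proof. by rewrite /w; der leaf; rewrite /w0 /=; field; exact: cond_neq0. Qed.
Let hw1 q : has_deriv q (evec 1) w (w1 q).
Proof. by rewrite /w; der leaf; rewrite /w1 /=; ring. Qed.

Let hw00 q : has_deriv q (evec 0) w0 (w00 q).
Proof.
rewrite /w0; apply: has_deriv_eq; first by apply: pderiveM; [exact: hB|solve_deriv leaf].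
by rewrite /w00 /=; field; exact: cond_neq0.
Qed.
Let hw10 q : has_deriv q (evec 1) w0 (w10 q).
Proof.
rewrite /w0; apply: has_deriv_eq; first by apply: pderiveM; [exact: hB|solve_deriv leaf].
by rewrite /w10 /=; field; exact: cond_neq0.
Qed.
Let hw01 q : has_deriv q (evec 0) w1 (w01 q).
Proof. by rewrite /w1; der leaf; rewrite /w01 /=; field; exact: cond_neq0. Qed.
Let hw11 q : has_deriv q (evec 1) w1 (w11 q).
Proof. by rewrite /w1; der leaf; rewrite /w11 /=; ring. Qed.

(** A separated mode in the twisted angle. As [y] vanishes at [- T] and [T],
   clamping the height to this interval extends the mode by zero. *)
Definition mode_fun (q : plane) : R :=
  y (Num.min (Num.max (q 0 0) (- T)) T) * cs (k%:R * (q 0 1 - Phi f (q 0 0))).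

Lemma mode_fun_in q : band T q -> mode_fun q = w q.
Proof.
rewrite /band /= ltr_norml => /andP[h1 h2].
by rewrite /mode_fun max_l ?ltW // min_l ?ltW.
Qed.

Lemma mode_fun_out q : ~ band T q -> mode_fun q = 0.
Proof.
move=> /negP; rewrite -leNgt /mode_fun.
case: (leP 0 (q 0 0)) => h.
  rewrite (ger0_norm h) => hT; rewrite max_l; last by rewrite (le_trans _ h) // oppr_le0 ltW.
  by rewrite min_r // yT mul0r.
rewrite ltr0_norm // => hT; rewrite max_r; last by rewrite lerNr.
by rewrite min_l ?yNT ?mul0r // ge0_cp // ltW.
Qed.

Let cy : continuous y.
Proof. by move=> t; apply: deriv_continuous (hy t). Qed.
Let cz : continuous z.
Proof. by move=> t; apply: deriv_continuous (hz t). Qed.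
Let ccs : continuous cs.
Proof. by move=> t; apply: deriv_continuous (hcs t). Qed.
Let cdcs : continuous dcs.
Proof. by move=> t; apply: deriv_continuous (hdcs t). Qed.

Let carg : continuous arg.
Proof.
rewrite /arg; cont ltac:(solve [exact: continuous_th|
  exact: (continuous_after (continuous_Phi hf) continuous_t)]).
Qed.

Let cP : continuous P.
Proof.
rewrite /P; apply: continuous_add; first exact: continuous_mode.
by apply: continuous_opp; apply: continuous_mul; [exact: continuous_cst|exact: (continuous_dens hf)].
Qed.

Let after (g : R -> R) : continuous g -> continuous (fun q : plane => g (q 0 0)).
Proof. by move=> cg; exact: (continuous_after cg continuous_t). Qed.

Ltac cleaf := solve [exact: (after cy)|exact: (after cz)|exact: (after continuous_dB)
  |exact: (after cP)|exact: (continuous_after ccs carg)|exact: (continuous_after cdcs carg)].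

Let cBq : continuous (fun q : plane => B (q 0 0)).
Proof. exact: (after continuous_B). Qed.

Ltac contB :=
  lazymatch goal with
  | |- continuous (fun q => (cond _ _ _)^-1) => exact: cBq
  | |- continuous (fun _ => ?c) => exact: continuous_cst
  | |- continuous (fun y => @?f y + @?g y) => apply: continuous_add; contB
  | |- continuous (fun y => - @?f y) => apply: continuous_opp; contB
  | |- continuous (fun y => @?f y * @?g y) => apply: continuous_mul; contB
  | |- _ => cleaf
  end.

(** The derivatives of the twist cancel the mixed terms of the Jacobi
   operator, and the eigenvalue equation becomes the system satisfied by [y]
   and [z]. *)
Lemma mode_fun_eigen : dirichlet_eigenspace nil3_metric (revolution f) (band T) lam mode_fun.
Proof.
have oD := @open_band R T.
split.
- rewrite /mode_fun; apply: continuous_mul; last exact: (continuous_after ccs carg).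
  apply: (continuous_after cy).
  have cmax : continuous (fun t : R => Num.max t (- T)).
    by move=> t; apply: (@continuous_max R R id (fun=> - T)); [exact: cvg_id|exact: cvg_cst].
  apply: (after (g := fun t => Num.min (Num.max t (- T)) T)) => t.
  by apply: (@continuous_min R R (fun t => Num.max t (- T)) (fun=> T)); [exact: cmax|exact: cvg_cst].
- move=> q; have E0 : (q + turn) 0 0 = q 0 0 by rewrite mxE turn0 addr0.
  have E1 : (q + turn) 0 1 = q 0 1 + 2 * pi by rewrite mxE turn1.
  rewrite /mode_fun E0 E1; congr (_ * _).
  by rewrite -[RHS]csturn; congr cs; ring.
- exact: mode_fun_out.
- apply: (Ck_ext oD mode_fun_in).
  apply: (@CkS_intro _ _ _ _ _ (fun i => if i == 0 then w0 else w1)).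
  + by rewrite /w; contB.
  + by move=> i x; elim/ord2_ind: i; [exact: hw0|exact: hw1].
  have C0 : Ck 1 (band T) w0.
    apply: (@CkS_intro _ _ _ _ _ (fun i => if i == 0 then w00 else w10)).
    + by rewrite /w0; contB.
    + by move=> i x; elim/ord2_ind: i; [exact: hw00|exact: hw10].
    by move=> i; apply: C0_intro; elim/ord2_ind: i => /=; rewrite /w00 /w10; contB.
  have C1 : Ck 1 (band T) w1.
    apply: (@CkS_intro _ _ _ _ _ (fun i => if i == 0 then w01 else w11)).
    + by rewrite /w1; contB.
    + by move=> i x; elim/ord2_ind: i; [exact: hw01|exact: hw11].
    by move=> i; apply: C0_intro; elim/ord2_ind: i => /=; rewrite /w01 /w11; contB.
  by move=> i; elim/ord2_ind: i; [exact: C0|exact: C1].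
move=> q Dq.
have N i (v : plane -> R) : (forall x, has_deriv x (evec i) w (v x)) ->
    \forall x \near q, partial i mode_fun x = v x.
  move=> hv; near=> x; have Dx : band T x by near: x; apply: open_nbhs_nbhs.
  have [_ <-] := hv x; apply: near_eq_derive.
  by near=> x'; apply: mode_fun_in; near: x'; apply: open_nbhs_nbhs.
rewrite (jacobiE a0 hf (N 0 w0 hw0) (N 1 w1 hw1) (hw00 q) (hw01 q) (hw10 q) (hw11 q)).
rewrite (mode_fun_in Dq) /w0 /w00 /w01 /w10 /w11 /w /P /dB.
move: (y _) (z _) (cs _) (dcs _) (pot a f _) => yy zz c s pp.
rewrite /cond /dens /cocond.
field; by rewrite f24_neq0 (f_neq0 a0 hf) gt_eqF.
Unshelve. all: by end_near. Qed.

End SeparatedMode.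
End SeparatedModes.

(** * Lower bounds of the index *)

Section Counting.
Context {R : realType}.
Local Notation plane := 'rV[R]_2.

Lemma dimension_ge {T : Type} (E : set (T -> R)) m (u : 'I_m -> T -> R) :
  (forall i, E (u i)) -> lin_indep u -> (m%:R%:E <= dimension E)%E.
Proof. by move=> Eu Lu; apply: ereal_sup_ubound; exists m => //; exists u. Qed.

Lemma domain_index_ge g F (D : set plane) K (l : nat -> R) (m : nat -> nat) :
  (forall k, (k < K)%N -> l k < 0) ->
  (forall j k, (j < k < K)%N -> l j <> l k) ->
  (forall k, (k < K)%N -> ((m k)%:R%:E <= dimension (dirichlet_eigenspace g F D (l k)))%E) ->
  (((\sum_(k < K) m k)%N)%:R%:E <= domain_index g F D)%E.
Proof.
move=> l0 linj hm; apply: esum_ge; exists (l @` `I_K).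
  by split; [apply: finite_image; exact: finite_II|move=> _ [k /= kK <-]; exact: l0].
rewrite fsbig_image; last first.
  move=> j k; rewrite !inE /= => jK kK E; case: (ltngtP j k) => // h; exfalso.
    by apply: (linj j k) E; rewrite h.
  by apply: (linj k j) (esym E); rewrite h.
rewrite -(@fsbig_ord _ _ _ K (fun k => dimension (dirichlet_eigenspace g F D (l k)))).
rewrite natr_sum -sumEFin; apply: lee_sum => k _; exact: hm.
Qed.

End Counting.

Section LowerBound.
Context {R : realType}.
Variables (a : R) (f : R -> R).
Hypotheses (a0 : 0 < a) (hf : catenoid_profile a f).
Local Notation plane := 'rV[R]_2.
Local Notation B t := ((cond a f t)^-1).
Local Notation mode k t := ((k%:R ^+ 2 - pot a f t) / cond a f t).
Local Notation mode_solution k := (solution (fun t => B t) (fun t => mode k t) (dens a f)).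
Local Notation eigenspace T lam := (dirichlet_eigenspace nil3_metric (revolution f) (band T) lam).

(** Otherwise the Wronskian of the two solutions, which vanishes at [0] and at
   [T], would be increasing. *)
Lemma mode_eigenvalue_neq j k lam y z v w T : (j < k)%N -> 0 < T ->
  mode_solution j lam y z -> mode_solution k lam v w ->
  (forall t, `|t| < T -> 0 < y t) -> (forall t, `|t| < T -> 0 < v t) ->
  y T = 0 -> v T = 0 -> False.
Proof.
move=> jk T0 [y0 z0 hy hz] [v0 w0 hv hw] py pv yT vT.
pose W t := y t * w t - z t * v t.
have : W 0 < W T.
  apply: (derive_gt0_lt T0 (df := fun t =>
    (k%:R ^+ 2 - j%:R ^+ 2) / cond a f t * (y t * v t))) => t tT.
    by rewrite /W; der ltac:(solve [exact: hy|exact: hz|exact: hv|exact: hw]); ring.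
  case/andP: tT => t0 tT; have tn : `|t| < T by rewrite gtr0_norm.
  rewrite mulr_gt0 ?mulr_gt0 ?py ?pv // ?invr_gt0 ?cond_gt0 // subr_gt0.
  by rewrite ltr_pXn2r ?nnegrE // ltr_nat.
by rewrite /W y0 v0 z0 w0 yT vT; lra.
Qed.

(** The cosine and the sine in the angle give two modes, distinguished by
   their values at the height [0]; at frequency [0] the sine is zero. *)
Lemma mode_dimension k lam y z T : 0 < T -> mode_solution k lam y z ->
  y T = 0 -> y (- T) = 0 ->
  ((if k == 0%N then 1%N else 2%N)%:R%:E <= dimension (eigenspace T lam))%E.
Proof.
move=> T0 sol yT yNT; have y0 : y 0 = 1 by case: sol.
have eigen cs dcs := @mode_fun_eigen R a f a0 hf k lam T y z cs dcs T0 sol yT yNT.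
have Ecos : eigenspace T lam (mode_fun f k T y cos).
  apply: (eigen _ (fun x => - sin x)).
  - by move=> x; exact: is_derive_cos.
  - by move=> x; apply: pderiveN; exact: is_derive_sin.
  - by move=> x; have [] := cos_sin_turns k x.
have Esin : eigenspace T lam (mode_fun f k T y sin).
  apply: (eigen _ cos).
  - by move=> x; exact: is_derive_sin.
  - by move=> x; exact: is_derive_cos.
  - by move=> x; have [] := cos_sin_turns k x.
have at0 cs th : mode_fun f k T y cs (pt 0 th) = cs (k%:R * th).
  rewrite /mode_fun pt0 pt1 (Phi_at0 hf) subr0 max_l ?oppr_le0 ?ltW // min_l ?ltW //.
  by rewrite y0 mul1r.
have [k0|k0] := eqVneq k 0%N.
  apply: (dimension_ge (u := fun=> mode_fun f k T y cos)) => // c H i.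
  have := H (pt 0 0); rewrite big_ord1 at0 mulr0 cos0 mulr1.
  by have -> : i = ord0 by exact: ord1.
apply: (dimension_ge (u := fun i : 'I_2 => mode_fun f k T y (if i == 0 then cos else sin))).
  by move=> i; case: ifP.
move=> c H i; have := H (pt 0 0); rewrite sum_ord2 /= !at0 mulr0 cos0 sin0 mulr0 addr0 mulr1.
have := H (pt 0 (pi / 2 / k%:R)); rewrite sum_ord2 /= !at0.
have -> : k%:R * (pi / 2 / k%:R) = pi / 2 :> R by field; rewrite pnatr_eq0.
rewrite cos_pihalf sin_pihalf mulr0 add0r mulr1.
by move=> c1 c0; elim/ord2_ind: i.
Qed.

(** A nonnegative subsolution [p] for the frequency [K] is one for each lower
   frequency. So every frequency up to [K] has a negative eigenvalue in one
   and the same band; the eigenvalues are distinct and their multiplicities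
   are [1, 2, ..., 2]. *)
Lemma index_ge K p cp dcp tau : 0 <= tau ->
  (forall t : R, has_deriv t 1 p (B t * cp t)) ->
  (forall t : R, has_deriv t 1 cp (dcp t)) ->
  (forall t, 0 <= t <= tau -> 0 <= p t) ->
  (forall t, 0 <= t <= tau -> mode K t * p t <= dcp t) ->
  0 < p 0 -> cp 0 = 0 -> p tau = 0 ->
  ((1 + 2 * K)%N%:R%:E <= catenoid_index f)%E.
Proof.
move=> tau0 hp hcp pp sub p0 cp0 ptau; pose T := tau + 1.
have T0 : 0 < T by rewrite /T; lra.
have tauT : 0 <= tau < T by rewrite tau0 /T; lra.
(* Choice functions of [k] require a statement for all [k]; above [K] the
   values are irrelevant. *)
have shoot k : exists s : R * ((R -> R) * (R -> R)), (k <= K)%N ->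
    [/\ s.1 < 0, mode_solution k s.1 s.2.1 s.2.2,
    (forall t, `|t| < T -> 0 < s.2.1 t) & (s.2.1 T = 0 /\ s.2.1 (- T) = 0)].
  case: (leqP k K) => kK; last by exists (0, (p, p)).
  have cB := continuous_B a0 hf; have cm := @continuous_mode R a f a0 hf k.
  have [||||||lam [y [z H]]] := @shooting R (fun t => B t) (fun t => mode k t) (dens a f) cB cm
    (continuous_dens hf) _ _ _ _ _ p cp dcp tau T tauT hp hcp _ p0 cp0 ptau.
  - by move=> t; rewrite invr_gt0; exact: cond_gt0.
  - exact: dens_gt0.
  - by move=> t; rewrite cond_even.
  - by move=> t; rewrite cond_even // pot_even.
  - by move=> t; rewrite dens_even.
  - move=> t ht; apply: le_trans (sub t ht); apply: ler_wpM2r; first exact: pp.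
    apply: ler_wpM2r; first by rewrite invr_ge0 ltW // cond_gt0.
    by rewrite lerB // lerXn2r ?nnegrE // ler_nat.
  by exists (lam, (y, z)).
have [S HS] := choice shoot.
apply: (@le_trans _ _ (domain_index nil3_metric (revolution f) (band T))); last first.
  by apply: ereal_sup_ubound; exists (band T) => //; exact: band_regular.
have -> : (1 + 2 * K = \sum_(k < K.+1) (if k == 0 :> nat then 1 else 2))%N.
  by rewrite big_ord_recl /= sum_nat_const card_ord mulnC.
apply: (@domain_index_ge _ _ _ _ K.+1 (fun k => (S k).1) (fun k => if k == 0%N then 1%N else 2%N)).
- by move=> k kK; have [] := HS k kK.
- move=> j k /andP[jk kK] E; have [_ sk pk [k1 _]] := HS k kK.
  have [|_ sj pj [j1 _]] := HS j; first by rewrite ltnW // (leq_trans jk).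
  rewrite E in sj; exact: (mode_eigenvalue_neq jk T0 sj sk pj pk j1 k1).
move=> k kK; have [_ sk _ [k1 k2]] := HS k kK; exact: (mode_dimension T0 sk k1 k2).
Qed.

(** If [Phi] reaches [pi / 2], the cosine in [horiz] vanishes there. Otherwise
   the sine stays away from zero, while the coefficient [1 / f] of the cosine
   tends to zero. *)
Lemma horiz_nonpos : exists2 s, 0 <= s & horiz f s <= 0.
Proof.
have [[t /andP[t0 ht]]|H] := pselect (exists t, (0 <= t) && (pi / 2 <= Phi f t)).
  have [|s /[!in_itv] /= /andP[s0 _] E] := @IVT R (Phi f) 0 t (pi / 2) t0
      (continuous_subspaceT (continuous_Phi hf)).
    rewrite (Phi_at0 hf); have p0 := pi_gt0 R.
    by rewrite ge_min divr_ge0 ?(ltW p0) //= le_max ht orbT.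
  exists s => //; rewrite /horiz E cos_pihalf sin_pihalf mul0r sub0r mulr1 oppr_le0.
  rewrite divr_ge0 //; case: (eqVneq s 0) => [->|sn].
    by rewrite (f1_at0 hf).
  by rewrite ltW // (f1_gt0 a0 hf) // lt_def sn.
have PhiT t : 0 <= t -> Phi f t < pi / 2.
  by move=> t0; rewrite ltNge; apply/negP => h; apply: H; exists t; rewrite t0.
have Phi1 := Phi_gt0 hf (@ltr01 R); have s1 : 0 < sin (Phi f 1).
  by apply: sin_gt0_pi; rewrite Phi1 (lt_trans (PhiT 1 ler01)) // ltr_pdivrMr // ltr_pMr ?pi_gt0 // ltr1n.
have d1 := f1_gt0 a0 hf (@ltr01 R).
pose M := Num.max (f 1) (2 / (f1 f 1 * sin (Phi f 1))).
have [t t0] := f_unbounded a0 hf M; rewrite gt_max => /andP[t1 t2].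
have mono x y : 0 <= x -> x <= y -> f x <= f y.
  move=> x0 xy; apply: (derive_ge0_le xy (fun s _ => derive_f hf s)) => s /andP[xs _].
  have := le_trans x0 xs; rewrite le_eqVlt => /orP[/eqP<-|s0]; first by rewrite (f1_at0 hf).
  by rewrite ltW // (f1_gt0 a0 hf).
have t1' : 1 <= t.
  by rewrite leNgt; apply/negP => h; have := mono t 1 (ltW t0) (ltW h); rewrite leNgt t1.
exists t; first exact: ltW.
have f1t : f1 f 1 <= f1 f t.
  by apply: (derive_ge0_le t1' (fun s _ => derive_f1 hf s)) => s _; rewrite ltW // (f2_gt0 a0 hf).
have st : sin (Phi f 1) <= sin (Phi f t).
  have Phit := PhiT t (ltW t0); have := Phi_le hf t1' => le1.
  apply: (derive_ge0_le le1 (fun x _ => is_derive_sin x)) => x /andP[h1 h2].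
  by apply: cos_ge0_pihalf; have := pi_gt0 R; lra.
have ft := f_gt0 a0 hf t.
have F : 1 < f t * (f1 f 1 * sin (Phi f 1) / 2).
  by move: t2; rewrite ltr_pdivrMr ?mulr_gt0 //; lra.
rewrite /horiz subr_le0 (@le_trans _ _ (1 / f t)) //.
  by rewrite ler_pM2r ?invr_gt0 // cos_le1.
rewrite ler_pdivrMr //; apply: ltW; apply: (lt_le_trans F).
rewrite mulrC ler_pM2r //.
have : f1 f 1 * sin (Phi f 1) <= f1 f t * sin (Phi f t) by rewrite ler_pM // ltW.
by lra.
Qed.

Lemma index_ge3 : (3%:E <= catenoid_index f)%E.
Proof.
have h0 : 0 < horiz f 0.
  by rewrite /horiz (Phi_at0 hf) cos0 sin0 mulr0 subr0 divr_gt0 // (f_gt0 a0 hf).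
have ch : continuous (horiz f) by move=> t; apply: deriv_continuous (derive_horiz a0 hf t).
have [s s0 hs] := horiz_nonpos.
have [tau /andP[tau0 _] [htau pos]] := first_zero ch h0 s0 hs.
apply: (@index_ge 1 (horiz f) (cond_dhoriz a f)
  (fun t => (1 - pot a f t) / cond a f t * horiz f t) tau (ltW tau0) _ _ _ _ h0 _ htau).
- by move=> t; rewrite mulrC; exact: derive_horiz.
- by move=> t; exact: derive_cond_dhoriz.
- move=> t /andP[t0]; rewrite le_eqVlt => /orP[/eqP->|tt]; first by rewrite htau.
  by rewrite ltW // pos // t0.
- by move=> t _; rewrite expr1n.
by rewrite /cond_dhoriz (Phi_at0 hf) (f1_at0 hf) sin0 oppr0 mul0r mulr0 mul0r subrr.
Qed.

(** In the conformal height [2 Phi / a], [p] is a cosine of frequency [nu],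
   and a subsolution since [nu ^ 2 = a ^ 2 - K ^ 2 <= pot - K ^ 2]. Its zero
   is at [Phi = phi], a value that [Phi_attains] provides when [sqrt (a ^ 2 +
   4) < 2 * nu]; this is the hypothesis. *)
Lemma index_ge_large K : 4 * K%:R ^+ 2 + 4 < 3 * a ^+ 2 ->
  ((1 + 2 * K)%N%:R%:E <= catenoid_index f)%E.
Proof.
move=> hK; pose nu := Num.sqrt (a ^+ 2 - K%:R ^+ 2).
have nuK : nu ^+ 2 = a ^+ 2 - K%:R ^+ 2.
  by rewrite sqr_sqrtr // subr_ge0; have := sqr_ge0 (K%:R : R); lra.
have nu0 : 0 < nu.
  by rewrite sqrtr_gt0 subr_gt0; have := sqr_ge0 (K%:R : R); lra.
pose p t := cos (2 * nu / a * Phi f t).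
pose phi := a * pi / (4 * nu); have pi0 := pi_gt0 R.
have phi0 : 0 <= phi by rewrite divr_ge0 ?mulr_ge0 ?ltW.
have [|t t0 ht] := Phi_attains a0 hf phi0.
  have -> : Num.sqrt (a ^+ 2 + 4) / a * phi = Num.sqrt (a ^+ 2 + 4) / (2 * nu) * (pi / 2).
    by rewrite /phi; field; rewrite !gt_eqF.
  rewrite gtr_pMl ?divr_gt0 // ltr_pdivrMr ?mulr_gt0 // mul1r.
  rewrite -(@ltr_pXn2r _ 2) ?nnegrE ?sqrtr_ge0 ?mulr_ge0 ?(ltW nu0) //.
  by rewrite sqr_sqrtr ?addr_ge0 ?sqr_ge0 // exprMn nuK; lra.
have [|s /[!in_itv] /= /andP[s0 _] E] := @IVT R (Phi f) 0 t phi (ltW t0)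
      (continuous_subspaceT (continuous_Phi hf)).
  by rewrite (Phi_at0 hf) ge_min phi0 /= le_max (ltW ht) orbT.
have hp (x : R) : has_deriv x 1 p (B x * (- nu * sin (2 * nu / a * Phi f x))).
  rewrite /p; apply: has_deriv_eq.
    apply: (pderive_comp (g := cos) (f := fun x => 2 * nu / a * Phi f x)).
      exact: is_derive_cos.
    by apply: pderiveM; [exact: pderiveC|exact: (derive_Phi hf)].
  by rewrite (rateE f a0) /=; field; rewrite (cond_neq0 f a0) gt_eqF.
have cp : continuous p by move=> x; apply: deriv_continuous (hp x).
have p0 : 0 < p 0 by rewrite /p (Phi_at0 hf) mulr0 cos0.
have ps : p s <= 0.
  rewrite /p E /phi; have -> : 2 * nu / a * (a * pi / (4 * nu)) = pi / 2.
    by field; rewrite !gt_eqF.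
  by rewrite cos_pihalf.
have [tau /andP[tau0 _] [htau pos]] := first_zero cp p0 s0 ps.
have pp x : 0 <= x <= tau -> 0 <= p x.
  move=> /andP[x0]; rewrite le_eqVlt => /orP[/eqP->|tt]; first by rewrite htau.
  by rewrite ltW // pos // x0.
apply: (@index_ge K p (fun x => - nu * sin (2 * nu / a * Phi f x))
  (fun x => - nu ^+ 2 * B x * p x) tau (ltW tau0) hp _ pp _ p0 _ htau).
- move=> x; apply: has_deriv_eq.
    apply: pderiveM; first exact: pderiveC.
    apply: (pderive_comp (g := sin) (f := fun x => 2 * nu / a * Phi f x)).
      exact: is_derive_sin.
    by apply: pderiveM; [exact: pderiveC|exact: (derive_Phi hf)].
  by rewrite (rateE f a0) /p /=; field; rewrite (cond_neq0 f a0) gt_eqF.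
- move=> x hx; apply: ler_wpM2r; first exact: pp.
  apply: ler_wpM2r; first by rewrite invr_ge0 ltW // cond_gt0.
  by rewrite nuK; have := pot_ge a0 hf x; lra.
by rewrite (Phi_at0 hf) mulr0 sin0 mulr0.
Qed.

End LowerBound.

(** * Nonnegativity of the index form *)

Section IndexForm.
Context {R : realType}.
Variables (a : R) (f : R -> R).
Hypotheses (a0 : 0 < a) (hf : catenoid_profile a f).
Local Notation plane := 'rV[R]_2.
Local Notation B t := ((cond a f t)^-1).

Lemma continuous_dvert : continuous (dvert a f).
Proof.
have -> : dvert a f = fun t => B t *
    ((a ^+ 2 + 4) / (f t ^+ 2 + 4) - 1 + a ^+ 2 / f t ^+ 2).
  by apply/funext => t; rewrite -(cond_dvert a0 hf) mulKf // cond_neq0.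
apply: continuous_mul; first exact: (continuous_B a0 hf).
cont ltac:(solve [exact: (continuous_f hf)]).
  by move=> t; exact: f24_neq0.
by move=> t; rewrite expf_neq0 // (f_neq0 a0 hf).
Qed.

Lemma vert_gt0 t : 0 < t -> 0 < vert a f t.
Proof. by move=> t0; rewrite /vert divr_gt0 ?mulr_gt0 ?(f1_gt0 a0 hf) ?(f_gt0 a0 hf). Qed.

Lemma cond_dvert_le1 t : cond a f t * dvert a f t <= 1.
Proof.
have y0 := f_gt0 a0 hf t; have := f2_ge a0 hf t => h.
rewrite (cond_dvert a0 hf).
have h1 : (a ^+ 2 + 4) / (f t ^+ 2 + 4) <= 1.
  by rewrite ler_pdivrMr ?mul1r ?lerD2r // f24_gt0.
have h2 : a ^+ 2 / f t ^+ 2 <= 1 by rewrite ler_pdivrMr ?mul1r // exprn_gt0.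
by lra.
Qed.

Lemma dvert0_gt0 : 0 < dvert a f 0.
Proof.
rewrite /dvert (f1_at0 hf) expr0n /= subr0 divr_gt0 ?exprn_gt0 ?(f_gt0 a0 hf) //.
by rewrite !mulr_gt0 // ?(f2_gt0 a0 hf) ?(f_gt0 a0 hf).
Qed.

Section HalfLine.
Variables (v dv : R -> R) (T : R).
Hypotheses (hv : forall t : R, has_deriv t 1 v (dv t)) (cdv : continuous dv).
Hypotheses (T0 : 0 <= T) (v0 : v 0 = 0) (vT : v T = 0).

Let I t : R := cond a f t * dv t ^+ 2 - pot a f t * B t * v t ^+ 2.

Lemma continuous_form : continuous I.
Proof.
have cv : continuous v by move=> t; apply: deriv_continuous (hv t).
rewrite /I; apply: continuous_add; last apply: continuous_opp.
  by cont ltac:(solve [exact: (continuous_cond hf)|exact: cdv]).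
apply: continuous_mul; last by cont ltac:(solve [exact: cv]).
by apply: continuous_mul; [exact: (continuous_pot a0 hf)|exact: (continuous_B a0 hf)].
Qed.

Let G t : R := cond a f t * dvert a f t * (v t ^+ 2 / vert a f t).

Let derive_G (t : R) : 0 < t -> has_deriv t 1 G
  (I t - cond a f t * (dv t - dvert a f t * v t / vert a f t) ^+ 2).
Proof.
move=> t0; have h0 : vert a f t != 0 by rewrite gt_eqF ?vert_gt0.
rewrite /G; apply: has_deriv_eq.
  apply: pderiveM; first exact: (derive_cond_dvert a0 hf).
  by apply: pderiveM; [apply: pderiveX; exact: hv|apply: pderiveV; [exact: h0|exact: (derive_vert a0 hf)]].
rewrite /I /=; have := cond_neq0 f a0 t; move: h0.
move: (vert a f t) (dvert a f t) (cond a f t) (pot a f t) (v t) (dv t) => h dh A W x dx h0 A0.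
by field; rewrite h0 A0.
Qed.

(** Picone's identity for the Jacobi field [vert], which is positive on the
   open half-line: the integrand is a square plus the derivative of [G]. Both
   [v] and [vert] vanish to first order at [0], so that [G] tends to zero
   there. *)
Lemma half_line_form_ge0 : 0 <= defint 0 T I.
Proof.
have [T00|Tn0] := eqVneq T 0; first by rewrite T00 defint_same.
have Tp : 0 < T by rewrite lt_def Tn0.
have cI := continuous_form; have cP := continuous_prim cI.
have key e : 0 < e -> e <= T -> prim I e - prim I 0 - G e <= defint 0 T I.
  move=> e0 eT.
  have : prim I e - G e <= prim I T - G T.
    apply: (derive_ge0_le eT (f := fun t => prim I t - G t) (df := fun t =>
      cond a f t * (dv t - dvert a f t * v t / vert a f t) ^+ 2)) => t /andP[et _].
      have t0 := lt_le_trans e0 et.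
      apply: has_deriv_eq; first by apply: pderiveD; [exact: derive_prim|apply: pderiveN; exact: derive_G].
      by rewrite opprB addrCA subrr addr0.
    by rewrite mulr_ge0 ?sqr_ge0 // ltW // cond_gt0.
  have -> : G T = 0 by rewrite /G vT expr0n /= mul0r mulr0.
  by rewrite /defint; lra.
apply/ler_addgt0Pr => eta eta0.
pose M := `|dv 0| + 1; pose m := dvert a f 0 / 2.
have m0 : 0 < m by rewrite divr_gt0 // dvert0_gt0.
have M0 : 0 < M by rewrite /M ltr_wpDl.
have H : \forall t \near (0 : R), `|dv t| < M /\ m < dvert a f t /\ prim I 0 - eta / 2 < prim I t.
  apply: filterI; last apply: filterI.
  - apply: (@near_lt _ (fun t => `|dv t|)); last by rewrite ltrDl.
    by move=> t; apply: cvg_norm; exact: cdv.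
  - by apply: near_gt; [exact: continuous_dvert|rewrite /m; have := dvert0_gt0; lra].
  - by apply: near_gt => //; rewrite gtrBl divr_gt0.
have [e /= e0 He] := (nbhs_ballP _ _).1 H.
(* On [[0, s]], [v] is at most [M * s] and [vert] at least [m * s]; the last
   bound on [s] makes the quotient [v ^ 2 / vert] at most [eta / 2]. *)
pose s := Num.min T (Num.min (e / 2) (eta / 2 * m / M ^+ 2)).
have s0 : 0 < s by rewrite !lt_min Tp !divr_gt0 // ?exprn_gt0 // mulr_gt0 // divr_gt0.
have sT : s <= T by rewrite ge_min lexx.
have se : s <= e / 2 by rewrite !ge_min lexx orbT.
have sm : s <= eta / 2 * m / M ^+ 2 by rewrite !ge_min lexx !orbT.
have Hs t : 0 <= t <= s -> `|dv t| < M /\ m < dvert a f t /\ prim I 0 - eta / 2 < prim I t.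
  move=> /andP[h1 h2]; apply: He; rewrite /ball /= sub0r normrN ger0_norm //; lra.
have [c cs Ec] := MVT_le (ltW s0) (fun x _ => hv x).
have [d ds Ed] := MVT_le (ltW s0) (fun x _ => derive_vert a0 hf x).
have [dvM _] := Hs c cs; have [_ [dm _]] := Hs d ds.
have ss : 0 <= s <= s by rewrite (ltW s0) lexx.
have [_ [_ Ps]] := Hs s ss; have := key s s0 sT.
have Gs : G s <= eta / 2.
  have h0 : vert a f 0 = 0 by rewrite /vert (f1_at0 hf) mulr0 mul0r.
  move: Ec Ed; rewrite v0 h0 !subr0 => Ec Ed.
  have X : v s ^+ 2 / vert a f s <= eta / 2.
    have dd0 : 0 < dvert a f d by exact: lt_trans m0 dm.
    have ds0 := mulr_gt0 dd0 s0.
    rewrite Ec Ed ler_pdivrMr //.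
    rewrite exprMn.
    have : s * M ^+ 2 <= eta / 2 * m by move: sm; rewrite ler_pdivlMr // exprn_gt0.
    have : dv c ^+ 2 <= M ^+ 2.
      rewrite -[dv c ^+ 2]real_normK ?num_real //.
      by rewrite lerXn2r ?nnegrE ?(ltW M0) ?(ltW dvM).
    have : eta / 2 * m <= eta / 2 * dvert a f d by rewrite ler_wpM2l // ltW // divr_gt0.
    move: (dv c ^+ 2) (dvert a f d) (M ^+ 2) => p q r h1 h2 h3.
    rewrite expr2 mulrA [_ * (_ * s)]mulrA ler_wpM2r ?(ltW s0) //.
    by apply: le_trans (le_trans h3 h1); rewrite mulrC ler_wpM2l // ltW.
  rewrite /G; apply: (@le_trans _ _ (1 * (v s ^+ 2 / vert a f s))); last by rewrite mul1r.
  by apply: ler_wpM2r (cond_dvert_le1 s); rewrite divr_ge0 ?sqr_ge0 // ltW // vert_gt0.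
by lra.
Qed.

End HalfLine.

Lemma line_form_ge0 (v dv : R -> R) T :
  (forall t : R, has_deriv t 1 v (dv t)) -> continuous dv -> 0 <= T ->
  v 0 = 0 -> v T = 0 -> v (- T) = 0 ->
  0 <= defint (- T) T (fun t => cond a f t * dv t ^+ 2 - pot a f t * B t * v t ^+ 2).
Proof.
move=> hv cdv T0 v0 vT vNT; rewrite -(defint_split (- T) 0 T).
apply: addr_ge0; last exact: half_line_form_ge0.
rewrite -[X in defint _ X](oppr0) -defint_reflect; last exact: (continuous_form hv cdv).
have hvN (t : R) : has_deriv t 1 (fun t => v (- t)) (- dv (- t)).
  apply: has_deriv_eq.
    by apply: (pderive_comp (g := v) (f := fun t => - t)); [exact: hv|apply: pderiveN; exact: pderive_id].
  by rewrite mulrN1.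
have cdvN : continuous (fun t => - dv (- t)).
  apply: continuous_opp; apply: (continuous_after cdv); apply: continuous_opp.
  exact: continuous_ident.
have := half_line_form_ge0 hvN cdvN T0; rewrite oppr0 v0 => /(_ erefl vNT).
by congr (_ <= _); apply: defint_ext => t; rewrite (cond_even a0 hf) (pot_even a0 hf) sqrrN.
Qed.

Section CylinderForm.
Variables (w w0 w1 : plane -> R) (T : R) (K : nat).
Hypotheses (hw0 : forall q, has_deriv q (evec 0) w (w0 q))
           (hw1 : forall q, has_deriv q (evec 1) w (w1 q)).
Hypotheses (cw : continuous w) (cw0 : continuous w0) (cw1 : continuous w1).
Hypotheses (pw : periodic w) (pw0 : periodic w0) (pw1 : periodic w1).
Hypotheses (T0 : 0 <= T) (wT : forall q : plane, T <= `|q 0 0| -> w q = 0).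
Hypotheses (K_le : K%:R <= Num.sqrt (a ^+ 2 + 2)) (lt_K : Num.sqrt (a ^+ 2 + 2) < K.+1%:R).
Hypothesis w_orth : forall j, (j < (2 * K).+1)%N ->
  defint 0 (2 * pi) (fun th => w (pt 0 th) * trig j th) = 0.

Let twist j (q : plane) : R := trig j (q 0 1 - Phi f (q 0 0)).
Let dtwist j (q : plane) : R := dtrig j (q 0 1 - Phi f (q 0 0)).
Let flux (q : plane) : R := cond a f (q 0 0) * w0 q + a / 2 * w1 q.
Let loop (u : plane -> R) t : R := defint 0 (2 * pi) (fun th => u (pt t th)).
Let coef j t : R := loop (fun q => w q * twist j q) t.
Let dcoef j t : R := loop (fun q => w0 q * twist j q) t + rate f t * loop (fun q => w1 q * twist j q) t.

Let cang : continuous (fun q : plane => q 0 1 - Phi f (q 0 0)).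
Proof.
cont ltac:(solve [exact: continuous_th|
  exact: (continuous_after (continuous_Phi hf) continuous_t)]).
Qed.
Let ctwist j : continuous (twist j).
Proof. exact: (continuous_after (@continuous_trig R j) cang). Qed.
Let cdtwist j : continuous (dtwist j).
Proof. exact: (continuous_after (@continuous_dtrig R j) cang). Qed.
Let after (g : R -> R) : continuous g -> continuous (fun q : plane => g (q 0 0)).
Proof. by move=> cg; exact: (continuous_after cg continuous_t). Qed.
Let cflux : continuous flux.
Proof.
by rewrite /flux; cont ltac:(solve [exact: (after (continuous_cond hf))|exact: cw0|exact: cw1]).
Qed.

Let periodic_pt (u : plane -> R) t th : periodic u -> u (pt t (th + 2 * pi)) = u (pt t th).
Proof. by move=> pu; rewrite -pt_turn. Qed.

Let loop_shift (u : plane -> R) t phi : continuous u -> periodic u ->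
  defint 0 (2 * pi) (fun th => u (pt t (th + phi))) = loop u t.
Proof.
move=> cu pu; rewrite (@defint_shift _ _ _ _ (fun th => u (pt t th))); last exact: continuous_slice.
rewrite add0r addrC defint_periodic //; first exact: continuous_slice.
by move=> x; exact: periodic_pt.
Qed.

Let twist_turn j : periodic (twist j).
Proof.
move=> q; rewrite /twist; have -> : (q + turn) 0 0 = q 0 0 by rewrite mxE turn0 addr0.
have -> : (q + turn) 0 1 = q 0 1 + 2 * pi by rewrite mxE turn1.
by rewrite addrAC trig_turn.
Qed.

Let loop_twist (u : plane -> R) j t : continuous u -> periodic u ->
  loop (fun q => u q * twist j q) t =
  defint 0 (2 * pi) (fun x => u (pt t (x + Phi f t)) * trig j x).
Proof.
move=> cu pu; rewrite -(@loop_shift _ t (Phi f t)).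
- by apply: defint_ext => x; rewrite /twist pt0 pt1 addrK.
- exact: continuous_mul.
- by move=> q; rewrite pu twist_turn.
Qed.

(** Integrating by parts on the circle moves the derivative of the twist to
   [w]; therefore [cond * dcoef] is a Fourier coefficient of [flux], see
   [cond_dcoef]. *)
Let derive_coef j (t : R) : has_deriv t 1 (coef j) (dcoef j t).
Proof.
have c0 : continuous (fun q => w0 q * twist j q) by exact: continuous_mul.
have c1 : continuous (fun q => w1 q * twist j q) by exact: continuous_mul.
have c2 : continuous (fun q => w q * dtwist j q) by exact: continuous_mul.
have crate : continuous (fun q : plane => rate f (q 0 0)) by exact: (after (continuous_rate hf)).
apply: has_deriv_eq.
  apply: (@derive_inner _ (fun q => w q * twist j q)
    (fun q => w0 q * twist j q - rate f (q 0 0) * (w q * dtwist j q))).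
  - exact: twopi_ge0.
  - exact: continuous_mul.
  - apply: continuous_add; first exact: c0.
    by apply: continuous_opp; apply: continuous_mul; [exact: crate|exact: c2].
  move=> q; apply: has_deriv_eq.
    apply: pderiveM; first exact: hw0.
    apply: (pderive_comp (g := trig j) (f := fun q : plane => q 0 1 - Phi f (q 0 0))).
      exact: derive_trig.
    apply: pderiveD; first exact: plane_coord_deriv.
    by apply: pderiveN; exact: height_deriv (derive_Phi hf _).
  by rewrite /twist /dtwist /=; ring.
have c3 : continuous (fun q : plane => rate f (q 0 0) * (w q * dtwist j q)).
  by apply: continuous_mul; [exact: crate|exact: c2].
rewrite (defintB _ _ (continuous_slice (t := t) c0) (continuous_slice (t := t) c3)).
congr (_ + _).
under defint_ext => th do rewrite pt0.
rewrite (defintZ _ _ _ (continuous_slice (t := t) c2)).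
rewrite -mulrN; congr (_ * _).
have hs (th : R) : has_deriv th 1 (fun th => w (pt t th)) (w1 (pt t th)).
  by apply/slice1_deriv; exact: hw1.
have ht (th : R) : has_deriv th 1 (fun th => twist j (pt t th)) (dtwist j (pt t th)).
  apply/slice1_deriv; rewrite /twist /dtwist; apply: has_deriv_eq.
    apply: (pderive_comp (g := trig j) (f := fun q : plane => q 0 1 - Phi f (q 0 0))).
      exact: derive_trig.
    apply: pderiveD; first exact: plane_coord_deriv.
    by apply: pderiveN; exact: height_deriv (derive_Phi hf _).
  by rewrite /=; ring.
have Ep := defint_parts 0 (2 * pi) hs ht (continuous_slice (t := t) cw1)
  (continuous_slice (t := t) (cdtwist (j := j))).
transitivity (defint 0 (2 * pi) (fun x => w1 (pt t x) * twist j (pt t x))); last by [].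
rewrite Ep.
have E (u : plane -> R) : periodic u -> u (pt t (2 * pi)) = u (pt t 0).
  by move=> pu; rewrite -[2 * pi]add0r periodic_pt.
by rewrite (E _ pw) (E _ (@twist_turn j)) subrr sub0r.
Qed.

Let cdcoef j : continuous (dcoef j).
Proof.
apply: continuous_add; last apply: continuous_mul.
- by apply: continuous_loop; exact: continuous_mul.
- exact: (continuous_rate hf).
- by apply: continuous_loop; exact: continuous_mul.
Qed.

Let cond_dcoef j t : cond a f t * dcoef j t = loop (fun q => flux q * twist j q) t.
Proof.
have c0 : continuous (fun q => w0 q * twist j q) by exact: continuous_mul.
have c1 : continuous (fun q => w1 q * twist j q) by exact: continuous_mul.
rewrite /dcoef mulrDr mulrA cond_rate /loop.
have s0 := continuous_slice (t := t) c0; have s1 := continuous_slice (t := t) c1.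
rewrite -(defintZ _ _ _ s0) -(defintZ _ _ _ s1) -defintD; last 2 first.
- by apply: continuous_mul; [exact: continuous_cst|exact: s0].
- by apply: continuous_mul; [exact: continuous_cst|exact: s1].
by apply: defint_ext => th; rewrite /flux pt0; ring.
Qed.

Let pflux : periodic flux.
Proof. by move=> q; rewrite /flux pw0 pw1 mxE turn0 addr0. Qed.

Let pot_le_mu : exists mu : R, [/\ K%:R < mu, mu < K.+1%:R & forall t, pot a f t <= mu ^+ 2].
Proof.
(* Any number strictly between [sqrt (a ^ 2 + 2)] and [K + 1] would do. *)
exists ((Num.sqrt (a ^+ 2 + 2) + K.+1%:R) / 2); split.
- have KK : K%:R < K.+1%:R :> R by rewrite ltr_nat.
  by move: K_le KK; move: (Num.sqrt _) (K%:R : R) (K.+1%:R : R) => s k k1; lra.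
- by move: lt_K; move: (Num.sqrt _) (K.+1%:R : R) => s k1; lra.
move=> t; apply: le_trans (pot_le a0 hf t) _.
rewrite -[leLHS](@sqr_sqrtr _ (a ^+ 2 + 2)) ?addr_ge0 ?sqr_ge0 //.
have := sqrtr_ge0 (a ^+ 2 + 2); move: lt_K.
by rewrite -/(_ <= _) => h1 h0; rewrite lerXn2r ?nnegrE //; lra.
Qed.

Let form (q : plane) : R :=
  B (q 0 0) * (flux q ^+ 2 + w1 q ^+ 2 - pot a f (q 0 0) * w q ^+ 2).

(** On one circle, Bessel's inequality bounds the term in [flux] from below,
   and [wirtinger_modes] the other two. *)
Let slice_form_ge t : \sum_(j < (2 * K).+1)
    (cond a f t * dcoef j t ^+ 2 - pot a f t * B t * coef j t ^+ 2) <= loop form t.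
Proof.
have [mu [Kmu muK Wmu]] := pot_le_mu.
have A0 := cond_gt0 f a0 t.
have c2 (u : plane -> R) : continuous u -> continuous (fun q : plane => u q ^+ 2).
  by move=> cu; cont ltac:(solve [exact: cu]).
have -> : loop form t = B t * (loop (fun q => flux q ^+ 2) t +
    (loop (fun q => w1 q ^+ 2) t - pot a f t * loop (fun q => w q ^+ 2) t)).
  rewrite /loop -defintZ; last by exact: (continuous_slice (t := t) (c2 _ cw)).
  rewrite -defintB; [|exact: (continuous_slice (t := t) (c2 _ cw1))|]; last first.
    by apply: continuous_mul; [exact: continuous_cst|exact: (continuous_slice (t := t) (c2 _ cw))].
  rewrite -defintD; [|exact: (continuous_slice (t := t) (c2 _ cflux))|]; last first.
    apply: continuous_add; first exact: (continuous_slice (t := t) (c2 _ cw1)).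
    apply: continuous_opp.
    by apply: continuous_mul; [exact: continuous_cst|exact: (continuous_slice (t := t) (c2 _ cw))].
  rewrite -defintZ; last first.
    apply: continuous_add; first exact: (continuous_slice (t := t) (c2 _ cflux)).
    apply: continuous_add; first exact: (continuous_slice (t := t) (c2 _ cw1)).
    apply: continuous_opp.
    by apply: continuous_mul; [exact: continuous_cst|exact: (continuous_slice (t := t) (c2 _ cw))].
  by apply: defint_ext => th; rewrite /form pt0 addrA.
have shifted (u : plane -> R) : continuous u -> continuous (fun x => u (pt t (x + Phi f t))).
  move=> cu; apply: (continuous_after (continuous_slice (t := t) cu)).
  by apply: continuous_add; [exact: continuous_ident|exact: continuous_cst].
have sqr_shift (u : plane -> R) : continuous u -> periodic u ->
    defint 0 (2 * pi) (fun x => u (pt t (x + Phi f t)) ^+ 2) = loop (fun q => u q ^+ 2) t.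
  move=> cu pu; rewrite -(@loop_shift (fun q => u q ^+ 2) t (Phi f t)) //; first exact: c2.
  by move=> q; rewrite pu.
have Bs := @bessel R K _ (shifted _ cflux).
have hv (x : R) : has_deriv x 1 (fun x => w (pt t (x + Phi f t))) (w1 (pt t (x + Phi f t))).
  apply: has_deriv_eq.
    apply: (pderive_comp (g := fun th => w (pt t th)) (f := fun x => x + Phi f t)).
      by apply/slice1_deriv; exact: hw1.
    by apply: pderiveD; [exact: pderive_id|exact: pderiveC].
  by rewrite /= addr0 mulr1.
have px (u : plane -> R) : periodic u -> forall x, u (pt t (x + 2 * pi + Phi f t)) = u (pt t (x + Phi f t)).
  by move=> pu x; rewrite addrAC periodic_pt.
have Ws := @wirtinger_modes R K _ _ mu (pot a f t) hv (shifted _ cw1) (px _ pw) (px _ pw1) Kmu muK (Wmu t).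
rewrite (sqr_shift _ cflux pflux) in Bs.
rewrite (sqr_shift _ cw1 pw1) (sqr_shift _ cw pw) in Ws.
rewrite -(ler_pM2l A0) [leRHS]mulrA divff ?mul1r ?gt_eqF //.
apply: le_trans (lerD Bs Ws); rewrite mulr_sumr -big_split /=.
apply: ler_sum => j _.
rewrite -(loop_twist _ _ cflux pflux) -(loop_twist _ _ cw pw) -cond_dcoef -/(coef j t).
have -> : cond a f t * (cond a f t * dcoef j t ^+ 2 - pot a f t * B t * coef j t ^+ 2) =
    (cond a f t * dcoef j t) ^+ 2 - pot a f t * coef j t ^+ 2.
  by move: (dcoef j t) (coef j t) (pot a f t) (cond a f t) A0 => x y W A A0; field; rewrite gt_eqF.
have := mulr_ge0 (sqr_ge0 (freq j)%:R) (sqr_ge0 (coef j t)).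
by move: (coef j t) (freq j)%:R (pot a f t) (cond a f t * _) => c n W d; lra.
Qed.

(** By [slice_form_ge], only the modes of frequency at most [K] are left. In
   the twisted angle each of them is a function of the height, which vanishes
   at [0] because of [w_orth] and [Phi 0 = 0]: [line_form_ge0] applies. *)
Lemma index_form_ge0 : 0 <= int2 T form.
Proof.
have cform : continuous form.
  rewrite /form; apply: continuous_mul; first exact: (after (continuous_B a0 hf)).
  by cont ltac:(solve [exact: cflux|exact: cw1|exact: cw|exact: (after (continuous_pot a0 hf))]).
have cJ (j : nat) : continuous (fun t => cond a f t * dcoef j t ^+ 2 - pot a f t * B t * coef j t ^+ 2).
  by apply: (continuous_form (derive_coef j)); exact: cdcoef.
apply: (@le_trans _ _ (defint (- T) T (fun t => \sum_(j < (2 * K).+1)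
    (cond a f t * dcoef j t ^+ 2 - pot a f t * B t * coef j t ^+ 2)))); last first.
  apply: le_defint; last by move=> t _; exact: slice_form_ge.
  - by apply: continuous_sum => j; exact: cJ.
  - exact: continuous_loop.
  - by rewrite ge0_cp.
rewrite defint_sum; last by move=> j; exact: cJ.
have edge j t : T <= `|t| -> coef j t = 0.
  move=> Tt; rewrite /coef /loop; under defint_ext => th do rewrite wT ?pt0 // mul0r.
  by rewrite defint_cst mul0r.
apply: sumr_ge0 => j _; apply: (line_form_ge0 (derive_coef j)) => //.
- rewrite /coef /loop; under defint_ext => th do rewrite /twist pt0 pt1 (Phi_at0 hf) subr0.
  exact: w_orth.
- by apply: edge; exact: ler_norm.
- by apply: edge; rewrite normrN; exact: ler_norm.
Qed.

End CylinderForm.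
End IndexForm.

(** * Logarithmic cutoffs, vanishing integrals and the unit sphere *)

Section Cutoff.
Context {R : realType}.
Implicit Types (x r : R).

Let cpos : continuous (fun x : R => 2 * Num.max x 0).
Proof.
apply: continuous_mul; first exact: continuous_cst.
by move=> t; apply: (@continuous_max R R id (fun=> 0)); [exact: cvg_id|exact: cvg_cst].
Qed.

(** The square of the positive part; obtained as a primitive, it comes with
   its derivative at [0]. *)
Definition pos_sqr : R -> R := prim (fun x => 2 * Num.max x 0).

Lemma derive_pos_sqr x : has_deriv x 1 pos_sqr (2 * Num.max x 0).
Proof. apply: derive_prim; exact: cpos. Qed.

Lemma pos_sqr_le0 x : x <= 0 -> pos_sqr x = 0.
Proof.
move=> x0; have [c /andP[_ c0] E] := MVT_le x0 (fun y _ => derive_pos_sqr y).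
have S0 : pos_sqr 0 = 0 by exact: (prim0 cpos).
by move: E; rewrite S0 max_r // mulr0 mul0r sub0r => /eqP; rewrite oppr_eq0 => /eqP.
Qed.

Lemma pos_sqr_ge0 x : 0 <= x -> pos_sqr x = x ^+ 2.
Proof.
move=> x0.
have h (y : R) : 0 <= y <= x -> has_deriv y 1 (fun y => pos_sqr y - y ^+ 2)
    (2 * Num.max y 0 - 2 * y).
  move=> _; der ltac:(solve [exact: derive_pos_sqr]); ring.
have [c /andP[c0 _] E] := MVT_le x0 h.
move: E; rewrite max_l // subrr mul0r (pos_sqr_le0 (lexx 0)) expr0n /= subr0.
by rewrite subr0 => /eqP; rewrite subr_eq0 => /eqP.
Qed.

Lemma pos_sqr_nneg x : 0 <= pos_sqr x.
Proof.
by case: (leP 0 x) => h; [rewrite pos_sqr_ge0 ?sqr_ge0|rewrite pos_sqr_le0 // ltW].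
Qed.

(** A transition of class C^1 from [0] to [1], with a derivative at most [1]
   and an explicit rate of convergence at infinity. *)
Definition psi x : R := pos_sqr x / (1 + pos_sqr x).
Definition dpsi x : R := 2 * Num.max x 0 / (1 + pos_sqr x) ^+ 2.

Let den_gt0 x : 0 < 1 + pos_sqr x.
Proof. by rewrite ltr_pwDl // pos_sqr_nneg. Qed.

Lemma derive_psi x : has_deriv x 1 psi (dpsi x).
Proof.
have n0 : 1 + pos_sqr x != 0 by rewrite gt_eqF.
rewrite /psi /dpsi; apply: has_deriv_eq.
  apply: pderiveM; first exact: derive_pos_sqr.
  apply: pderiveV; first exact: n0.
  by apply: pderiveD; [exact: pderiveC|exact: derive_pos_sqr].
by move: n0; move: (pos_sqr x) (Num.max x 0) => S m n0; field.
Qed.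

Lemma continuous_dpsi : continuous dpsi.
Proof.
have cS : continuous pos_sqr by move=> x; apply: deriv_continuous (derive_pos_sqr x).
rewrite /dpsi; apply: continuous_mul; first exact: cpos.
apply: continuous_inv; first by move=> x; rewrite expf_neq0 // gt_eqF.
by cont ltac:(solve [exact: cS]).
Qed.

Lemma psi_le0 x : x <= 0 -> psi x = 0 /\ dpsi x = 0.
Proof. by move=> x0; rewrite /psi /dpsi pos_sqr_le0 // max_r // mulr0 !mul0r. Qed.

Lemma psi_bounds x : 0 <= psi x <= 1.
Proof.
have d := den_gt0 x; rewrite /psi divr_ge0 ?pos_sqr_nneg ?(ltW d) //=.
by rewrite ler_pdivrMr // mul1r lerDr.
Qed.

Lemma dpsi_bounds x : 0 <= dpsi x <= 1.
Proof.
rewrite /dpsi; case: (leP x 0) => [x0|x0].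
  by rewrite mulr0 mul0r lexx ler01.
rewrite (pos_sqr_ge0 (ltW x0)).
have p : 0 < 1 + x ^+ 2 by rewrite ltr_pwDl // sqr_ge0.
have n0 : 0 <= 2 * x / (1 + x ^+ 2) ^+ 2.
  by rewrite divr_ge0 // ?exprn_ge0 ?(ltW p) // mulr_ge0 // ltW.
rewrite n0 /= ler_pdivrMr ?exprn_gt0 // mul1r.
apply: (@le_trans _ _ (1 + x ^+ 2)); first by have := sqr_ge0 (x - 1); lra.
by rewrite expr2 ler_pMr // lerDl sqr_ge0.
Qed.

Lemma psi_ge_half x : 1 <= x -> 1 / 2 <= psi x.
Proof.
move=> x1; have x0 : 0 <= x by exact: le_trans x1.
rewrite /psi pos_sqr_ge0 // ler_pdivlMr ?ltr_pwDl ?sqr_ge0 //.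
have : 1 <= x ^+ 2 by rewrite expr_ge1.
by lra.
Qed.

Lemma psi_tail x y : 0 < y -> y <= x -> 1 - psi x <= (y ^+ 2)^-1.
Proof.
move=> y0 yx; have x0 : 0 <= x by rewrite ltW // (lt_le_trans y0).
rewrite /psi pos_sqr_ge0 //.
have p : 0 < 1 + x ^+ 2 by rewrite ltr_pwDl // sqr_ge0.
have -> : 1 - x ^+ 2 / (1 + x ^+ 2) = (1 + x ^+ 2)^-1 by field; rewrite gt_eqF.
rewrite lef_pV2 ?posrE ?exprn_gt0 //.
have : y ^+ 2 <= x ^+ 2 by rewrite lerXn2r ?nnegrE // ltW.
by lra.
Qed.

Section LogCutoff.
Variables (kap del : R).
Hypotheses (kap0 : 0 < kap) (del0 : 0 < del).

(** A logarithmic cutoff, zero up to [del]. *)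
Definition cut r : R := psi (kap * ln (r / del)).
Definition dcut r : R := kap / r * dpsi (kap * ln (r / del)).

Lemma cut_small r : r <= del -> cut r = 0 /\ dcut r = 0.
Proof.
move=> rd; have [|c d] := @psi_le0 (kap * ln (r / del)).
  rewrite mulr_ge0_le0 ?(ltW kap0) //; apply: ln_le0.
  by rewrite ler_pdivrMr // mul1r.
by rewrite /cut /dcut c d mulr0.
Qed.

Lemma derive_cut r : has_deriv r 1 cut (dcut r).
Proof.
case: (ltP r del) => rd.
  have [_ ->] := cut_small (ltW rd).
  apply: near_eq_deriv (pderiveC 0 r 1).
  have H : \forall y \near r, y < del.
    by apply: (@near_lt _ id) => //; exact: continuous_ident.
  by apply: filterS H => y yd; have [-> _] := cut_small (ltW yd).
have r0 : 0 < r by exact: lt_le_trans rd.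
rewrite /cut; apply: has_deriv_eq.
  apply: (pderive_comp (g := psi) (f := fun r => kap * ln (r / del))).
    exact: derive_psi.
  apply: pderiveM; first exact: pderiveC.
  apply: (pderive_comp (g := @ln R) (f := fun r => r / del)).
    by apply: is_derive1_ln; rewrite divr_gt0.
  by apply: pderiveM; [exact: pderive_id|exact: pderiveC].
by rewrite /dcut /=; field; rewrite !gt_eqF.
Qed.

Lemma continuous_cut : continuous cut.
Proof. by move=> r; apply: deriv_continuous (derive_cut r). Qed.

Lemma continuous_dcut : continuous dcut.
Proof.
move=> r; case: (ltP r del) => rd.
  have H : \forall y \near r, y < del.
    by apply: (@near_lt _ id) => //; exact: continuous_ident.
  have E : \forall y \near r, 0 = dcut y.
    by apply: filterS H => y yd; have [_ ->] := cut_small (ltW yd).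
  suff : dcut y @[y --> r] --> dcut r by [].
  have [_ ->] := cut_small (ltW rd).
  by apply: (cvg_trans (near_eq_cvg E)); exact: cvg_cst.
have r0 : 0 < r by exact: lt_le_trans rd.
have cl : {for r, continuous (fun r => kap * ln (r / del))}.
  apply: cvgM; first exact: cvg_cst.
  apply: (@continuous_comp _ _ _ (fun r => r / del) (@ln R)).
    by apply: cvgM; [exact: cvg_id|exact: cvg_cst].
  by apply: continuous_ln; rewrite divr_gt0.
apply: cvgM; last exact: (@continuous_comp _ _ _ (fun r => kap * ln (r / del)) dpsi r cl (@continuous_dpsi _)).
apply: cvgM; first exact: cvg_cst.
by apply: cvgV; [rewrite gt_eqF|exact: cvg_id].
Qed.

Lemma cut_bounds r : 0 <= cut r <= 1.
Proof. exact: psi_bounds. Qed.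

Lemma dcut_ge0 r : 0 <= dcut r.
Proof.
case: (leP r del) => rd; first by have [_ ->] := cut_small rd.
have r0 : 0 < r by exact: lt_trans rd.
have /andP[h _] := dpsi_bounds (kap * ln (r / del)).
by rewrite /dcut mulr_ge0 // divr_ge0 ?(ltW kap0) ?(ltW r0).
Qed.

End LogCutoff.

(** As a function of [ln r] the cutoff has derivative at most [kap]. The last
   factor is at least [1 / 2] where [dcut] is not zero: it is there because
   the quantities to be integrated against [dcut] are only controlled under a
   cutoff. *)
Lemma dcut_le kap del r : 0 < kap -> 0 < del ->
  r * dcut kap del r <= 2 * kap * cut 1 (del * expR (-1)) r.
Proof.
move=> k0 d0; have /andP[c0 _] := cut_bounds 1 (del * expR (-1)) r.
case: (leP r del) => rd.
  by have [_ ->] := cut_small k0 d0 rd; rewrite mulr0 mulr_ge0 // mulr_ge0 // ltW.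
have r0 : 0 < r by exact: lt_trans rd.
have e0 := expR_gt0 (-1 : R).
have -> : r * dcut kap del r = kap * dpsi (kap * ln (r / del)).
  by rewrite /dcut; move: (dpsi _) => p; field; rewrite gt_eqF.
have /andP[_ h] := dpsi_bounds (kap * ln (r / del)).
apply: (@le_trans _ _ (kap * 1)); first by rewrite ler_pM2l.
rewrite [2 * _]mulrC -mulrA ler_pM2l //.
have : 1 / 2 <= cut 1 (del * expR (-1)) r; last by lra.
apply: psi_ge_half; rewrite mul1r.
have -> : r / (del * expR (-1)) = r / del * expR 1.
  by rewrite invfM -expRN opprK mulrA.
rewrite lnM ?posrE ?expR_gt0 ?divr_gt0 // expRK lerDr ln_ge0 //.
by rewrite ler_pdivlMr // mul1r ltW.
Qed.

(** For [r <= e] nothing is asked of the cutoff. For [r > e] the argument of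
   [psi] is large because [- ln del = 1 / kap ^ 2] outweighs [ln r], which is
   at least [ln e]. *)
Lemma cut_exhausts (e : R) : 0 < e -> exists kap del : R,
  [/\ 0 < kap <= e, 0 < del & forall r, 0 <= r -> (1 - cut kap del r) * r <= e * (1 + r)].
Proof.
move=> e0; pose l := `|ln e|.
(* By the third bound the argument of [psi] is at least [1 / (2 kap)], where
   [psi] differs from [1] by at most [4 kap ^ 2 <= 4 kap], which is at most
   [e]. *)
pose kap := Num.min (Num.min 1 e) (Num.min ((2 * l + 1)^-1) (e / 4)).
have l0 : 0 <= l by exact: normr_ge0.
have l1 : 0 < 2 * l + 1 by lra.
have k0 : 0 < kap by rewrite !lt_min ltr01 e0 invr_gt0 l1 divr_gt0.
have k1 : kap <= 1 by rewrite !ge_min lexx.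
have ke : kap <= e by rewrite !ge_min lexx orbT.
have kl : kap <= (2 * l + 1)^-1 by rewrite !ge_min lexx !orbT.
have k4 : kap <= e / 4 by rewrite !ge_min lexx !orbT.
exists kap, (expR (- (kap ^+ 2)^-1)); split; rewrite ?k0 ?expR_gt0 // => r r0.
have /andP[c0 c1] := cut_bounds kap (expR (- (kap ^+ 2)^-1)) r.
case: (leP r e) => re.
  apply: (@le_trans _ _ (1 * r)); first by rewrite ler_wpM2r //; lra.
  by have := mulr_ge0 (ltW e0) r0; lra.
have r0' : 0 < r by exact: lt_trans re.
apply: (@le_trans _ _ (e * r)); last by rewrite ler_pM2l // lerDr.
rewrite ler_pM2r //.
have X : (2 * kap)^-1 <= kap * ln (r / expR (- (kap ^+ 2)^-1)).
  rewrite ln_div ?posrE ?expR_gt0 // expRK opprK mulrDr.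
  have -> : kap * (kap ^+ 2)^-1 = kap^-1 by field; rewrite gt_eqF.
  have h1 : - l <= ln r.
    apply: (@le_trans _ _ (ln e)); first by rewrite lerNl /l -normrN ler_norm.
    by rewrite ler_ln ?posrE // ltW.
  have h2 : kap * l <= 1 / 2.
    have : kap * (2 * l + 1) <= 1 by rewrite -ler_pdivlMr // mul1r.
    by lra.
  have h3 : - (1 / 2) <= kap * ln r.
    apply: (@le_trans _ _ (kap * - l)); first by lra.
    by rewrite ler_pM2l.
  have h4 : 1 <= kap^-1 by rewrite invf_ge1.
  have -> : (2 * kap)^-1 = kap^-1 / 2 by field; rewrite gt_eqF.
  by lra.
have k20 : 0 < (2 * kap)^-1 by rewrite invr_gt0 mulr_gt0.
apply: (le_trans (psi_tail k20 X)).
rewrite exprVn invrK exprMn.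
have : kap ^+ 2 <= kap * 1 by rewrite expr2 ler_pM2l.
by lra.
Qed.

End Cutoff.

Section ZeroIntegral.
Context {R : realType}.
Local Notation plane := 'rV[R]_2.

(** The primitive is nondecreasing with equal end values, hence constant. *)
Lemma defint_eq0 (g : R -> R) a b x : continuous g -> a <= b ->
  (forall y, 0 <= g y) -> defint a b g = 0 -> a < x < b -> g x = 0.
Proof.
move=> cg ab g0 I0 /andP[ax xb].
have mono s t : s <= t -> prim g s <= prim g t.
  by move=> st; apply: (derive_ge0_le st (fun y _ => derive_prim y cg)).
have cst y : a <= y <= b -> prim g y = prim g a.
  move=> /andP[ay yb]; apply/le_anti/andP; split; last exact: mono.
  apply: (le_trans (mono _ _ yb)); have := I0; rewrite /defint => /eqP.
  by rewrite subr_eq0 => /eqP ->.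
have H : \forall y \near x, prim g a = prim g y.
  have H1 : \forall y \near x, a < y by apply: (@near_gt _ id) => //; exact: continuous_ident.
  have H2 : \forall y \near x, y < b by apply: (@near_lt _ id) => //; exact: continuous_ident.
  by apply: filterS2 H1 H2 => y h1 h2; rewrite cst // !ltW.
have h := near_eq_deriv H (pderiveC (prim g a) x 1).
by have [_ <-] := derive_prim x cg; case: h.
Qed.

Lemma int2_eq0 (w : plane -> R) T (q : plane) : continuous w -> periodic w -> 0 <= T ->
  (forall p, 0 <= w p) -> int2 T w = 0 -> `|q 0 0| < T -> w q = 0.
Proof.
move=> cw pw T0 w0 I0 qT; rewrite (ptE q).
move: (q 0 0) (q 0 1) qT => t th; rewrite ltr_norml => tT.
have pi0 := pi_gt0 R.
have cs := continuous_slice (t := t) cw.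
have L0 : defint 0 (2 * pi) (fun th => w (pt t th)) = 0.
  apply: (@defint_eq0 (fun t => defint 0 (2 * pi) (fun th => w (pt t th))) (- T) T) tT => //;
    first exact: continuous_loop.
    by rewrite ge0_cp.
  by move=> s; apply: defint_ge0 => //; [exact: continuous_slice|exact: twopi_ge0].
apply: (@defint_eq0 (fun th => w (pt t th)) (th - pi) (th - pi + 2 * pi)) => //.
- by rewrite lerDl twopi_ge0.
- by rewrite defint_periodic // => x; rewrite -pt_turn pw.
- by apply/andP; split; lra.
Qed.

Lemma sphere_max n (q : 'rV[R]_n.+1 -> R) : continuous q ->
  exists2 c : 'rV[R]_n.+1, \sum_i c 0 i ^+ 2 = 1 &
    forall d : 'rV[R]_n.+1, \sum_i d 0 i ^+ 2 = 1 -> q d <= q c.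
Proof.
move=> cq; pose s (c : 'rV[R]_n.+1) : R := \sum_i c 0 i ^+ 2.
have cs : continuous s.
  apply: continuous_sum => i; apply: continuous_expn.
  by move=> c; exact: coord_continuous.
pose S := [set c | s c = 1].
have clS : closed S.
  have -> : S = s @^-1` [set 1] by [].
  by apply: closed_comp; [move=> c _; exact: cs|exact: closed_eq].
pose M : R := 1.
pose C := [set v : 'rV[R]_n.+1 | forall i, `[- M, M]%classic (v ord0 i)].
have cC : compact C by apply: (@rV_compact _ _ (fun=> `[- M, M]%classic)) => i; exact: segment_compact.
have SC : S `<=` C.
  move=> c Sc i; rewrite /= in_itv /= -ler_norml -(@ler_pXn2r _ 2) ?nnegrE // expr1n real_normK ?num_real //.
  by rewrite -[leRHS]Sc /s (bigD1 i) //= lerDl sumr_ge0 // => j _; exact: sqr_ge0.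
have cpS : compact S by exact: (subclosed_compact clS cC SC).
have [|c /[!inE] Sc Hc] := EVT_max_rV _ cpS (continuous_subspaceT cq).
  exists (delta_mx 0 0); rewrite /S /s /= (bigD1 ord0) //= mxE !eqxx expr1n big1 ?addr0 //.
  by move=> i i0; rewrite mxE eqxx /= (negbTE i0) expr0n.
by exists c => // d Sd; apply: Hc; rewrite inE.
Qed.

End ZeroIntegral.

(** * The cut-off Green identity *)

Section Periodic.
Context {R : realType}.
Local Notation plane := 'rV[R]_2.

Lemma partial_periodic (u : plane -> R) i : periodic u -> periodic (partial i u).
Proof.
move=> pu q; rewrite /partial /derive.
have -> : (fun h : R => h^-1 *: ((u \o shift (q + turn)) (h *: evec i) - u (q + turn))) =
          (fun h : R => h^-1 *: ((u \o shift q) (h *: evec i) - u q)) => //.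
by apply/funext => h /=; rewrite addrA !pu.
Qed.

End Periodic.

Section DivergenceForm.
Context {R : realType}.
Variables (a : R) (f : R -> R).
Hypotheses (a0 : 0 < a) (hf : catenoid_profile a f).
Local Notation plane := 'rV[R]_2.
Local Notation t q := (q 0 0).
Local Notation B s := ((cond a f s)^-1).

(** The principal part of the index form, polarised: the matrix [conductivity]
   as a bilinear form. *)
Definition bracket s (x0 x1 y0 y1 : R) : R :=
  x0 * (cond a f s * y0 + a / 2 * y1) + x1 * (a / 2 * y0 + cocond a f s * y1).

(** Completing the square, with [cond * cocond - a ^ 2 / 4 = 1]. *)
Lemma bracket_sqr s x0 x1 : bracket s x0 x1 x0 x1 =
  B s * ((cond a f s * x0 + a / 2 * x1) ^+ 2 + x1 ^+ 2).
Proof.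
have y4 := f24_neq0 f s; rewrite /bracket /cond /cocond; field.
by rewrite y4 gt_eqF.
Qed.

Lemma bracket_ge0 s x0 x1 : 0 <= bracket s x0 x1 x0 x1.
Proof.
rewrite bracket_sqr mulr_ge0 ?addr_ge0 ?sqr_ge0 //.
by rewrite invr_ge0 ltW // cond_gt0.
Qed.

Lemma bracketC s x0 x1 y0 y1 : bracket s x0 x1 y0 y1 = bracket s y0 y1 x0 x1.
Proof. by rewrite /bracket; ring. Qed.

Lemma bracket_le s x0 x1 y0 y1 : `|bracket s x0 x1 y0 y1| <=
  (bracket s x0 x1 x0 x1 + bracket s y0 y1 y0 y1) / 2.
Proof.
have h1 := bracket_ge0 s (x0 - y0) (x1 - y1).
have h2 := bracket_ge0 s (x0 + y0) (x1 + y1).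
have e1 : bracket s (x0 - y0) (x1 - y1) (x0 - y0) (x1 - y1) =
  bracket s x0 x1 x0 x1 + bracket s y0 y1 y0 y1 - 2 * bracket s x0 x1 y0 y1.
  by rewrite /bracket; ring.
have e2 : bracket s (x0 + y0) (x1 + y1) (x0 + y0) (x1 + y1) =
  bracket s x0 x1 x0 x1 + bracket s y0 y1 y0 y1 + 2 * bracket s x0 x1 y0 y1.
  by rewrite /bracket; ring.
by rewrite ler_norml; apply/andP; split; lra.
Qed.

Lemma bracket_suml s n (c x0 x1 : 'I_n -> R) y0 y1 :
  bracket s (\sum_i c i * x0 i) (\sum_i c i * x1 i) y0 y1 =
  \sum_i c i * bracket s (x0 i) (x1 i) y0 y1.
Proof.
rewrite /bracket !mulr_suml -big_split /=.
by apply: eq_bigr => i _; ring.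
Qed.

Section Domain.
Variables (D : set plane) (T : R).
Hypotheses (T0 : 0 <= T) (DT : forall q, D q -> `|t q| < T).

Definition continuous_in (F : plane -> R) := forall q, D q -> {for q, continuous F}.

Lemma cin_global F : continuous F -> continuous_in F.
Proof. by move=> cF q _; exact: cF. Qed.

Lemma cin_add F G : continuous_in F -> continuous_in G -> continuous_in (fun q => F q + G q).
Proof. by move=> cF cG q Dq; exact: (cvgD (cF q Dq) (cG q Dq)). Qed.

Lemma cin_mul F G : continuous_in F -> continuous_in G -> continuous_in (fun q => F q * G q).
Proof. by move=> cF cG q Dq; exact: (cvgM (cF q Dq) (cG q Dq)). Qed.

Lemma cin_sum n (F : 'I_n -> plane -> R) : (forall i, continuous_in (F i)) ->
  continuous_in (fun q => \sum_i F i q).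
Proof.
move=> cF q Dq.
suff H s : {for q, continuous (fun p => \sum_(i <- s) F i p)} by exact: H.
elim: s => [|i s IH].
  have -> : (fun p => \sum_(i <- [::]) F i p) = fun=> 0 by apply/funext => p; rewrite big_nil.
  exact: (@continuous_cst _ _ (0 : R) q).
have -> : (fun p => \sum_(i <- i :: s) F i p) = fun p => F i p + \sum_(i <- s) F i p.
  by apply/funext => p; rewrite big_cons.
exact: (cvgD (cF i q Dq) IH).
Qed.

Lemma continuous_height (g : R -> R) : continuous g -> continuous (fun q : plane => g (t q)).
Proof. by move=> cg; exact: (continuous_after cg continuous_t). Qed.

Lemma continuous_cocond : continuous (cocond a f).
Proof.
rewrite /cocond; cont ltac:(solve [exact: (continuous_f hf)]).
by move=> s; rewrite mulf_neq0 ?f24_neq0 // gt_eqF.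
Qed.

Lemma cin_bracket X0 X1 Y0 Y1 : continuous_in X0 -> continuous_in X1 ->
  continuous_in Y0 -> continuous_in Y1 ->
  continuous_in (fun q => bracket (t q) (X0 q) (X1 q) (Y0 q) (Y1 q)).
Proof.
move=> c0 c1 d0 d1; rewrite /bracket.
have cc c : continuous_in (fun=> c) by exact/cin_global/continuous_cst.
have cA := cin_global (continuous_height (continuous_cond hf)).
have cC := cin_global (continuous_height continuous_cocond).
by apply: cin_add; apply: cin_mul => //; apply: cin_add; apply: cin_mul.
Qed.

(** The derivatives of eigenfunctions may be unbounded near the boundary of
   [D], so nothing is required of them outside [D]. *)
Definition C1_in (X X0 X1 : plane -> R) :=
  [/\ (forall q, D q -> has_deriv q (evec 0) X (X0 q)),
      (forall q, D q -> has_deriv q (evec 1) X (X1 q)),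
      continuous X /\ (continuous_in X0 /\ continuous_in X1)
    & periodic X /\ (periodic X0 /\ periodic X1)].

(** The eigenvalue equation in divergence form, multiplied by the area
   density, with [Z] in place of [lam * Y]. In this form it is linear in [Y]
   and [Z] together, and holds for sums over different eigenvalues; [y0] and
   [y1] are the two terms of the divergence. *)
Definition solves (Y Y0 Y1 Z : plane -> R) := exists y0 y1 : plane -> R,
  [/\ (forall q, D q -> has_deriv q (evec 0) (fun q => cond a f (t q) * Y0 q + a / 2 * Y1 q) (y0 q)),
      (forall q, D q -> has_deriv q (evec 1) (fun q => a / 2 * Y0 q + cocond a f (t q) * Y1 q) (y1 q)),
      continuous_in y0, continuous_in y1
    & forall q, D q -> y0 q + y1 q = - (pot a f (t q) * B (t q) * Y q + dens a f (t q) * Z q)].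

Lemma C1_in_sum n (c : 'I_n -> R) (X X0 X1 : 'I_n -> plane -> R) :
  (forall i, C1_in (X i) (X0 i) (X1 i)) ->
  C1_in (fun q => \sum_i c i * X i q) (fun q => \sum_i c i * X0 i q)
        (fun q => \sum_i c i * X1 i q).
Proof.
move=> h; split.
- move=> q Dq; apply: has_deriv_eq.
    by apply: pderive_sum => i; apply: pderiveM; [exact: pderiveC|have [+ _ _ _] := h i; exact].
  by apply: eq_bigr => i _; rewrite mul0r add0r.
- move=> q Dq; apply: has_deriv_eq.
    by apply: pderive_sum => i; apply: pderiveM; [exact: pderiveC|have [_ + _ _] := h i; exact].
  by apply: eq_bigr => i _; rewrite mul0r add0r.
- split; last split.
  + apply: continuous_sum => i; apply: continuous_mul; first exact: continuous_cst.
    by have [_ _ [cX _] _] := h i.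
  + apply: cin_sum => i; apply: cin_mul; first exact/cin_global/continuous_cst.
    by have [_ _ [_ [cX _]] _] := h i.
  + apply: cin_sum => i; apply: cin_mul; first exact/cin_global/continuous_cst.
    by have [_ _ [_ [_ cX]] _] := h i.
- by split; last split; move=> q; apply: eq_bigr => i _; have [_ _ _ [p [p0 p1]]] := h i;
    rewrite ?p ?p0 ?p1.
Qed.

Lemma solves_sum n (c : 'I_n -> R) (Y Y0 Y1 Z : 'I_n -> plane -> R) :
  (forall i, solves (Y i) (Y0 i) (Y1 i) (Z i)) ->
  solves (fun q => \sum_i c i * Y i q) (fun q => \sum_i c i * Y0 i q)
        (fun q => \sum_i c i * Y1 i q) (fun q => \sum_i c i * Z i q).
Proof.
move=> /choice[y0] /choice[y1] h.
have cc k : continuous_in (fun=> k) by exact/cin_global/continuous_cst.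
exists (fun q => \sum_i c i * y0 i q), (fun q => \sum_i c i * y1 i q); split.
- move=> q Dq.
  have -> : (fun q : plane => cond a f (t q) * (\sum_i c i * Y0 i q) + a / 2 * \sum_i c i * Y1 i q) =
     (fun q : plane => \sum_i c i * (cond a f (t q) * Y0 i q + a / 2 * Y1 i q)).
    by apply/funext => p; rewrite !mulr_sumr -big_split; apply: eq_bigr => i _ /=; ring.
  apply: has_deriv_eq.
    by apply: pderive_sum => i; apply: pderiveM; [exact: pderiveC|have [+ _ _ _ _] := h i; exact].
  by apply: eq_bigr => i _; rewrite mul0r add0r.
- move=> q Dq.
  have -> : (fun q : plane => a / 2 * (\sum_i c i * Y0 i q) + cocond a f (t q) * \sum_i c i * Y1 i q) =
     (fun q : plane => \sum_i c i * (a / 2 * Y0 i q + cocond a f (t q) * Y1 i q)).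
    by apply/funext => p; rewrite !mulr_sumr -big_split; apply: eq_bigr => i _ /=; ring.
  apply: has_deriv_eq.
    by apply: pderive_sum => i; apply: pderiveM; [exact: pderiveC|have [_ + _ _ _] := h i; exact].
  by apply: eq_bigr => i _; rewrite mul0r add0r.
- by apply: cin_sum => i; apply: cin_mul => //; have [_ _ + _ _] := h i.
- by apply: cin_sum => i; apply: cin_mul => //; have [_ _ _ + _] := h i.
move=> q Dq; rewrite -big_split /= !mulr_sumr -big_split -sumrN.
apply: eq_bigr => i _ /=; have [_ _ _ _ e] := h i.
by rewrite -mulrDr (e q Dq); ring.
Qed.

Section Green.
Variables (r dr0 dr1 : plane -> R).
Hypothesis (hr : C1_in r dr0 dr1).
Hypothesis (r_out : forall q, ~ D q -> r q = 0).

(** A continuous [r] that vanishes outside [D] is at most [del] near each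
   point outside [D]. Hence [g (r q) * F q] is zero there whatever the
   behaviour of [F] at the boundary. *)
Definition cutoff (g dg : R -> R) := exists2 del : R, 0 < del &
  [/\ (forall x : R, has_deriv x 1 g (dg x)), continuous dg
    & forall x, x <= del -> g x = 0 /\ dg x = 0].

Lemma cutoff_at0 g dg : cutoff g dg -> g 0 = 0 /\ dg 0 = 0.
Proof. by move=> [del /ltW d0 [_ _ h]]; exact: h. Qed.

Lemma cutoff_outside g dg q : cutoff g dg -> ~ D q -> g (r q) = 0 /\ dg (r q) = 0.
Proof. by move=> hg nD; rewrite r_out //; exact: cutoff_at0 hg. Qed.

Let cr : continuous r. Proof. by have [_ _ []] := hr. Qed.

Lemma cutoff_near0 g dg q : cutoff g dg -> ~ D q ->
  \forall y \near q, g (r y) = 0 /\ dg (r y) = 0.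
Proof.
move=> [del d0 [_ _ h]] nD.
have H : \forall y \near q, r y < del.
  have : \forall x \near r q, x < del.
    by rewrite (r_out nD); apply: (@near_lt _ id) => //; exact: continuous_ident.
  exact: cr.
by apply: filterS H => y /ltW; exact: h.
Qed.

Lemma cutoff_continuous g dg F : cutoff g dg -> continuous_in F ->
  continuous (fun q => g (r q) * F q).
Proof.
move=> hg cF q; have [Dq|nD] := pselect (D q).
  have [del _ [dg' _ _]] := hg.
  have cg : {for r q, continuous g} by apply: deriv_continuous (dg' _).
  have cgr : {for q, continuous (fun p => g (r p))}.
    by apply: continuous_comp; [exact: cr|exact: cg].
  exact: (cvgM cgr (cF q Dq)).
have E : \forall y \near q, 0 = g (r y) * F y.
  by apply: filterS (cutoff_near0 hg nD) => y [-> _]; rewrite mul0r.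
suff : g (r y) * F y @[y --> q] --> g (r q) * F q by [].
have [-> _] := cutoff_outside hg nD; rewrite mul0r.
by apply: (cvg_trans (near_eq_cvg E)); exact: cvg_cst.
Qed.

Lemma dcutoff_continuous g dg F : cutoff g dg -> continuous_in F ->
  continuous (fun q => dg (r q) * F q).
Proof.
move=> hg cF q; have [Dq|nD] := pselect (D q).
  have [del _ [_ cdg _]] := hg.
  have cgr : {for q, continuous (fun p => dg (r p))}.
    by apply: continuous_comp; [exact: cr|exact: cdg].
  exact: (cvgM cgr (cF q Dq)).
have E : \forall y \near q, 0 = dg (r y) * F y.
  by apply: filterS (cutoff_near0 hg nD) => y [_ ->]; rewrite mul0r.
suff : dg (r y) * F y @[y --> q] --> dg (r q) * F q by [].
have [_ ->] := cutoff_outside hg nD; rewrite mul0r.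
by apply: (cvg_trans (near_eq_cvg E)); exact: cvg_cst.
Qed.

Lemma cutoff_deriv g dg F q e dr dF : cutoff g dg ->
  (D q -> has_deriv q e r dr) -> (D q -> has_deriv q e F dF) ->
  has_deriv q e (fun q => g (r q) * F q) (dg (r q) * (dr * F q) + g (r q) * dF).
Proof.
move=> hg hdr hF; have [Dq|nD] := pselect (D q).
  have [del _ [dg' _ _]] := hg; apply: has_deriv_eq.
    apply: pderiveM; last exact: hF.
    by apply: (pderive_comp (g := g) (f := r)); [exact: dg'|exact: hdr].
  by rewrite mulrA.
have [-> ->] := cutoff_outside hg nD; rewrite !mul0r addr0.
apply: near_eq_deriv (pderiveC 0 q e).
by apply: filterS (cutoff_near0 hg nD) => y [-> _]; rewrite mul0r.
Qed.

Let edge (q : plane) : T <= `|t q| -> ~ D q.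
Proof. by move=> h /DT; rewrite ltNge h. Qed.

(** The divergence theorem for [g (r q) * X q] times the flux of [Y], a vector
   field that extends by zero outside [D]. *)
Lemma green g dg X X0 X1 Y Y0 Y1 Z : cutoff g dg ->
  C1_in X X0 X1 -> C1_in Y Y0 Y1 -> continuous Z -> solves Y Y0 Y1 Z ->
  int2 T (fun q => dg (r q) * (X q * bracket (t q) (dr0 q) (dr1 q) (Y0 q) (Y1 q))) +
  int2 T (fun q => g (r q) * bracket (t q) (X0 q) (X1 q) (Y0 q) (Y1 q)) =
  int2 T (fun q => g (r q) *
    (X q * (pot a f (t q) * B (t q) * Y q + dens a f (t q) * Z q))).
Proof.
move=> hg hX hY cZ [y0 [y1 [hy0 hy1 cy0 cy1 pde]]].
have [hX0 hX1 [cX [cX0 cX1]] [pX [pX0 pX1]]] := hX.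
have [hY0 hY1 [cY [cY0 cY1]] [pY [pY0 pY1]]] := hY.
have [hr0 hr1 [_ [cr0 cr1]] [pr [pr0 pr1]]] := hr.
have cXi := cin_global cX; have cYi := cin_global cY.
have cc k : continuous_in (fun=> k) by exact/cin_global/continuous_cst.
have cA := cin_global (continuous_height (continuous_cond hf)).
have cC := cin_global (continuous_height continuous_cocond).
have cB : continuous_in (fun q => B (t q)) := cin_global (continuous_height (continuous_B a0 hf)).
have cW := cin_global (continuous_height (continuous_pot a0 hf)).
have cw := cin_global (continuous_height (continuous_dens hf)).
pose F0 (q : plane) := cond a f (t q) * Y0 q + a / 2 * Y1 q.
pose F1 (q : plane) := a / 2 * Y0 q + cocond a f (t q) * Y1 q.
have cF0 : continuous_in F0 by apply: cin_add; apply: cin_mul.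
have cF1 : continuous_in F1 by apply: cin_add; apply: cin_mul.
pose P0 q := dg (r q) * (dr0 q * (X q * F0 q)) + g (r q) * (X0 q * F0 q + X q * y0 q).
pose Q1 q := dg (r q) * (dr1 q * (X q * F1 q)) + g (r q) * (X1 q * F1 q + X q * y1 q).
have cP0 : continuous P0.
  apply: continuous_add; [apply: (dcutoff_continuous hg)|apply: (cutoff_continuous hg)].
    by do 2 (apply: cin_mul => //).
  by apply: cin_add; apply: cin_mul.
have cQ1 : continuous Q1.
  apply: continuous_add; [apply: (dcutoff_continuous hg)|apply: (cutoff_continuous hg)].
    by do 2 (apply: cin_mul => //).
  by apply: cin_add; apply: cin_mul.
have cP : continuous (fun q => g (r q) * (X q * F0 q)).
  by apply: (cutoff_continuous hg); apply: cin_mul.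
have hP q : has_deriv q (evec 0) (fun q => g (r q) * (X q * F0 q)) (P0 q).
  apply: cutoff_deriv => // Dq; first exact: hr0.
  by apply: pderiveM; [exact: hX0|exact: hy0].
have hQ q : has_deriv q (evec 1) (fun q => g (r q) * (X q * F1 q)) (Q1 q).
  apply: cutoff_deriv => // Dq; first exact: hr1.
  by apply: pderiveM; [exact: hX1|exact: hy1].
have turn_t (q : plane) : t (q + turn) = t q by rewrite mxE turn0 addr0.
have PT (q : plane) : T <= `|t q| -> g (r q) * (X q * F0 q) = 0.
  by move=> /edge nD; have [-> _] := cutoff_outside hg nD; rewrite mul0r.
have perQ : periodic (fun q => g (r q) * (X q * F1 q)).
  by move=> q; rewrite /F1 pr pX pY0 pY1 turn_t.
have := divergence_theorem cP cP0 cQ1 hP hQ PT T0 perQ.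
have cI1 : continuous (fun q => dg (r q) * (X q * bracket (t q) (dr0 q) (dr1 q) (Y0 q) (Y1 q))).
  by apply: (dcutoff_continuous hg); apply: cin_mul => //; exact: cin_bracket.
have cI2 : continuous (fun q => g (r q) * bracket (t q) (X0 q) (X1 q) (Y0 q) (Y1 q)).
  by apply: (cutoff_continuous hg); exact: cin_bracket.
have cI3 : continuous (fun q => g (r q) *
    (X q * (pot a f (t q) * B (t q) * Y q + dens a f (t q) * Z q))).
  apply: (cutoff_continuous hg); apply: cin_mul => //; apply: cin_add.
    by apply: cin_mul => //; apply: cin_mul.
  by apply: cin_mul => //; exact: cin_global.
have cI12 : continuous (fun q => dg (r q) * (X q * bracket (t q) (dr0 q) (dr1 q) (Y0 q) (Y1 q)) +
  g (r q) * bracket (t q) (X0 q) (X1 q) (Y0 q) (Y1 q)) by exact: continuous_add.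
move=> E; apply/eqP; rewrite -subr_eq0 -int2D // -int2B //; apply/eqP; rewrite -[RHS]E.
apply: int2_ext => q; rewrite /P0 /Q1.
have [Dq|nD] := pselect (D q); last first.
  by have [-> ->] := cutoff_outside hg nD; rewrite !mul0r !addr0 subr0.
have := pde q Dq; rewrite /F0 /F1 /bracket.
move: (dg (r q)) (g (r q)) (X q) (X0 q) (X1 q) (Y q) (Y0 q) (Y1 q) (y0 q) (y1 q)
  (dr0 q) (dr1 q) (pot a f (t q)) (cond a f (t q)) (cocond a f (t q)) (dens a f (t q) * Z q).
move=> dgr gr x x0 x1 y yy0 yy1 z0 z1 e0 e1 W A C L h.
have -> : z1 = - (W / A * y + L) - z0 by rewrite -h; ring.
by ring.
Qed.

End Green.
End Domain.
End DivergenceForm.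

(** * Families of eigenfunctions with negative eigenvalues *)

Section Family.
Context {R : realType}.
Variables (a : R) (f : R -> R).
Hypotheses (a0 : 0 < a) (hf : catenoid_profile a f).
Local Notation plane := 'rV[R]_2.
Local Notation t q := (q 0 0).
Local Notation B s := ((cond a f s)^-1).
Variables (D : set plane) (T : R).
Hypotheses (T0 : 0 <= T) (DT : forall q : plane, D q -> `|t q| < T).
Variables (n : nat) (lam : 'I_n.+1 -> R) (u : 'I_n.+1 -> plane -> R).
Hypothesis eigen : forall j,
  dirichlet_eigenspace nil3_metric (revolution f) D (lam j) (u j).

Let d (i : 'I_2) j : plane -> R := partial i (u j).

Lemma derive_cocond (s : R) : has_deriv s 1 (cocond a f)
  (- (2 * (a ^+ 2 + 4) * f s * f1 f s) / (a * (f s ^+ 2 + 4) ^+ 2)).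
Proof.
rewrite /cocond; der ltac:(solve [exact: (derive_f hf)]).
  by rewrite mulf_neq0 ?f24_neq0 // gt_eqF.
by have := f24_neq0 f s; move: (f s) (f1 f s) => y y1 h; field; rewrite h gt_eqF.
Qed.

Lemma eigen_C1 j : C1_in D (u j) (d 0 j) (d 1 j).
Proof.
have [cu pu _ [_ C] _] := eigen j.
have [d0 [c0 _]] := C 0; have [d1 [c1 _]] := C 1.
split.
- by move=> q Dq; apply: derivableP; exact: d0.
- by move=> q Dq; apply: derivableP; exact: d1.
- by split; [exact: cu|split; [exact: c0|exact: c1]].
- by split; [exact: pu|split; exact: partial_periodic].
Qed.

Lemma eigen_solves j : solves a f D (u j) (d 0 j) (d 1 j) (fun q => lam j * u j q).
Proof.
have [cu pu _ [_ C] pde] := eigen j.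
have [_ [c0 C0]] := C 0; have [_ [c1 C1]] := C 1.
have [h00 [c00 _]] := C0 0; have [h10 [c10 _]] := C0 1.
have [h01 [c01 _]] := C1 0; have [h11 [c11 _]] := C1 1.
have cc k : continuous_in D (fun=> k) by exact/cin_global/continuous_cst.
have cA := cin_global (D := D) (continuous_height (continuous_cond hf)).
have cC := cin_global (D := D) (continuous_height (continuous_cocond a0 hf)).
have cA' : continuous_in D (fun q => a * f (t q) * f1 f (t q) / 2).
  apply: cin_global; apply: (continuous_height (g := fun s => a * f s * f1 f s / 2)).
  by cont ltac:(solve [exact: (continuous_f hf)|exact: (continuous_f1 hf)]).
exists (fun q : plane => a * f (t q) * f1 f (t q) / 2 * d 0 j q + cond a f (t q) * partial 0 (d 0 j) q
  + a / 2 * partial 0 (d 1 j) q),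
  (fun q : plane => a / 2 * partial 1 (d 0 j) q + cocond a f (t q) * partial 1 (d 1 j) q); split.
- move=> q Dq; apply: has_deriv_eq.
    apply: pderiveD; apply: pderiveM.
    + exact: height_deriv (derive_cond hf _).
    + by apply: derivableP; exact: h00.
    + exact: pderiveC.
    + by apply: derivableP; exact: h01.
  by rewrite /= mulr1 mul0r add0r.
- move=> q Dq; apply: has_deriv_eq.
    apply: pderiveD; apply: pderiveM.
    + exact: pderiveC.
    + by apply: derivableP; exact: h10.
    + by apply: height_deriv; exact: derive_cocond.
    + by apply: derivableP; exact: h11.
  by rewrite /= mul0r add0r mulr0 mul0r add0r.
- exact: (cin_add (cin_add (cin_mul cA' c0) (cin_mul cA c00)) (cin_mul (cc _) c01)).
- exact: (cin_add (cin_mul (cc _) c10) (cin_mul cC c11)).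
move=> q Dq; have := pde q Dq.
have [e00 e01 e10 e11] : [/\ has_deriv q (evec 0) (d 0 j) (partial 0 (d 0 j) q),
   has_deriv q (evec 0) (d 1 j) (partial 0 (d 1 j) q),
   has_deriv q (evec 1) (d 0 j) (partial 1 (d 0 j) q) &
   has_deriv q (evec 1) (d 1 j) (partial 1 (d 1 j) q)].
  by split; apply: derivableP; [exact: h00|exact: h01|exact: h10|exact: h11].
have N0 : \forall y \near q, partial 0 (u j) y = d 0 j y by near=> y.
have N1 : \forall y \near q, partial 1 (u j) y = d 1 j y by near=> y.
rewrite (jacobiE a0 hf N0 N1 e00 e01 e10 e11).
have w0 : dens a f (t q) != 0 by rewrite gt_eqF ?(dens_gt0 a0 hf).
have A0 := cond_neq0 f a0 (t q).
move: w0 A0; move: (a * f (t q) * f1 f (t q) / 2) (d 0 j q) (partial 0 (d 0 j) q) (partial 0 (d 1 j) q)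
  (partial 1 (d 0 j) q) (partial 1 (d 1 j) q) (u j q) (dens a f (t q)) (cond a f (t q))
  (cocond a f (t q)) (pot a f (t q)) (lam j).
move=> A' x0 x00 x01 x10 x11 x w A CC W l w0 A0 E.
have -> : W / A * x + w * (l * x) = w * (l * x + W / (A * w) * x).
  by field; rewrite w0 A0.
rewrite -E; field; by rewrite w0 A0.
Unshelve. all: by end_near. Qed.

(** A cutoff of [mass] serves all the [u j] at once: this function is of class
   C^1 in [D], zero outside, and dominates the products [u i * u j]. *)
Definition mass q : R := \sum_j u j q ^+ 2.
Definition dmass i q : R := \sum_j (2 * u j q) * d i j q.

Lemma mass_C1 : C1_in D mass (dmass 0) (dmass 1).
Proof.
have hd i j q : D q -> has_deriv q (evec i) (u j) (d i j q).
  have [h0 h1 _ _] := eigen_C1 j => Dq.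
  by elim/ord2_ind: i; [exact: h0|exact: h1].
have h i : forall q, D q -> has_deriv q (evec i) mass (dmass i q).
  move=> q Dq; apply: has_deriv_eq.
    by apply: pderive_sum => j; apply: pderiveX; exact: (hd i j q Dq).
  by apply: eq_bigr => j _; rewrite /= expr1; ring.
have c2 (k : R) : continuous_in D (fun=> k) by exact/cin_global/continuous_cst.
have cu j : continuous_in D (u j).
  by apply: cin_global; have [_ _ []] := eigen_C1 j.
split; [exact: h|exact: h| |].
- split; last split.
  + apply: continuous_sum => j; apply: continuous_expn.
    by have [_ _ []] := eigen_C1 j.
  + apply: cin_sum => j; apply: cin_mul; first exact: cin_mul.
    by have [_ _ [_ []]] := eigen_C1 j.
  + apply: cin_sum => j; apply: cin_mul; first exact: cin_mul.
    by have [_ _ [_ []]] := eigen_C1 j.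
- by split; last split; move=> q; apply: eq_bigr => j _; have [_ _ _ [p [p0 p1]]] := eigen_C1 j;
    rewrite p ?p0 ?p1.
Qed.

Lemma mass_out q : ~ D q -> mass q = 0.
Proof.
move=> nD; rewrite /mass big1 // => j _; have [_ _ h _ _] := eigen j.
by rewrite h // expr0n.
Qed.

Lemma mass_ge0 q : 0 <= mass q.
Proof. by apply: sumr_ge0 => j _; exact: sqr_ge0. Qed.

Lemma prod_le_mass i j (q : plane) : `|u i q * u j q| <= mass q.
Proof.
have le k : u k q ^+ 2 <= mass q.
  by rewrite /mass (bigD1 k) //= lerDl sumr_ge0 // => l _; exact: sqr_ge0.
have := le i; have := le j; have := sqr_ge0 (u i q - u j q); have := sqr_ge0 (u i q + u j q).
move: (u i q) (u j q) (mass q) => x y m h1 h2 h3 h4.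
by rewrite ler_norml; apply/andP; split; lra.
Qed.

Local Notation br q i j := (bracket a f (t q) (d 0 i q) (d 1 i q) (d 0 j q) (d 1 j q)).
Local Notation N := (n.+1%:R : R).

Definition grad (q : plane) : R := \sum_j br q j j.

Lemma grad_ge0 (q : plane) : 0 <= grad q.
Proof. by apply: sumr_ge0 => j _; exact: bracket_ge0. Qed.

Lemma bracket_le_grad i j (q : plane) : `|br q i j| <= grad q.
Proof.
have le k : br q k k <= grad q.
  by rewrite /grad (bigD1 k) //= lerDl sumr_ge0 // => l _; exact: bracket_ge0.
have b := bracket_le f a0 (t q) (d 0 i q) (d 1 i q) (d 0 j q) (d 1 j q).
by apply: (le_trans b); have := le i; have := le j; lra.
Qed.

Lemma sum_const_le (F : 'I_n.+1 -> R) c : (forall i, `|F i| <= c) -> `|\sum_i F i| <= N * c.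
Proof.
move=> h; apply: (le_trans (ler_norm_sum _ _ _)).
apply: (le_trans (ler_sum _ (fun i _ => h i))).
by rewrite sumr_const card_ord mulr_natl.
Qed.

Lemma bracket_dmass_le i j (q : plane) :
  `|u i q * bracket a f (t q) (dmass 0 q) (dmass 1 q) (d 0 j q) (d 1 j q)| <=
  N * 2 * (mass q * grad q).
Proof.
rewrite /dmass bracket_suml mulr_sumr -mulrA; apply: sum_const_le => k.
rewrite (_ : u i q * (2 * u k q * _) = 2 * ((u i q * u k q) * br q k j)); last by ring.
rewrite normrM ger0_norm // ler_pM2l // normrM.
by apply: ler_pM; [exact: normr_ge0|exact: normr_ge0|exact: prod_le_mass|exact: bracket_le_grad].
Qed.

Lemma bracket_dmass2_le (q : plane) :
  `|bracket a f (t q) (dmass 0 q) (dmass 1 q) (dmass 0 q) (dmass 1 q)| <=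
  N * (N * (4 * (mass q * grad q))).
Proof.
rewrite {1 2}/dmass bracket_suml; apply: sum_const_le => k.
rewrite bracketC /dmass bracket_suml mulr_sumr; apply: sum_const_le => l.
rewrite (_ : 2 * u k q * (2 * u l q * _) = 4 * ((u k q * u l q) * br q l k)); last by ring.
rewrite normrM ger0_norm // ler_pM2l // normrM.
by apply: ler_pM; [exact: normr_ge0|exact: normr_ge0|exact: prod_le_mass|exact: bracket_le_grad].
Qed.

Hypothesis lam_neg : forall j, lam j < 0.

Let cD k : continuous_in D (fun=> k).
Proof. exact/cin_global/continuous_cst. Qed.

Let cu j : continuous (u j).
Proof. by have [_ _ []] := eigen_C1 j. Qed.

Let cmass : continuous mass.
Proof. by have [_ _ []] := mass_C1. Qed.

Let cdens : continuous (fun q : plane => dens a f (t q)).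
Proof. exact: (continuous_height (continuous_dens hf)). Qed.

Let cpB : continuous (fun q : plane => pot a f (t q) * B (t q)).
Proof.
apply: continuous_mul; first exact: (continuous_height (continuous_pot a0 hf)).
exact: (continuous_height (continuous_B a0 hf)).
Qed.

Let cbr i j : continuous_in D (fun q => br q i j).
Proof.
have [_ _ [_ [c0 c1]] _] := eigen_C1 i; have [_ _ [_ [c2 c3]] _] := eigen_C1 j.
exact: cin_bracket.
Qed.

Let cgrad : continuous_in D grad.
Proof. by apply: cin_sum => j; exact: cbr. Qed.

Let cdmass j : continuous_in D
  (fun q => u j q * bracket a f (t q) (dmass 0 q) (dmass 1 q) (d 0 j q) (d 1 j q)).
Proof.
have [_ _ [_ [c0 c1]] _] := eigen_C1 j; have [_ _ [_ [c2 c3]] _] := mass_C1.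
by apply: cin_mul; [exact: cin_global|exact: cin_bracket].
Qed.

Definition potential_mass : R := int2 T (fun q => pot a f (t q) * B (t q) * mass q).
Definition total_mass : R := int2 T (fun q => dens a f (t q) * (1 + mass q)).

Lemma potential_mass_ge0 : 0 <= potential_mass.
Proof.
apply: int2_ge0 => //; first exact: continuous_mul.
move=> q; rewrite mulr_ge0 ?mass_ge0 // mulr_ge0 ?invr_ge0 ?(ltW (cond_gt0 f a0 _)) //.
by rewrite (le_trans (sqr_ge0 a)) // (pot_ge a0 hf).
Qed.

Lemma total_mass_ge0 : 0 <= total_mass.
Proof.
apply: int2_ge0 => //.
  by apply: continuous_mul => //; apply: continuous_add => //; exact: continuous_cst.
move=> q; rewrite mulr_ge0 ?addr_ge0 ?mass_ge0 //.
by rewrite ltW // (dens_gt0 a0 hf).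
Qed.

Let clam j : continuous (fun q => lam j * u j q).
Proof. by apply: continuous_mul; [exact: continuous_cst|exact: cu]. Qed.

Let cpde i j : continuous (fun q : plane =>
  u i q * (pot a f (t q) * B (t q) * u j q + dens a f (t q) * (lam j * u j q))).
Proof.
apply: continuous_mul; first exact: cu.
apply: continuous_add; first by apply: continuous_mul; [exact: cpB|exact: cu].
by apply: continuous_mul; [exact: cdens|exact: clam].
Qed.

(** Sum over [j] of Green's identities with [X = Y = u j]. The cutoff term has
   a sign because [g] is nondecreasing, the eigenvalue term because the
   eigenvalues are negative. The bound is thus the same for all cutoffs. *)
Lemma grad_bound g dg : cutoff g dg -> (forall x, 0 <= g x <= 1) -> (forall x, 0 <= dg x) ->
  int2 T (fun q => g (mass q) * grad q) <= potential_mass.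
Proof.
move=> hg g01 dg0.
pose I1 j q := dg (mass q) * (u j q * bracket a f (t q) (dmass 0 q) (dmass 1 q) (d 0 j q) (d 1 j q)).
pose I2 j q := g (mass q) * br q j j.
pose I3 j q := g (mass q) * (u j q * (pot a f (t q) * B (t q) * u j q + dens a f (t q) * (lam j * u j q))).
have cI1 j : continuous (I1 j) by exact: (dcutoff_continuous mass_C1 mass_out hg).
have cI2 j : continuous (I2 j) by exact: (cutoff_continuous mass_C1 mass_out hg).
have cI3 j : continuous (I3 j).
  apply: (cutoff_continuous mass_C1 mass_out hg); apply: cin_global.
  exact: cpde.
have G j : int2 T (I2 j) = int2 T (I3 j) - int2 T (I1 j).
  have cZ : continuous (fun q => lam j * u j q).
    by apply: continuous_mul => //; exact: continuous_cst.
  have := @green R a f a0 hf D T T0 DT mass (dmass 0) (dmass 1) mass_C1 mass_out g dg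
    (u j) (d 0 j) (d 1 j) (u j) (d 0 j) (d 1 j) _ hg (eigen_C1 j) (eigen_C1 j) cZ (eigen_solves j).
  by rewrite -/(I1 j) -/(I2 j) -/(I3 j) => <-; rewrite addrC addKr.
have -> : int2 T (fun q => g (mass q) * grad q) = int2 T (fun q => \sum_j (I3 j q - I1 j q)).
  transitivity (int2 T (fun q => \sum_j I2 j q)).
    by apply: int2_ext => q; rewrite /grad mulr_sumr.
  rewrite int2_sum //.
  have -> : int2 T (fun q => \sum_j (I3 j q - I1 j q)) = \sum_j int2 T (fun q => I3 j q - I1 j q).
    by apply: int2_sum => j; apply: continuous_add => //; exact: continuous_opp.
  by apply: eq_bigr => j _; rewrite G int2B.
apply: le_int2 => //.
- by apply: continuous_sum => j; apply: continuous_add => //; exact: continuous_opp.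
- exact: continuous_mul.
move=> q; rewrite sumrB.
have h1 : 0 <= \sum_j I1 j q.
  rewrite /I1 -mulr_sumr mulr_ge0 //.
  have E : \sum_j u j q * bracket a f (t q) (dmass 0 q) (dmass 1 q) (d 0 j q) (d 1 j q) =
      bracket a f (t q) (dmass 0 q) (dmass 1 q) (dmass 0 q) (dmass 1 q) / 2.
    have E := bracket_suml a f (t q) (fun j => 2 * u j q) (fun j => d 0 j q) (fun j => d 1 j q)
      (dmass 0 q) (dmass 1 q).
    rewrite -/(dmass 0 q) -/(dmass 1 q) in E; rewrite E mulr_suml.
    by apply: eq_bigr => j _; rewrite bracketC; move: (bracket _ _ _ _ _ _ _) => b; field.
  by rewrite E divr_ge0 ?bracket_ge0.
have p0 : 0 <= pot a f (t q) * B (t q).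
  rewrite mulr_ge0 ?invr_ge0 ?(ltW (cond_gt0 f a0 _)) //.
  by rewrite (le_trans (sqr_ge0 a)) // (pot_ge a0 hf).
have /andP[g0 g1] := g01 (mass q).
have h3 : \sum_j I3 j q <= pot a f (t q) * B (t q) * mass q.
  apply: (@le_trans _ _ (g (mass q) * (pot a f (t q) * B (t q) * mass q))); last first.
    by rewrite ler_piMl // mulr_ge0 // mass_ge0.
  have Em : pot a f (t q) * B (t q) * mass q = \sum_j pot a f (t q) * B (t q) * u j q ^+ 2.
    by rewrite /mass mulr_sumr.
  rewrite /I3 -mulr_sumr Em ler_wpM2l //.
  apply: ler_sum => j _; have w0 := dens_gt0 a0 hf (t q).
  have : dens a f (t q) * - lam j * u j q ^+ 2 >= 0.
    by rewrite mulr_ge0 ?sqr_ge0 // mulr_ge0 ?oppr_ge0 ?(ltW (lam_neg j)) // ltW.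
  move: (dens a f (t q)) (lam j) (u j q) (pot a f (t q) * B (t q)) => w l x p.
  by lra.
by rewrite lerBlDr (le_trans h3) // lerDl.
Qed.

Lemma cut_cutoff (kap del : R) : 0 < kap -> 0 < del -> cutoff (cut kap del) (dcut kap del).
Proof.
move=> k0 d0; exists del => //; split; [exact: derive_cut|exact: continuous_dcut|].
by move=> x; exact: cut_small.
Qed.

Section Estimates.
Variables (kap del : R).
Hypotheses (kap0 : 0 < kap) (del0 : 0 < del).

Let g := cut 1 (del * expR (-1)).
Let hg : cutoff g (dcut 1 (del * expR (-1))).
Proof. by apply: cut_cutoff => //; rewrite mulr_gt0 ?expR_gt0. Qed.
Let cg : continuous (fun q => g (mass q) * grad q).
Proof. exact: (cutoff_continuous mass_C1 mass_out hg). Qed.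

Let g_bound : int2 T (fun q => g (mass q) * grad q) <= potential_mass.
Proof.
apply: (grad_bound hg); first by move=> x; exact: cut_bounds.
by move=> x; apply: dcut_ge0 => //; rewrite mulr_gt0 ?expR_gt0.
Qed.

Let g_ge0 q : 0 <= g (mass q).
Proof. by have /andP[] := cut_bounds 1 (del * expR (-1)) (mass q). Qed.

(** [dcut_le] trades the derivative of the cutoff for the factor [kap] and
   another cutoff, to which [grad_bound] applies. All error terms of the
   cut-off integrations by parts are of this kind, or quadratic as in
   [dcut2_int_le]. *)
Lemma dcut_int_le (F : plane -> R) C : continuous_in D F -> 0 <= C ->
  (forall q, D q -> `|F q| <= C * (mass q * grad q)) ->
  `|int2 T (fun q => dcut kap del (mass q) * F q)| <= 2 * kap * C * potential_mass.
Proof.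
move=> cF C0 hF; have hc := cut_cutoff kap0 del0.
have k0 : 0 <= 2 * kap * C by rewrite !mulr_ge0 // ltW.
apply: (@le_trans _ _ (int2 T (fun q => 2 * kap * C * (g (mass q) * grad q)))); last first.
  by rewrite int2Z // ler_wpM2l.
apply: int2_norm_le => //.
- exact: (dcutoff_continuous mass_C1 mass_out hc).
- by apply: continuous_mul => //; exact: continuous_cst.
move=> q; have [Dq|nD] := pselect (D q); last first.
  have [_ ->] := cutoff_outside mass_out hc nD; have [-> _] := cutoff_outside mass_out hg nD.
  by rewrite !mul0r mulr0 normr0.
rewrite normrM (ger0_norm (dcut_ge0 kap0 del0 _)).
apply: (le_trans (ler_wpM2l (dcut_ge0 kap0 del0 _) (hF q Dq))).
have h := dcut_le (mass q) kap0 del0; have e0 := grad_ge0 q.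
have := ler_wpM2l (mulr_ge0 C0 e0) h; rewrite -/g.
by move: (g (mass q)) (dcut kap del (mass q)) (grad q) (mass q) => gg dc e m; lra.
Qed.

Lemma dcut2_int_le (F : plane -> R) C : continuous_in D F -> 0 <= C ->
  (forall q, D q -> `|F q| <= C * (mass q * (mass q * grad q))) ->
  `|int2 T (fun q => dcut kap del (mass q) * (dcut kap del (mass q) * F q))|
     <= 4 * kap ^+ 2 * C * potential_mass.
Proof.
move=> cF C0 hF; have hc := cut_cutoff kap0 del0.
have k0 : 0 <= 4 * kap ^+ 2 * C.
  by apply: mulr_ge0 C0; apply: mulr_ge0; [exact: ler0n|exact: sqr_ge0].
apply: (@le_trans _ _ (int2 T (fun q => 4 * kap ^+ 2 * C * (g (mass q) * grad q)))); last first.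
  by rewrite int2Z // ler_wpM2l.
apply: int2_norm_le => //.
- apply: (dcutoff_continuous mass_C1 mass_out hc); apply: cin_global.
  exact: (dcutoff_continuous mass_C1 mass_out hc).
- by apply: continuous_mul => //; exact: continuous_cst.
move=> q; have [Dq|nD] := pselect (D q); last first.
  have [_ ->] := cutoff_outside mass_out hc nD; have [-> _] := cutoff_outside mass_out hg nD.
  by rewrite !mul0r mulr0 normr0.
have d0 := dcut_ge0 kap0 del0 (mass q).
rewrite mulrA normrM (ger0_norm (mulr_ge0 d0 d0)).
apply: (le_trans (ler_wpM2l (mulr_ge0 d0 d0) (hF q Dq))).
have h := dcut_le (mass q) kap0 del0; have e0 := grad_ge0 q.
have m0 := mass_ge0 q; have gg0 := g_ge0 q.
have /andP[_ g1] := cut_bounds 1 (del * expR (-1)) (mass q).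
rewrite -/g in h g1.
have h2 : (mass q * dcut kap del (mass q)) ^+ 2 <= 4 * kap ^+ 2 * g (mass q).
  apply: (@le_trans _ _ ((2 * kap * g (mass q)) ^+ 2)).
    have h20 : 0 <= 2 * kap by rewrite mulr_ge0 // ltW.
    by rewrite lerXn2r ?nnegrE ?(mulr_ge0 m0 d0) ?(mulr_ge0 h20 gg0).
  have k2 : 0 <= 4 * kap ^+ 2 by apply: mulr_ge0; [exact: ler0n|exact: sqr_ge0].
  move: gg0 g1; move: (g (mass q)) => G G0 G1.
  rewrite (_ : (2 * kap * G) ^+ 2 = 4 * kap ^+ 2 * G ^+ 2); last by ring.
  by rewrite ler_wpM2l // expr2 ler_piMl.
have := ler_wpM2l (mulr_ge0 C0 e0) h2.
by move: (g (mass q)) (dcut kap del (mass q)) (grad q) (mass q) => gg dc e m; lra.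
Qed.

End Estimates.

Lemma exhaust_int_le (h : R -> R) e (F : plane -> R) C : continuous h -> (forall x, 0 <= h x <= 1) ->
  0 <= e -> (forall x, 0 <= x -> (1 - h x) * x <= e * (1 + x)) ->
  continuous F -> 0 <= C -> (forall q, `|F q| <= C * mass q) ->
  `|int2 T (fun q => dens a f (t q) * F q) -
    int2 T (fun q => h (mass q) * (dens a f (t q) * F q))| <= e * C * total_mass.
Proof.
move=> ch h01 e0 he cF C0 hF.
have chm : continuous (fun q : plane => h (mass q)) by exact: (continuous_after ch cmass).
have c1 : continuous (fun q : plane => dens a f (t q) * F q) by exact: continuous_mul.
have c2 : continuous (fun q : plane => h (mass q) * (dens a f (t q) * F q)) by exact: continuous_mul.
have c3 : continuous (fun q : plane => dens a f (t q) * (1 + mass q)).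
  by apply: continuous_mul => //; apply: continuous_add => //; exact: continuous_cst.
rewrite -int2B // -int2Z //; apply: int2_norm_le => //.
- by apply: continuous_add => //; exact: continuous_opp.
- by apply: continuous_mul => //; exact: continuous_cst.
move=> q; have w0 := dens_gt0 a0 hf (t q); have /andP[_ h1] := h01 (mass q).
have hm := he _ (mass_ge0 q).
rewrite (_ : _ - _ = dens a f (t q) * ((1 - h (mass q)) * F q)); last by ring.
rewrite normrM (gtr0_norm w0) normrM ger0_norm ?subr_ge0 //.
rewrite [leRHS]mulrCA ler_pM2l //.
have s0 : 0 <= 1 - h (mass q) by rewrite subr_ge0.
apply: (le_trans (ler_wpM2l s0 (hF q))).
have := ler_wpM2l C0 hm.
by move: (h (mass q)) (mass q) => hh m; lra.
Qed.

Definition gram i j : R := int2 T (fun q => dens a f (t q) * (u i q * u j q)).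

Let green_eigen i j g dg (hg : cutoff g dg) :
  int2 T (fun q => dg (mass q) *
    (u i q * bracket a f (t q) (dmass 0 q) (dmass 1 q) (d 0 j q) (d 1 j q))) +
  int2 T (fun q => g (mass q) * br q i j) =
  int2 T (fun q => g (mass q) *
    (u i q * (pot a f (t q) * B (t q) * u j q + dens a f (t q) * (lam j * u j q)))).
Proof.
apply: (@green R a f a0 hf D T T0 DT mass (dmass 0) (dmass 1) mass_C1 mass_out g dg
    (u i) (d 0 i) (d 1 i) (u j) (d 0 j) (d 1 j) _ hg (eigen_C1 i) (eigen_C1 j)).
  by apply: continuous_mul => //; exact: continuous_cst.
exact: eigen_solves.
Qed.

(** The Jacobi operator is symmetric: Green's identities for [(i, j)] and for
   [(j, i)] give [(lam j - lam i) * gram i j = 0] up to errors of the order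
   of [e]. *)
Lemma gram_orth i j : lam i <> lam j -> gram i j = 0.
Proof.
move=> /eqP lij; have lij0 : 0 < `|lam j - lam i| by rewrite normr_gt0 subr_eq0 eq_sym.
pose C := 8 * N * potential_mass + `|lam j - lam i| * total_mass.
have C0 : 0 <= C.
  by rewrite addr_ge0 ?mulr_ge0 ?potential_mass_ge0 ?total_mass_ge0 ?normr_ge0 ?ler0n.
have key e : 0 < e -> `|lam j - lam i| * `|gram i j| <= e * C.
  move=> e0; have [kap [del [/andP[k0 ke] d0 hcut]]] := cut_exhausts e0.
  have hg := cut_cutoff k0 d0; pose g := cut kap del; pose dg := dcut kap del.
  pose J i j := int2 T (fun q => dg (mass q) *
    (u i q * bracket a f (t q) (dmass 0 q) (dmass 1 q) (d 0 j q) (d 1 j q))).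
  have hJ i' j' : `|J i' j'| <= 2 * kap * (N * 2) * potential_mass.
    apply: (dcut_int_le k0 d0).
    - have [_ _ [_ [c0 c1]] _] := eigen_C1 j'; have [_ _ [_ [c2 c3]] _] := mass_C1.
      by apply: cin_mul; [exact: cin_global|exact: cin_bracket].
    - by rewrite mulr_ge0 ?ler0n.
    - by move=> q _; exact: bracket_dmass_le.
  have cF : continuous (fun q : plane => u i q * u j q) by exact: continuous_mul.
  have cg : continuous g by exact: (continuous_cut k0 d0).
  have cI : continuous (fun q => g (mass q) * (dens a f (t q) * (u i q * u j q))).
    by apply: continuous_mul; [exact: (continuous_after cg cmass)|exact: continuous_mul].
  have E : (lam j - lam i) * int2 T (fun q => g (mass q) * (dens a f (t q) * (u i q * u j q)))
      = J i j - J j i.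
    pose Q i j := int2 T (fun q => g (mass q) * br q i j).
    pose K i j := int2 T (fun q => g (mass q) *
        (u i q * (pot a f (t q) * B (t q) * u j q + dens a f (t q) * (lam j * u j q)))).
    have ge i' j' : J i' j' + Q i' j' = K i' j' by exact: green_eigen hg.
    have e3 : Q i j = Q j i by apply: int2_ext => q; rewrite bracketC.
    have cK i' j' : continuous (fun q : plane => g (mass q) *
        (u i' q * (pot a f (t q) * B (t q) * u j' q + dens a f (t q) * (lam j' * u j' q)))).
      by apply: continuous_mul; [exact: (continuous_after cg cmass)|exact: cpde].
    have e4 : (lam j - lam i) * int2 T (fun q => g (mass q) * (dens a f (t q) * (u i q * u j q))) =
      K i j - K j i.
      rewrite -(int2Z _ _ cI) -(int2B _ (cK i j) (cK j i)); apply: int2_ext => q.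
      by move: (g (mass q)) (u i q) (u j q) (pot a f (t q)) (cond a f (t q)) (dens a f (t q)) =>
        gg x y W A w; ring.
    rewrite e4 -!ge e3; move: (J i j) (J j i) (Q j i) => x y z; ring.
  have h01 x : 0 <= g x <= 1 by exact: cut_bounds.
  have hF q : `|u i q * u j q| <= 1 * mass q by rewrite mul1r; exact: prod_le_mass.
  have X := exhaust_int_le cg h01 (ltW e0) hcut cF ler01 hF.
  rewrite -/(gram i j) in X.
  set I := int2 T _ in E X.
  have b1 : `|(lam j - lam i) * I| <= e * (8 * N * potential_mass).
    rewrite E; apply: (le_trans (ler_normB _ _)).
    apply: (le_trans (lerD (hJ i j) (hJ j i))).
    rewrite (_ : _ + _ = kap * (8 * N * potential_mass)); last first.
      by move: potential_mass => M; ring.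
    by rewrite ler_wpM2r // !mulr_ge0 ?ler0n ?potential_mass_ge0.
  rewrite normrM in b1.
  have b2 : `|gram i j| <= `|I| + e * total_mass.
    have := ler_normD I (gram i j - I); rewrite addrCA subrr addr0 => h.
    by apply: (le_trans h); rewrite lerD2l; move: X; rewrite mulr1.
  apply: (le_trans (ler_wpM2l (ltW lij0) b2)).
  rewrite mulrDr (_ : e * C = e * (8 * N * potential_mass) + `|lam j - lam i| * (e * total_mass)).
    by rewrite lerD2r.
  by rewrite /C; move: `|_| potential_mass total_mass => l p m; ring.
have G0 : `|lam j - lam i| * `|gram i j| <= 0.
  apply/ler_addgt0Pr => eta eta0; rewrite add0r.
  apply: (le_trans (key (eta / (C + 1)) _)); first by rewrite divr_gt0 // ltr_wpDl.
  by rewrite mulrAC ler_pdivrMr ?ltr_wpDl // ler_pM2l // lerDl.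
apply/eqP; rewrite -normr_eq0 eq_le normr_ge0 andbT.
by move: G0; rewrite pmulr_rle0.
Qed.

Section Energy.
Variables (c : 'I_n.+1 -> R) (K : nat).
Hypothesis c1 : \sum_i c i ^+ 2 = 1.
Hypotheses (K_le : K%:R <= Num.sqrt (a ^+ 2 + 2)) (lt_K : Num.sqrt (a ^+ 2 + 2) < K.+1%:R).

Definition combination q : R := \sum_i c i * u i q.
Definition combination_eq q : R := \sum_i c i * (lam i * u i q).
Definition dcombination k q : R := \sum_i c i * d k i q.

Lemma coef_le1 i : `|c i| <= 1.
Proof.
rewrite -(@ler_pXn2r _ 2) ?nnegrE // expr1n real_normK ?num_real // -c1 (bigD1 i) //= lerDl.
by apply: sumr_ge0 => j _; exact: sqr_ge0.
Qed.

Lemma coef2_le i j (x m : R) : `|x| <= m -> `|c i * c j * x| <= m.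
Proof.
move=> h; apply: le_trans h; rewrite normrM ler_piMl // normrM.
by rewrite -[leRHS](mulr1 1) ler_pM ?coef_le1.
Qed.

Lemma combination_sqr_le (q : plane) : `|combination q * combination q| <= N * (N * mass q).
Proof.
rewrite {1}/combination mulr_suml; apply: sum_const_le => i.
rewrite /combination mulr_sumr; apply: sum_const_le => j.
rewrite (_ : _ * _ = c i * c j * (u i q * u j q)); last by ring.
by apply: coef2_le; exact: prod_le_mass.
Qed.

Let Lam : R := \sum_j `|lam j|.

Lemma combination_eq_le (q : plane) : `|combination q * combination_eq q| <= N * (N * Lam) * mass q.
Proof.
rewrite -!mulrA /combination mulr_suml; apply: sum_const_le => i.
rewrite /combination_eq mulr_sumr; apply: sum_const_le => j.
rewrite (_ : _ * _ = c i * c j * (lam j * (u i q * u j q))); last by ring.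
apply: coef2_le; rewrite normrM ler_pM ?prod_le_mass //.
by rewrite /Lam (bigD1 j) //= lerDl; apply: sumr_ge0.
Qed.

Let hX : C1_in D combination (dcombination 0) (dcombination 1).
Proof. by apply: C1_in_sum => i; exact: eigen_C1. Qed.

Let hZ : solves a f D combination (dcombination 0) (dcombination 1) combination_eq.
Proof. by apply: solves_sum => i; exact: eigen_solves. Qed.

Let cX : continuous combination. Proof. by have [_ _ []] := hX. Qed.

Let cZ : continuous combination_eq.
Proof.
by apply: continuous_sum => i; apply: continuous_mul; [exact: continuous_cst|exact: clam].
Qed.

Lemma energy_arith (ia ie i e p m l k : R) : 0 <= ia + ie -> `|ia| <= k ->
  k <= e * (16 * N ^+ 4 * p) -> `|i - ie| <= 2 * e * l * m ->
  - e * (16 * N ^+ 4 * p + 2 * l * m) <= i.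
Proof.
move: (N ^+ 4) => n4; rewrite !ler_norml => h1 /andP[_ h2] h3 /andP[h4 _].
by lra.
Qed.

(** The index form of the cut-off combination [w] is nonnegative. By Green's
   identity with the cutoff [g ^ 2], it is the sum of the integrals of [Ia],
   an error in which the cutoff is differentiated, and of [Ie], the
   expression to be estimated under the cutoff. *)
Lemma energy_ge kap del e : 0 < kap -> kap <= e -> e <= 1 -> 0 < del ->
  (forall r, 0 <= r -> (1 - cut kap del r) * r <= e * (1 + r)) ->
  (forall j, (j < (2 * K).+1)%N ->
    defint 0 (2 * pi) (fun th => cut kap del (mass (pt 0 th)) * combination (pt 0 th) * trig j th) = 0) ->
  - e * (16 * N ^+ 4 * potential_mass + 2 * (N * (N * Lam)) * total_mass) <=
  int2 T (fun q => dens a f (t q) * (combination q * combination_eq q)).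
Proof.
move=> k0 ke e1 d0 hcut orth; have hg := cut_cutoff k0 d0.
set g := cut kap del in hg hcut orth *; set dg := dcut kap del in hg *.
pose X := combination; pose Z := combination_eq.
pose X0 := dcombination 0; pose X1 := dcombination 1.
have [dX0 dX1 [_ [cX0 cX1]] [pX [pX0 pX1]]] := hX.
have [dm0 dm1 [_ [cm0 cm1]] [pm [pm0 pm1]]] := mass_C1.
have cXi := cin_global (D := D) cX.
have cg : continuous g by exact: continuous_cut.
have cgm : continuous (fun q => g (mass q)) by exact: (continuous_after cg cmass).
have g01 x : 0 <= g x <= 1 by exact: cut_bounds.
pose w q := g (mass q) * X q.
pose w0 q := dg (mass q) * (dmass 0 q * X q) + g (mass q) * X0 q.
pose w1 q := dg (mass q) * (dmass 1 q * X q) + g (mass q) * X1 q.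
have hw0 q : has_deriv q (evec 0) w (w0 q).
  by apply: (cutoff_deriv mass_C1 mass_out hg) => Dq; [exact: dm0|exact: dX0].
have hw1 q : has_deriv q (evec 1) w (w1 q).
  by apply: (cutoff_deriv mass_C1 mass_out hg) => Dq; [exact: dm1|exact: dX1].
have cw : continuous w by exact: (continuous_mul cgm cX).
have cw0 : continuous w0.
  exact: (continuous_add (dcutoff_continuous mass_C1 mass_out hg (cin_mul cm0 cXi))
    (cutoff_continuous mass_C1 mass_out hg cX0)).
have cw1 : continuous w1.
  exact: (continuous_add (dcutoff_continuous mass_C1 mass_out hg (cin_mul cm1 cXi))
    (cutoff_continuous mass_C1 mass_out hg cX1)).
have qX : periodic X := pX; have qX0 : periodic X0 := pX0; have qX1 : periodic X1 := pX1.
have pw : periodic w by move=> q; rewrite /w pm qX.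
have pw0 : periodic w0 by move=> q; rewrite /w0 pm pm0 qX qX0.
have pw1 : periodic w1 by move=> q; rewrite /w1 pm pm1 qX qX1.
have wT (q : plane) : T <= `|t q| -> w q = 0.
  move=> h; have nD : ~ D q by move/DT; rewrite ltNge h.
  by have [e0 _] := cutoff_outside mass_out hg nD; rewrite /w e0 mul0r.
have F0 := index_form_ge0 a0 hf hw0 hw1 cw cw0 cw1 pw pw0 pw1 T0 wT K_le lt_K orth.
pose g2 x := g x * g x; pose dg2 x := 2 * (g x * dg x).
have hg2 : cutoff g2 dg2.
  have [dl dl0 [hd cd hs]] := hg; exists dl => //; split.
  - move=> x; apply: has_deriv_eq; first by apply: pderiveM; exact: hd.
    by rewrite /dg2; ring.
  - apply: continuous_mul; first exact: continuous_cst.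
    by apply: continuous_mul; [exact: cg|exact: cd].
  - by move=> x /hs[gx dgx]; rewrite /g2 /dg2 gx dgx !mulr0.
pose F1 q := X q * X q * bracket a f (t q) (dmass 0 q) (dmass 1 q) (dmass 0 q) (dmass 1 q).
have cF1 : continuous_in D F1.
  exact: (cin_mul (cin_mul cXi cXi) (cin_bracket a0 hf cm0 cm1 cm0 cm1)).
pose Ia q := dg (mass q) * (dg (mass q) * F1 q).
pose Ib q := dg2 (mass q) * (X q * bracket a f (t q) (dmass 0 q) (dmass 1 q) (X0 q) (X1 q)).
pose Ic q := g2 (mass q) * bracket a f (t q) (X0 q) (X1 q) (X0 q) (X1 q).
pose Id q := g2 (mass q) * (X q * (pot a f (t q) * B (t q) * X q + dens a f (t q) * Z q)).
pose Ie q := g2 (mass q) * (dens a f (t q) * (X q * Z q)).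
have G : int2 T Ib + int2 T Ic = int2 T Id.
  exact: (@green R a f a0 hf D T T0 DT mass (dmass 0) (dmass 1) mass_C1 mass_out g2 dg2
    X X0 X1 X X0 X1 Z hg2 hX hX cZ hZ).
have cIa : continuous Ia.
  have cI := dcutoff_continuous mass_C1 mass_out hg cF1.
  exact: (dcutoff_continuous mass_C1 mass_out hg (cin_global cI)).
have cIb : continuous Ib.
  exact: (dcutoff_continuous mass_C1 mass_out hg2 (cin_mul cXi (cin_bracket a0 hf cm0 cm1 cX0 cX1))).
have cIc : continuous Ic.
  exact: (cutoff_continuous mass_C1 mass_out hg2 (cin_bracket a0 hf cX0 cX1 cX0 cX1)).
have cg2 : continuous g2 by exact: (continuous_mul cg cg).
have cg2m : continuous (fun q => g2 (mass q)) by exact: (continuous_after cg2 cmass).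
have cId : continuous Id.
  apply: continuous_mul; first exact: cg2m.
  apply: continuous_mul; first exact: cX.
  apply: continuous_add; first by apply: continuous_mul; [exact: cpB|exact: cX].
  by apply: continuous_mul; [exact: cdens|exact: cZ].
have cXZ : continuous (fun q => X q * Z q) by exact: (continuous_mul cX cZ).
have cIe : continuous Ie.
  by apply: continuous_mul; [exact: cg2m|apply: continuous_mul; [exact: cdens|exact: cXZ]].
have E : int2 T (fun q => B (t q) * ((cond a f (t q) * w0 q + a / 2 * w1 q) ^+ 2 + w1 q ^+ 2
    - pot a f (t q) * w q ^+ 2)) = int2 T Ia + int2 T Ie.
  transitivity (int2 T (fun q => (Ia q + (Ib q + Ic q - Id q)) + Ie q)); last first.
    have cBC := continuous_add cIb cIc.
    have cBCD := continuous_add cBC (continuous_opp cId).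
    have cABCD := continuous_add cIa cBCD.
    rewrite (int2D _ cABCD cIe) (int2D _ cIa cBCD) (int2B _ cBC cId) (int2D _ cIb cIc) G.
    by rewrite subrr addr0.
  apply: int2_ext => q; rewrite mulrBr -bracket_sqr //.
  rewrite /Ia /Ib /Ic /Id /Ie /F1 /w /w0 /w1 /g2 /dg2 /bracket.
  move: (g (mass q)) (dg (mass q)) (dmass 0 q) (dmass 1 q) (X q) (X0 q) (X1 q) (Z q)
    (cond a f (t q)) (cocond a f (t q)) (pot a f (t q)) (dens a f (t q)).
  by move=> gg dgg m0 m1 x x0 x1 z A CC W om; ring.
have ba : `|int2 T Ia| <= 4 * kap ^+ 2 * (4 * N ^+ 4) * potential_mass.
  have n4 : 0 <= 4 * N ^+ 4 by apply: mulr_ge0; rewrite ?exprn_ge0 ?ler0n.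
  apply: (dcut2_int_le k0 d0 cF1 n4).
  move=> q _; rewrite /F1 normrM.
  apply: (@le_trans _ _ ((N * (N * mass q)) * (N * (N * (4 * (mass q * grad q)))))).
    apply: ler_pM; [exact: normr_ge0|exact: normr_ge0|exact: combination_sqr_le|].
    exact: bracket_dmass2_le.
  by move: (mass q) (grad q) N => m gr NN; rewrite le_eqVlt; apply/orP; left; apply/eqP; ring.
have Lam0 : 0 <= Lam by apply: sumr_ge0.
have be : `|int2 T (fun q => dens a f (t q) * (X q * Z q)) - int2 T Ie| <=
    2 * e * (N * (N * Lam)) * total_mass.
  have e0 : 0 <= e by rewrite ltW // (lt_le_trans k0).
  apply: exhaust_int_le => //.
  - move=> x; have /andP[h0 h1] := g01 x; rewrite /g2 mulr_ge0 //=.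
    by rewrite -[leRHS](mulr1 1) ler_pM.
  - by rewrite mulr_ge0.
  - move=> x x0; have /andP[h0 h1] := g01 x; have h := hcut x x0.
    apply: (@le_trans _ _ (2 * ((1 - g x) * x))); last by lra.
    rewrite (_ : 1 - g2 x = (1 + g x) * (1 - g x)); last by rewrite /g2; ring.
    by rewrite -mulrA ler_wpM2r ?mulr_ge0 ?subr_ge0 //; lra.
  - by rewrite !mulr_ge0 ?ler0n.
  - exact: combination_eq_le.
rewrite E in F0.
have p0 := potential_mass_ge0.
have k2 : 4 * kap ^+ 2 * (4 * N ^+ 4) * potential_mass <= e * (16 * N ^+ 4 * potential_mass).
  have ke2 : kap ^+ 2 <= e.
    have k1 := le_trans ke e1.
    by apply: le_trans ke; rewrite expr2 ler_piMl // ltW.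
  have m0 : 0 <= 16 * N ^+ 4 * potential_mass.
    by apply: mulr_ge0 => //; apply: mulr_ge0; rewrite ?exprn_ge0 ?ler0n.
  apply: le_trans (ler_wpM2r m0 ke2).
  by move: (N ^+ 4) potential_mass => NN p; rewrite le_eqVlt; apply/orP; left; apply/eqP; ring.
exact: (energy_arith F0 ba k2 be).
Qed.

End Energy.

Lemma gram_form (b c : 'I_n.+1 -> R) :
  int2 T (fun q => dens a f (t q) * ((\sum_i b i * u i q) * (\sum_j c j * u j q))) =
  \sum_i \sum_j b i * c j * gram i j.
Proof.
transitivity (int2 T (fun q => \sum_i \sum_j b i * c j * (dens a f (t q) * (u i q * u j q)))).
  apply: int2_ext => q; rewrite mulr_suml mulr_sumr; apply: eq_bigr => i _.
  by rewrite !mulr_sumr; apply: eq_bigr => j _; ring.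
have cij i j : continuous (fun q : plane => dens a f (t q) * (u i q * u j q)).
  apply: continuous_mul; first exact: cdens.
  by apply: continuous_mul; exact: cu.
have cbij i j : continuous (fun q : plane => b i * c j * (dens a f (t q) * (u i q * u j q))).
  by apply: continuous_mul; [exact: continuous_cst|exact: cij].
rewrite int2_sum; last by move=> i; apply: continuous_sum => j; exact: cbij.
apply: eq_bigr => i _; rewrite int2_sum; last by move=> j; exact: cbij.
by apply: eq_bigr => j _; rewrite int2Z.
Qed.

(** There are [n] linear conditions on [n + 1] coefficients. *)
Lemma exists_coefficients (g : R -> R) : continuous g ->
  exists2 c : 'rV[R]_n.+1, \sum_i c 0 i ^+ 2 = 1 & forall j, (j < n)%N ->
    defint 0 (2 * pi) (fun th => g (mass (pt 0 th)) * combination (fun i => c 0 i) (pt 0 th) * trig j th) = 0.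
Proof.
move=> cg.
have cI i (j : nat) : continuous (fun th => g (mass (pt 0 th)) * u i (pt 0 th) * trig j th).
  apply: continuous_mul; last exact: continuous_trig.
  apply: continuous_mul; last by apply: continuous_slice; exact: cu.
  by apply: (continuous_after cg); apply: continuous_slice; exact: cmass.
pose M : 'M[R]_(n.+1, n) := \matrix_(i, j)
  defint 0 (2 * pi) (fun th => g (mass (pt 0 th)) * u i (pt 0 th) * trig j th).
have [b b0 bM] := left_kernel M.
pose s := \sum_i b 0 i ^+ 2.
have s0 : 0 < s.
  rewrite lt_def; apply/andP; split; last by apply: sumr_ge0 => i _; exact: sqr_ge0.
  apply: contraNneq b0 => /eqP; rewrite psumr_eq0; last by move=> i _; exact: sqr_ge0.
  move=> /allP h; apply/eqP/rowP => i; rewrite mxE; apply/eqP.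
  by have := h i (mem_index_enum i); rewrite sqrf_eq0.
exists ((Num.sqrt s)^-1 *: b).
  under eq_bigr => i _ do rewrite mxE exprMn.
  by rewrite -mulr_sumr exprVn sqr_sqrtr ?ltW // mulVf // gt_eqF.
move=> j jn.
transitivity (defint 0 (2 * pi) (fun th => \sum_i ((Num.sqrt s)^-1 * b 0 i) *
   (g (mass (pt 0 th)) * u i (pt 0 th) * trig j th))).
  apply: defint_ext => th; rewrite /combination mulr_sumr mulr_suml.
  by apply: eq_bigr => i _; rewrite mxE; ring.
rewrite defint_sum; last by move=> i; apply: continuous_mul; [exact: continuous_cst|exact: cI].
under eq_bigr => i _ do rewrite defintZ //.
have /rowP/(_ (Ordinal jn)) := bM; rewrite !mxE => E.
transitivity ((Num.sqrt s)^-1 * \sum_i b 0 i * M i (Ordinal jn)); last by rewrite E mulr0.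
rewrite mulr_sumr.
by apply: eq_bigr => i _; rewrite mxE mulrA.
Qed.

Section Contradiction.
Variable K : nat.
Hypotheses (K_le : K%:R <= Num.sqrt (a ^+ 2 + 2)) (lt_K : Num.sqrt (a ^+ 2 + 2) < K.+1%:R).
Hypothesis nK : n = (2 * K).+1.
Hypothesis indep : forall l (b : 'I_n.+1 -> R),
  (forall q, \sum_(i | lam i == l) b i * u i q = 0) -> forall i, lam i = l -> b i = 0.

Let energy (c : 'rV[R]_n.+1) : R := \sum_i \sum_j c 0 i * (c 0 j * lam j) * gram i j.

Let energyE c : energy c =
  int2 T (fun q => dens a f (t q) * (combination (fun i => c 0 i) q * combination_eq (fun i => c 0 i) q)).
Proof.
rewrite /energy -gram_form; apply: int2_ext => q; rewrite /combination /combination_eq.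
by congr (_ * (_ * _)); apply: eq_bigr => i _; rewrite mulrA.
Qed.

Let energy_continuous : continuous energy.
Proof.
have cc i : continuous (fun c : 'rV[R]_n.+1 => c 0 i) by move=> c; exact: coord_continuous.
apply: continuous_sum => i; apply: continuous_sum => j.
apply: continuous_mul; last exact: continuous_cst.
apply: continuous_mul; first exact: cc.
by apply: continuous_mul; [exact: cc|exact: continuous_cst].
Qed.

(** Coefficients for which [energy] is at least [- e] depend on [e] through
   the cutoff; but they lie on the unit sphere, where [energy] has a maximum. *)
Let energy_nonneg : exists2 c : 'rV[R]_n.+1, \sum_i c 0 i ^+ 2 = 1 & 0 <= energy c.
Proof.
have [c c1 cmax] := sphere_max energy_continuous; exists c => //.
rewrite leNgt; apply/negP => neg.
pose C := 16 * N ^+ 4 * potential_mass + 2 * (N * (N * \sum_j `|lam j|)) * total_mass.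
have C0 : 0 <= C.
  have s0 : 0 <= \sum_j `|lam j| by apply: sumr_ge0.
  by rewrite addr_ge0 // mulr_ge0 ?potential_mass_ge0 ?total_mass_ge0 // !mulr_ge0 ?exprn_ge0 ?ler0n.
(* So that the error [e * C] is smaller than [- energy c]. *)
pose e := Num.min 1 (- energy c / (2 * (C + 1))).
have C1 : 0 < C + 1 by rewrite ltr_wpDl.
have e0 : 0 < e by rewrite lt_min ltr01 divr_gt0 ?oppr_gt0 // mulr_gt0.
have e1 : e <= 1 by rewrite ge_min lexx.
have eC : e * (2 * (C + 1)) <= - energy c.
  by rewrite -ler_pdivlMr ?mulr_gt0 // ge_min lexx orbT.
have [kap [del [/andP[k0 ke] d0 hcut]]] := cut_exhausts e0.
have cg : continuous (cut kap del) by exact: continuous_cut.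
have [b b1 borth] := exists_coefficients cg.
have orth j : (j < (2 * K).+1)%N -> defint 0 (2 * pi)
   (fun th => cut kap del (mass (pt 0 th)) * combination (fun i => b 0 i) (pt 0 th) * trig j th) = 0.
  by move=> jK; apply: borth; rewrite nK.
have := energy_ge b1 K_le lt_K k0 ke e1 d0 hcut orth.
rewrite -energyE -/C => h.
have := le_trans h (cmax b b1); rewrite leNgt => /negP; apply.
have h1 : e * C <= e * (C + 1) by rewrite ler_pM2l // lerDl.
have h2 : 0 < e * (C + 1) by rewrite mulr_gt0.
by move: eC; rewrite mulrCA mulNr; move: (e * C) (e * (C + 1)) (energy c) h1 h2 => x y z; lra.
Qed.

Let combination_eq0 (b : 'I_n.+1 -> R) : \sum_i \sum_j b i * b j * gram i j <= 0 ->
  forall q, \sum_i b i * u i q = 0.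
Proof.
move=> h q; pose Y q := \sum_i b i * u i q.
have cY : continuous Y.
  by apply: continuous_sum => i; apply: continuous_mul; [exact: continuous_cst|exact: cu].
have pY : periodic Y.
  by move=> p; apply: eq_bigr => i _; have [_ pu _ _ _] := eigen i; rewrite pu.
have [Dq|nD] := pselect (D q); last first.
  by rewrite big1 // => i _; have [_ _ z _ _] := eigen i; rewrite z // mulr0.
have cw : continuous (fun q : plane => dens a f (t q) * (Y q * Y q)).
  exact: (continuous_mul cdens (continuous_mul cY cY)).
have pw : periodic (fun q : plane => dens a f (t q) * (Y q * Y q)).
  by move=> p; rewrite pY mxE turn0 addr0.
have w0 (p : plane) : 0 <= dens a f (t p) * (Y p * Y p).
  by rewrite mulr_ge0 ?(ltW (dens_gt0 a0 hf _)) // -expr2 sqr_ge0.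
have I0 : int2 T (fun q => dens a f (t q) * (Y q * Y q)) = 0.
  by apply/eqP; rewrite eq_le int2_ge0 // andbT; rewrite gram_form.
have := int2_eq0 cw pw T0 w0 I0 (DT Dq).
by move=> /eqP; rewrite mulf_eq0 gt_eqF ?(dens_gt0 a0 hf) //= mulf_eq0 orbb => /eqP.
Qed.

(** Eigenfunctions of different eigenvalues being orthogonal, [energy c] is
   minus the square norm of the combination with coefficients [b i = sqrt (-
   lam i) * c i]. This combination is therefore zero, and so are its
   components in the eigenspaces; by independence [b = 0], although [c] has
   norm [1]. *)
Lemma no_large_family : False.
Proof.
have [c c1 ec] := energy_nonneg.
pose b i := Num.sqrt (- lam i) * c 0 i.
have sq i : Num.sqrt (- lam i) ^+ 2 = - lam i by rewrite sqr_sqrtr // oppr_ge0 ltW.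
have E : energy c = - \sum_i \sum_j b i * b j * gram i j.
  rewrite /energy -sumrN; apply: eq_bigr => i _; rewrite -sumrN; apply: eq_bigr => j _.
  have [lij|/eqP lij] := eqVneq (lam i) (lam j); last by rewrite gram_orth // !mulr0 oppr0.
  have -> : b i * b j = c 0 i * (c 0 j * (Num.sqrt (- lam j) ^+ 2)) by rewrite /b lij; ring.
  by rewrite sq; ring.
have Y0 q : \sum_i b i * u i q = 0.
  by apply: combination_eq0; rewrite -oppr_ge0 -E.
have b0 i : b i = 0.
  pose bl j := if lam j == lam i then b j else 0.
  have bl0 q : \sum_j bl j * u j q = 0.
    apply: combination_eq0.
    have -> : \sum_j \sum_k bl j * bl k * gram j k = \sum_j \sum_k bl j * b k * gram j k.
      apply: eq_bigr => j _; apply: eq_bigr => k _; rewrite /bl.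
      case: (eqVneq (lam j) (lam i)) => lj; last by rewrite !mul0r.
      case: (eqVneq (lam k) (lam i)) => // /eqP lk.
      by rewrite gram_orth ?mulr0 // lj => /esym.
    rewrite -gram_form (_ : int2 T _ = int2 T (fun=> 0)); last first.
      by apply: int2_ext => p; rewrite Y0 !mulr0.
    by rewrite /int2; under defint_ext => s do rewrite defint_cst mul0r; rewrite defint_cst mul0r.
  apply: (indep (l := lam i)) => // q; rewrite -[RHS](bl0 q) big_mkcond.
  by apply: eq_bigr => j _; rewrite /bl; case: ifP => // _; rewrite mul0r.
have c0 i : c 0 i = 0.
  have := b0 i; rewrite /b => /eqP; rewrite mulf_eq0 => /orP[|/eqP //].
  by rewrite sqrtr_eq0 oppr_le0 leNgt lam_neg.
have := c1; rewrite big1 => [/eqP|i _]; last by rewrite c0 expr0n.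
by rewrite eq_sym oner_eq0.
Qed.

End Contradiction.
End Family.

(** * The upper bound and the theorem *)

Section IndexUpperBound.
Context {R : realType}.
Variables (g : 'rV[R]_3 -> 'M[R]_3) (F : 'rV[R]_2 -> 'rV[R]_3) (D : set 'rV[R]_2).
Local Notation E := (dirichlet_eigenspace g F D).

(** Independence within each eigenspace; between eigenspaces it follows from
   [gram_orth]. *)
Definition eigen_indep k (lam : 'I_k -> R) (u : 'I_k -> 'rV[R]_2 -> R) :=
  forall l (b : 'I_k -> R), (forall q, \sum_(i | lam i == l) b i * u i q = 0) ->
  forall i, lam i = l -> b i = 0.

Definition has_indep l m := exists u : 'I_m -> 'rV[R]_2 -> R, (forall i, E l (u i)) /\ lin_indep u.

Lemma has_indep_le l m k : (k <= m)%N -> has_indep l m -> has_indep l k.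
Proof.
move=> km; rewrite -(subnKC km); move: (m - k)%N => r [u [Eu Lu]].
exists (fun i => u (lshift r i)); split=> // c H i.
pose c' (j : 'I_(k + r)) := match fintype.split j with inl i => c i | inr _ => 0 end.
have <- : c' (lshift r i) = c i by rewrite /c' (unsplitK (inl i)).
apply: Lu => x; rewrite big_split_ord /= [X in _ + X]big1 ?addr0 => [|j _].
  by rewrite -[RHS](H x); apply: eq_bigr => j _; rewrite /c' (unsplitK (inl j)).
by rewrite /c' (unsplitK (inr j)) mul0r.
Qed.

Lemma eigen_family (s : seq R) (m : R -> nat) k : uniq s ->
  (forall l, l \in s -> has_indep l (m l)) -> (k <= \sum_(l <- s) m l)%N ->
  exists (lam : 'I_k -> R) (u : 'I_k -> 'rV[R]_2 -> R),
    [/\ (forall j, lam j \in s), (forall j, E (lam j) (u j)) & eigen_indep lam u].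
Proof.
elim: s k => [|l s IH] k /=.
  rewrite big_nil leqn0 => _ _ /eqP ->.
  by exists (fun=> 0), (fun=> fun=> 0); split; [case|case|move=> ? ? ? []].
case/andP=> ls us Hs; rewrite big_cons => km.
pose k1 := minn k (m l); pose k2 := (k - k1)%N.
have kE : k = (k1 + k2)%N by rewrite /k2 subnKC // geq_minl.
have [||lam [u [lams Eu Lu]]] := IH k2 us.
- by move=> l' ls'; apply: Hs; rewrite inE ls' orbT.
- by rewrite /k2 /k1; lia.
have [u1 [Eu1 Lu1]] : has_indep l k1.
  by apply: (has_indep_le (geq_minr _ _)); apply: Hs; rewrite inE eqxx.
rewrite kE.
exists (fun i => match fintype.split i with inl _ => l | inr j => lam j end),
       (fun i => match fintype.split i with inl j => u1 j | inr j => u j end).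
have sl i : fintype.split (lshift k2 i) = inl i :> 'I_k1 + 'I_k2 := unsplitK (inl i).
have sr i : fintype.split (rshift k1 i) = inr i :> 'I_k1 + 'I_k2 := unsplitK (inr i).
split.
- by move=> j; case: (fintype.split j) => i; rewrite inE ?eqxx // lams orbT.
- by move=> j; case: (fintype.split j) => i; [exact: Eu1|exact: Eu].
move=> l0 b H.
have H' q : \sum_(i < k1 | l == l0) b (lshift k2 i) * u1 i q +
            \sum_(i < k2 | lam i == l0) b (rshift k1 i) * u i q = 0.
  rewrite -[RHS](H q) big_split_ord; congr (_ + _); apply: eq_big => i; rewrite ?sl ?sr //.
have [l0E|l0E] := eqVneq l l0.
  have b1 j : b (lshift k2 j) = 0.
    apply: (Lu1 (fun i => b (lshift k2 i))) => q; rewrite -[RHS](H' q).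
    rewrite [X in _ = _ + X]big1 ?addr0; last first.
      by move=> i /eqP E'; have := lams i; rewrite E' -l0E (negbTE ls).
    by apply: eq_bigl => i; rewrite l0E eqxx.
  move=> i; rewrite -[i]splitK; case: (fintype.split i) => j; rewrite unsplitK => lj.
    exact: b1.
  by have := lams j; rewrite lj -l0E (negbTE ls).
have b2 := Lu l0 (fun i => b (rshift k1 i)).
move=> i; rewrite -[i]splitK; case: (fintype.split i) => j; rewrite unsplitK => lj.
  by rewrite lj eqxx in l0E.
apply: b2 => // q; rewrite -[RHS](H' q) [X in _ = X + _]big1 ?add0r //.
by move=> i' /eqP E'; rewrite E' eqxx in l0E.
Qed.

(** The dimensions of the eigenspaces are bounded by [N], hence attained by
   finite families. If finitely many of them had a sum above [N], these
   families would together contain [N + 1] independent eigenfunctions. *)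
Lemma domain_index_le N :
  (forall (lam : 'I_N.+1 -> R) u, (forall j, lam j < 0) -> (forall j, E (lam j) (u j)) ->
     eigen_indep lam u -> False) ->
  (domain_index g F D <= N%:R%:E)%E.
Proof.
move=> H.
have bound l m : l < 0 -> has_indep l m -> (m <= N)%N.
  move=> l0 hm; rewrite leqNgt; apply/negP => Nm.
  have [|||lam [u [lams Eu Lu]]] := @eigen_family [:: l] (fun=> N.+1) N.+1 => //.
  - by move=> l'; rewrite inE => /eqP ->; exact: has_indep_le hm.
  - by rewrite big_seq1.
  by apply: (H lam u) => // j; have := lams j; rewrite inE => /eqP ->.
have attained l : exists m, l < 0 -> has_indep l m /\ (dimension (E l) <= m%:R%:E)%E.
  have [l0|l0] := ltP l 0; last by exists 0%N.
  have ex : exists i, `[<has_indep l i>].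
    exists 0%N; apply/asboolP; exists (fun=> fun=> 0); split; first by case.
    by move=> c _ [].
  have ub i : `[<has_indep l i>] -> (i <= N)%N by move/asboolP; exact: bound.
  case: (ex_maxnP ex ub) => m /asboolP hm mmax; exists m => _; split=> //.
  apply: ge_ereal_sup => _ [k hk <-]; rewrite lee_fin ler_nat.
  by apply: mmax; apply/asboolP.
have [m Hm] := choice attained.
apply: ge_ereal_sup => _ [X [finX XI] <-]; rewrite fsbig_finite //.
set s := finmap.enum_fset (fset_set X).
have s0 l : l \in s -> l < 0.
  move=> ls; apply: XI; have : l \in X by rewrite -(in_fset_set finX).
  by rewrite inE.
apply: (@le_trans _ _ (\sum_(l <- s) m l)%:R%:E).
  rewrite natr_sum -sumEFin big_seq [leRHS]big_seq.
  by apply: lee_sum => l ls; have [] := Hm l (s0 l ls).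
rewrite lee_fin ler_nat leqNgt; apply/negP => Ns.
have us : uniq s by exact: finmap.fset_uniq.
have [|lam [u [lams Eu Lu]]] := @eigen_family s m N.+1 us _ Ns.
  by move=> l ls; have [] := Hm l (s0 l ls).
by apply: (H lam u) => // j; exact/s0/lams.
Qed.

End IndexUpperBound.

Section UpperBound.
Context {R : realType}.
Variables (a : R) (f : R -> R).
Hypotheses (a0 : 0 < a) (hf : catenoid_profile a f).
Local Notation plane := 'rV[R]_2.

(** The height is bounded on the compact closure of the image in the cylinder. *)
Lemma regular_bounded (D : set plane) : regular_domain D ->
  exists2 T : R, 0 <= T & forall q : plane, D q -> `|q 0 0| < T.
Proof.
move=> [_ [_ [p Dp]] _ cD _].
have [||c _ Hc] := @EVT_max_rV R 3 (fun v => `|v 0 2%:R|) (closure (to_cylinder @` D)) _ cD.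
- by exists (to_cylinder p); apply: subset_closure; exists p.
- have cc : continuous (fun v : 'rV[R]_3 => v 0 2%:R) by move=> v; exact: coord_continuous.
  by apply: continuous_subspaceT => v; exact: (cvg_norm (cc v)).
exists (`|c 0 2%:R| + 1) => [|q Dq]; first by rewrite addr_ge0.
have := Hc (to_cylinder q); rewrite inE => h.
have {}h : `|(to_cylinder q : 'rV[R]_3) 0 2%:R| <= `|c 0 2%:R|.
  by apply: h; apply: subset_closure; exists q.
by rewrite /to_cylinder /revolution mxE /= in h; apply: le_lt_trans h _; rewrite ltrDl.
Qed.

Lemma index_le K : K%:R <= Num.sqrt (a ^+ 2 + 2) -> Num.sqrt (a ^+ 2 + 2) < K.+1%:R ->
  (catenoid_index f <= (1 + 2 * K)%N%:R%:E)%E.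
Proof.
move=> K1 K2; apply: ge_ereal_sup => _ [D hD <-]; rewrite add1n.
have [T T0 DT] := regular_bounded hD.
apply: domain_index_le => lam u lam0 Eu Lu.
exact: (no_large_family a0 hf T0 DT Eu lam0 K1 K2 erefl Lu).
Qed.

End UpperBound.

Theorem theorem4p4 (R : realType) (f : R -> R -> R)
  (hf : forall a : R, 0 < a -> catenoid_profile a (f a)) :
  ((forall a : R, 0 < a ->
      [/\ catenoid_index (f a) \is a fin_num,
          (3%:E <= catenoid_index (f a))%E
        & (catenoid_index (f a)
             <= (1 + 2 * (Num.floor (Num.sqrt (a ^+ 2 + 2)))%:~R)%:E)%E]) /\
   (\forall a \near (0 : R)^'+, catenoid_index (f a) = 3%:E)) /\
  (((Num.sqrt 3)%:E
      <= limf_einf (fun a : R => catenoid_index (f a) * (a^-1)%:E)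
           (pinfty_nbhs R))%E /\
   catenoid_index (f a) @[a --> +oo] --> +oo%E).
Proof.
have lower (a : R) : 3 <= a -> ((Num.sqrt 3 * a - 3)%:E <= catenoid_index (f a))%E.
  move=> a2; have a0 : 0 < a by apply: lt_le_trans a2.
  have s3 : (1 : R) <= Num.sqrt 3 by rewrite -[leLHS]sqrtr1 ler_wsqrtr // ler1n.
  have ss : Num.sqrt 3 ^+ 2 = 3 :> R by rewrite sqr_sqrtr.
  (* The integer part [K] of [x] satisfies [4 K ^ 2 + 4 < 3 a ^ 2], and [1 +
     2 K > 2 x - 1 = sqrt 3 a - 3]. *)
  pose x : R := Num.sqrt 3 * a / 2 - 1.
  have sa : 3 <= Num.sqrt 3 * a.
    by rewrite -[leLHS]mul1r ler_pM.
  have x0 : 0 <= x by rewrite /x; lra.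
  have [K KE] : exists K : nat, Num.floor x = K.
    by have := floor_ge0 x; rewrite x0; case: (Num.floor x) => // K _; exists K.
  have /andP[k1 k2] := floor_itv x; rewrite KE in k1 k2.
  have {}k1 : K%:R <= x := k1.
  have {}k2 : x < K%:R + 1 by move: k2; rewrite intrD.
  have large : 4 * K%:R ^+ 2 + 4 < 3 * a ^+ 2.
    have h : K%:R ^+ 2 <= x ^+ 2 by rewrite lerXn2r ?nnegrE ?ler0n.
    have e : 4 * x ^+ 2 = 3 * a ^+ 2 - 4 * (Num.sqrt 3 * a) + 4.
      by rewrite /x; field: ss.
    by lra.
  apply: le_trans (index_ge_large a0 (hf a a0) large).
  by rewrite lee_fin natrD natrM; rewrite /x in k2; lra.
have upper (a : R) : 0 < a -> (catenoid_index (f a)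
             <= (1 + 2 * (Num.floor (Num.sqrt (a ^+ 2 + 2)))%:~R)%:E)%E.
  move=> a0; set x := Num.sqrt _.
  have [K KE] : exists K : nat, Num.floor x = K.
    by have := floor_ge0 x; rewrite sqrtr_ge0; case: (Num.floor x) => // K _; exists K.
  have /andP[k1 k2] := floor_itv x; rewrite KE in k1 k2 *.
  have := index_le a0 (hf a a0) (K := K) k1; rewrite -/x natrD natrM; apply.
  by move: k2; rewrite intrD -natr1.
split; split.
- move=> a a0; have i3 := index_ge3 a0 (hf a a0); split; [|exact: i3|exact: upper].
  rewrite fin_numElt (lt_le_trans _ i3) ?ltNyr //=.
  by apply: le_lt_trans (upper a a0) _; rewrite ltry.
- near=> a; have a0 : 0 < a by [].
  (* Then [1 <= sqrt (a ^ 2 + 2) < 2], so the two bounds of the index agree. *)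
  have a1 : a < 1 by [].
  apply/le_anti/andP; split; last exact: (index_ge3 a0 (hf a a0)).
  apply: (index_le (K := 1) a0 (hf a a0)).
    by rewrite -[leLHS]sqrtr1 ler_wsqrtr //; have := sqr_ge0 a; lra.
  have E : Num.sqrt (2 ^+ 2) = 2 :> R by rewrite sqrtr_sqr ger0_norm.
  rewrite -[X in _ < X]E ltr_sqrt ?exprn_gt0 //.
  have : a ^+ 2 < 1 by rewrite expr_lt1 // ltW.
  by lra.
- rewrite /limf_einf leeNr; apply/lee_addgt0Pr => e e0.
  apply: (@le_trans _ _ (ereal_sup [set (- (catenoid_index (f a) * (a^-1)%:E))%E | a in [set a : R | Num.max 3 (3 / e) < a]])).
    apply: ereal_inf_lbound; exists [set a : R | Num.max 3 (3 / e) < a] => //.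
    by apply: nbhs_pinfty_gt; rewrite num_real.
  apply: ge_ereal_sup => _ [a /= + <-]; rewrite gt_max => /andP[a2 ae].
  have a0 : 0 < a by apply: lt_trans a2.
  rewrite -EFinD leeNl -EFinN opprD opprK.
  have := lee_wpmul2r _ (lower a (ltW a2)) => /(_ (a^-1)%:E).
  rewrite lee_fin invr_ge0 (ltW a0) => /(_ isT); apply: le_trans.
  rewrite -EFinM lee_fin mulrBl mulfK ?gt_eqF // lerD2l lerN2.
  by rewrite ler_pdivrMr // mulrC -ler_pdivrMr // ltW.
- apply/cvgeyPge => A; near=> a.
  apply: le_trans (lower a _); last by near: a; exact: nbhs_pinfty_ge.
  rewrite lee_fin.
  have aA : A + 3 <= a by near: a; apply: nbhs_pinfty_ge; rewrite num_real.
  have a2 : 3 <= a by near: a; exact: nbhs_pinfty_ge.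
  have s3 : (1 : R) <= Num.sqrt 3 by rewrite -[leLHS]sqrtr1 ler_wsqrtr // ler1n.
  have : 1 * a <= Num.sqrt 3 * a by rewrite ler_wpM2r // (le_trans _ a2).
  by lra.
Unshelve. all: by end_near. Qed.
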